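(* Let $\alpha\in(0,1)$, $\theta>0$, let $H$ be a nonatomic probability measure on a Polish space $\mathbb{X}$ and let $f:\mathbb{X}\to\mathbb{R}^+$ be measurable with $\int_{\mathbb{X}} f^\alpha\,dH<\infty$. Let $Q_{\alpha,0}$ be the probability distribution of $\tilde P_{\alpha,0}(f)=\int f\,d\tilde P_{\alpha,0}$, where $\tilde P_{\alpha,0}$ is a PD$(\alpha,0)$ random probability measure with $\mathbb{E}[\tilde P_{\alpha,0}(\cdot)]=H(\cdot)$. Then $$\tilde P_{\alpha,\theta}(f)\stackrel{d}{=}\int_{\mathbb{R}^+}x\,\tilde P_{0,\theta}(dx),$$ where $\tilde P_{\alpha,\theta}$ is a PD$(\alpha,\theta)$ random probability measure with $\mathbb{E}[\tilde P_{\alpha,\theta}(\cdot)]=H(\cdot)$ and $\tilde P_{0,\theta}$ is a Dirichlet process with $\mathbb{E}[\tilde P_{0,\theta}(\cdot)]=Q_{\alpha,0}(\cdot)$ (i.e. parameter measure $\theta Q_{\alpha,0}$). Moreover, the probability distribution of $\tilde P_{\alpha,\theta}(f)$ is absolutely continuous with respect to Lebesgue measure on $\mathbb{R}$.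
   Context: For $0\le\alpha<1$, $\theta>-\alpha$ and a probability measure $\mu$ on a space $S$, a PD$(\alpha,\theta)$ random probability measure with mean $\mu$ is $\sum_{k\ge1}W_k\delta_{Z_k}$, where $V_k$ are independent with $V_k\sim\mathrm{Beta}(1-\alpha,\theta+k\alpha)$, $W_1=V_1$, $W_k=V_k\prod_{j<k}(1-V_j)$ for $k\ge2$, and $Z_k$ are i.i.d. with law $\mu$, independent of $(V_k)$. The case $\alpha=0$, $\theta>0$ is the Dirichlet process with parameter measure $\theta\mu$.
   Formalization: The formal theorem additionally assumes that f is not H-almost surely constant; for constant f = c the variable equals c almost surely, so its law is a point mass and the absolute continuity claim fails. *)

(* Defs.v *)
From HB Require Import structures.
From mathcomp Require Import all_boot all_order all_algebra.
From mathcomp Require Import all_classical all_reals all_analysis.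
From mathcomp Require Import measurable_realfun.
Set Implicit Arguments. Unset Strict Implicit. Unset Printing Implicit Defensive.
Import Order.TTheory GRing.Theory Num.Theory.
Local Open Scope classical_set_scope.
Local Open Scope ring_scope.

Definition indep_events d (T : measurableType d) (R : realType)
  (P : probability T R) (I : eqType) (E : I -> set T) : Prop :=
  forall s : seq I, uniq s ->
    P (\big[setI/setT]_(i <- s) E i) = (\prod_(i <- s) P (E i))%E.

Definition stick_indep d (T : measurableType d) (R : realType)
  (P : probability T R) d1 (T1 : measurableType d1) d2 (T2 : measurableType d2)
  (V : nat -> T -> T1) (Z : nat -> T -> T2) : Prop :=
  forall (A : nat -> set T1) (B : nat -> set T2),
    (forall k, measurable (A k)) -> (forall k, measurable (B k)) ->
    indep_events P (fun i : nat + nat =>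
      match i with inl k => V k @^-1` A k | inr k => Z k @^-1` B k end).

Definition has_law d (T : measurableType d) (R : realType)
  (P : probability T R) d' (T' : measurableType d') (X : T -> T')
  (mu : set T' -> \bar R) : Prop :=
  forall B, measurable B -> P (X @^-1` B) = mu B.

Definition beta_dens (R : realType) (a b : R) (x : R) : R :=
  x `^ (a - 1) * (1 - x) `^ (b - 1).

Definition beta_law (R : realType) (a b : R) (A : set R) : \bar R :=
  (fine (\int[lebesgue_measure]_(x in A `&` `]0%R, 1%R[) (beta_dens a b x)%:E)
   / fine (\int[lebesgue_measure]_(x in `]0%R, 1%R[) (beta_dens a b x)%:E))%:E.

(* (V, Z) is a stick-breaking representation of a PD(alpha, theta) random
   probability measure with mean mu: V_k ~ Beta(1-alpha, theta + k alpha)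
   (k >= 1; here indexed from 0), Z_k iid ~ mu, all independent. *)
Definition PD_stick d (T : measurableType d) (R : realType)
  (alpha theta : R) d' (S : measurableType d') (mu : set S -> \bar R)
  (P : probability T R) (V : nat -> T -> R) (Z : nat -> T -> S) : Prop :=
  [/\ forall k, measurable_fun setT (V k),
      forall k, measurable_fun setT (Z k),
      stick_indep P V Z,
      forall k, has_law P (V k) (beta_law (1 - alpha) (theta + k.+1%:R * alpha))
    & forall k, has_law P (Z k) mu].

Definition stick_weight (T : Type) (R : realType) (V : nat -> T -> R)
  (k : nat) (w : T) : R :=
  V k w * \prod_(j < k) (1 - V j w).

(* int g dP~ = sum_k W_k g(Z_k), with g(Z_k) given as g k w *)
Definition stick_integral (T : Type) (R : realType) (V : nat -> T -> R)
  (g : nat -> T -> \bar R) (w : T) : \bar R :=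
  (\sum_(0 <= k <oo) ((stick_weight V k w)%:E * g k w))%E.

Definition nonatomic d (S : measurableType d) (R : realType)
  (H : set S -> \bar R) : Prop :=
  forall A, measurable A -> (0 < H A)%E ->
    exists2 B, measurable B & [/\ B `<=` A, (0 < H B)%E & (H B < H A)%E].

(* Main.v *)
(* Let X_s be the integral of f under PD(alpha, s). Splitting off the first stick gives
   X_s = V f(Z) + (1 - V) X_{s+alpha} in law; for bounded f this is a recursion between the
   coefficients of E((1 - z X_s)^(-s)) at s and s + alpha, whose solutions satisfy
   E((1 - z X_{s+t})^(-s-t)) = E((1 - z X_s)^(-s)) E((1 - z X_t)^(-t)) for s in alpha N.
   Combined with the recursions at 0 and at theta it yields
   X_theta = B X_0 + (1 - B) X_theta in law, B ~ Beta(1, theta), since bounded laws are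
   determined by their moments, and truncation removes the boundedness of f. This is the
   distributional equation of the mean of a Dirichlet process with parameter theta Q, and
   its finite solution is unique because iterating it multiplies the remainder by a vanishing
   product of sticks. Finiteness follows from a Borel-Cantelli truncation of f^alpha at level
   k + c in the k-th stick. Absolute continuity: given f(Z) <> X_{theta+alpha} the law of
   V f(Z) + (1 - V) X_{theta+alpha} has a density, and f(Z) = X_{theta+alpha} has probability
   zero because the same splitting excludes atoms when f is not a.s. constant. *)
Require Import Defs.
From HB Require Import structures.
From mathcomp Require Import all_boot all_order all_algebra.
From mathcomp Require Import all_classical all_reals all_analysis.
From mathcomp Require Import measurable_realfun.
From mathcomp Require Import ring lra.
Import Order.TTheory GRing.Theory Num.Theory.
Import numFieldNormedType.Exports.
Local Open Scope classical_set_scope.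
Local Open Scope ring_scope.
Set Implicit Arguments. Unset Strict Implicit. Unset Printing Implicit Defensive.

(** * Rising factorials and convolutions *)

(** The algebra rests on one Beta identity: for V ~ Beta(p, q), E (1 - z (V x + (1 - V) y))^(-p-q) =
    (1 - z x)^(-p) (1 - z y)^(-q). With C_s(z) = E (1 - z X_s)^(-s) and h(z) = E (1 - z
    f(Z))^(-(1-alpha)) it turns the stick splitting into E (1 - z X_s)^(-s-1) = h C_{s+alpha}. At s
    = theta the right side is h C_alpha C_theta by multiplicativity, and h C_alpha = E (1 - z
    X_0)^(-1) is the case s = 0; read backwards with p = 1, q = theta, the identity shows the
    transform of B X_0 + (1 - B) X_theta. The obstacle is multiplicativity: the recursion climbs
    from s to s + alpha without a starting value, since C_0 = 1 says nothing about X_0, and no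
    closed form of C_s is used. Uniqueness is read off at infinity instead: the n-th coefficients of
    both sides lie between 0 and M^n (s)_n / n!, and climbing N steps bounds their difference by
    this quantity times the product over k < N of (s + (k+1) alpha) / (s + k alpha + 1), which tends
    to 0. Only coefficients are manipulated, so no power series has to converge. *)

Definition rising {R : realType} (a : R) (n : nat) : R := \prod_(i < n) (a + i%:R).

Definition rising_coef {R : realType} (a : R) (n : nat) : R := rising a n / n`!%:R.

Definition conv {R : realType} (f g : nat -> R) (n : nat) : R :=
  \sum_(k < n.+1) f k * g (n - k)%N.

Section rising_factorials.
Variable R : realType.
Implicit Types (a b s t : R) (f g h : nat -> R).

Lemma rising0 a : rising a 0 = 1.
Proof. by rewrite /rising big_ord0. Qed.

Lemma risingS a n : rising a n.+1 = rising a n * (a + n%:R).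
Proof. by rewrite /rising big_ord_recr. Qed.

Lemma risingSl a n : rising a n.+1 = a * rising (a + 1) n.
Proof.
rewrite /rising big_ord_recl addr0; congr (_ * _); apply: eq_bigr => i _.
by rewrite lift0 -addn1 natrD [i%:R + 1]addrC addrA.
Qed.

Lemma rising_ge0 a n : 0 <= a -> 0 <= rising a n.
Proof. by move=> a0; apply: prodr_ge0 => i _; rewrite addr_ge0. Qed.

Lemma rising_gt0 a n : 0 < a -> 0 < rising a n.
Proof. by move=> a0; apply: prodr_gt0 => i _; rewrite ltr_wpDr. Qed.

Lemma rising_coef0 a : rising_coef a 0 = 1.
Proof. by rewrite /rising_coef rising0 fact0 divr1. Qed.

Lemma rising_coefS a n :
  n.+1%:R * rising_coef a n.+1 = (a + n%:R) * rising_coef a n.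
Proof.
rewrite /rising_coef risingS factS natrM.
have n0 : n.+1%:R != 0 :> R by rewrite pnatr_eq0.
have f0 : n`!%:R != 0 :> R by rewrite pnatr_eq0 -lt0n fact_gt0.
by field; rewrite f0 nat1r n0.
Qed.

Lemma rising_coef_ge0 a n : 0 <= a -> 0 <= rising_coef a n.
Proof. by move=> a0; rewrite divr_ge0// rising_ge0. Qed.

Lemma rising_coef_gt0 a n : 0 < a -> 0 < rising_coef a n.
Proof. by move=> a0; rewrite divr_gt0 ?rising_gt0// ltr0n fact_gt0. Qed.

Lemma rising_coef_vandermonde s t n :
  conv (rising_coef s) (rising_coef t) n = rising_coef (s + t) n.
Proof.
elim: n => [|n IH].
  by rewrite /conv big_ord_recl big_ord0 !rising_coef0 mulr1 addr0.
have n0 : n.+1%:R != 0 :> R by rewrite pnatr_eq0.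
apply: (mulfI n0); rewrite rising_coefS -IH /conv.
transitivity (\sum_(k < n.+2) (k%:R * rising_coef s k) * rising_coef t (n.+1 - k)%N
   + \sum_(k < n.+2) rising_coef s k * ((n.+1 - k)%N%:R * rising_coef t (n.+1 - k)%N)).
  rewrite -big_split/= mulr_sumr; apply: eq_bigr => k _.
  have kn : (k <= n.+1)%N by rewrite -ltnS.
  by rewrite natrB//; ring.
rewrite big_ord_recl/= mul0r mul0r add0r.
rewrite [X in _ + X]big_ord_recr/= subnn mul0r mulr0 addr0 -big_split/= mulr_sumr.
apply: eq_bigr => k _; rewrite /bump/= add1n subSS.
have kn : (k <= n)%N by rewrite -ltnS.
rewrite rising_coefS subSn// rising_coefS natrB//; ring.
Qed.

(** Source of the contraction in [conv_coef_add]. As (r + n) (r)_n = r (r + 1)_n, it compares (r +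
    al)_n with (r + 1)_n factor by factor: the first factors have ratio (r + al) / (r + 1), the
    others at most 1. *)
Lemma rising_coef_step (al r : R) n : 0 < al < 1 -> 0 <= r -> (0 < n)%N ->
  r * rising_coef (r + al) n <=
  (r + n%:R) * rising_coef r n * ((r + al) / (r + 1)).
Proof.
move=> /andP[al0 al1] r0; case: n => // n _.
have -> : (r + n.+1%:R) * rising_coef r n.+1 = r * rising_coef (r + 1) n.+1.
  rewrite /rising_coef !mulrA; congr (_ / _).
  by rewrite -risingSl mulrC -risingS.
rewrite -mulrA ler_wpM2l// /rising_coef mulrAC ler_wpM2r ?invr_ge0//.
rewrite !risingSl mulrAC mulrA [(r + 1) * _]mulrC -[_ * _ / _ * _]mulrA.
rewrite mulrA mulfK; last by apply: lt0r_neq0; lra.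
rewrite ler_wpM2l//; first lra.
apply: ler_prod => i _; apply/andP; split; last by lra.
by rewrite addr_ge0//; lra.
Qed.

(** The n-th term of a convolution reads no index beyond n, so truncation to polynomials loses
    nothing and the ring laws of polynomials carry over. *)
Lemma convE (N : nat) f g n : (n < N)%N ->
  conv f g n = ((\poly_(k < N) f k) * (\poly_(k < N) g k))`_n.
Proof.
move=> nN; rewrite coefM; apply: eq_bigr => k _.
rewrite !coef_poly (leq_ltn_trans _ nN) ?(leq_ltn_trans _ nN)//.
- exact: leq_subr.
- by rewrite -ltnS.
Qed.

Lemma eq_conv f f' g g' n : (forall k, (k <= n)%N -> f k = f' k) ->
  (forall k, (k <= n)%N -> g k = g' k) -> conv f g n = conv f' g' n.
Proof.
move=> ff gg; apply: eq_bigr => k _.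
by rewrite ff ?gg ?leq_subr// -ltnS.
Qed.

Lemma convC f g n : conv f g n = conv g f n.
Proof. by rewrite !(@convE n.+1)// mulrC. Qed.

Lemma convA f g h n : conv f (conv g h) n = conv (conv f g) h n.
Proof.
rewrite !(@convE n.+1)//.
transitivity ((\poly_(k < n.+1) f k * (\poly_(k < n.+1) g k * \poly_(k < n.+1) h k))`_n).
  rewrite !coefM; apply: eq_bigr => k _; congr (_ * _).
  by rewrite coef_poly ltnS leq_subr (@convE n.+1)// ltnS leq_subr.
rewrite mulrA !coefM; apply: eq_bigr => k _; congr (_ * _).
by rewrite coef_poly ltn_ord (@convE n.+1).
Qed.

Lemma convCA f g h n : conv f (conv g h) n = conv g (conv f h) n.
Proof.
rewrite !convA; apply: eq_conv => // k _; exact: convC.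
Qed.

Lemma convB f g h n : conv f (fun k => g k - h k) n = conv f g n - conv f h n.
Proof. by rewrite /conv -sumrB; apply: eq_bigr => k _; rewrite mulrBr. Qed.

(** In an induction on the order, once the lower coefficients of f vanish, convolution with a series
    of constant term 1 acts as the identity. *)
Lemma conv_lead h f n : h 0%N = 1 -> (forall k, (k < n)%N -> f k = 0) ->
  conv h f n = f n.
Proof.
move=> h0 f0; rewrite /conv big_ord_recl/= subn0 h0 mul1r big1 ?addr0// => i _.
by rewrite f0 ?mulr0// /bump/= add1n ltn_subrL/= (leq_ltn_trans _ (ltn_ord i)).
Qed.

(** Follows from 1 - u <= exp(-u) and ln(1 + 1/x) <= 1/x. With x = (th + 1) / al + N and be = (1 -
    al) / al the left side is the N-th mean stick factor, while the right side telescopes in N. *)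
Lemma powR_ratio_ge (be x : R) : 0 < be -> 0 < x ->
  1 - be / x <= (x / (x + 1)) `^ be.
Proof.
move=> be0 x0; have x1 : 0 < x + 1 by rewrite addr_gt0.
rewrite /powR gt_eqF ?divr_gt0//.
apply: (le_trans (expR_ge1Dx (- (be / x)))); rewrite ler_expR.
have -> : - (be / x) = be * - x^-1 by rewrite mulrN.
rewrite ler_pM2l// -[x / (x + 1)]invrK lnV ?qualifE/= ?invr_gt0 ?divr_gt0//.
rewrite lerN2 invf_div.
have -> : (x + 1) / x = 1 + x^-1 by rewrite mulrDl divff ?gt_eqF// mul1r.
by apply: le_ln1Dx; rewrite (@lt_trans _ _ 0)// ?ltrN10// invr_gt0.
Qed.

(* The product is the expected mass left after N sticks of PD(al, th). *)
Lemma prod_stick_mean_le (al th : R) N : 0 < al < 1 -> 0 <= th ->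
  \prod_(k < N) ((th + k.+1%:R * al) / (th + k%:R * al + 1)) <=
  ((th + 1) / al / ((th + 1) / al + N%:R)) `^ ((1 - al) / al).
Proof.
move=> /andP[al0 al1] th0; set c := (th + 1) / al; set be := (1 - al) / al.
have be0 : 0 < be by rewrite divr_gt0// subr_gt0.
have c0 : 0 < c by rewrite divr_gt0//; lra.
elim: N => [|N IH].
  by rewrite big_ord0 addr0 divff ?gt_eqF// powR1.
have cN : 0 < c + N%:R by rewrite ltr_wpDr.
rewrite big_ord_recr/=.
have -> : c / (c + N.+1%:R) = c / (c + N%:R) * ((c + N%:R) / (c + N%:R + 1)).
  rewrite mulrA divfK ?gt_eqF// -addrA -natr1//.
rewrite powRM; [|by rewrite divr_ge0// ltW|by rewrite divr_ge0// ltW// ltr_wpDr].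
apply: ler_pM => //.
- apply: prodr_ge0 => i _; rewrite divr_ge0// ?addr_ge0// ?mulr_ge0//; lra.
- rewrite divr_ge0// ?addr_ge0// ?mulr_ge0//; lra.
- apply: le_trans _ (powR_ratio_ge be0 cN); rewrite le_eqVlt; apply/orP; left; apply/eqP.
  rewrite /be /c -natr1.
  have ne1 : th + 1 + N%:R * al != 0.
    by rewrite gt_eqF// ltr_wpDr// ?ltr_wpDl// mulr_ge0// ltW.
  by field; rewrite (gt_eqF al0) ne1.
Qed.

Lemma prod_stick_mean_small (al th e : R) : 0 < al < 1 -> 0 <= th -> 0 < e ->
  exists N, \prod_(k < N) ((th + k.+1%:R * al) / (th + k%:R * al + 1)) <= e.
Proof.
move=> al01 th0 e0; have [al0 al1] := andP al01.
set be := (1 - al) / al.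
have be0 : 0 < be by rewrite divr_gt0// subr_gt0.
set c := (th + 1) / al.
have c0 : 0 < c by rewrite divr_gt0//; lra.
(* [d] is the number whose [be]-th power is [e]; N >= c / d makes the base c / (c + N) at most
   [d]. *)
pose d := e `^ be^-1.
have d0 : 0 < d by rewrite powR_gt0.
have [N cdN] : exists N : nat, c / d <= N%:R.
  exists (Num.truncn (c / d)).+1; apply: ltW; exact: truncnS_gt.
exists N; apply: le_trans (prod_stick_mean_le N al01 th0) _.
rewrite -/be -/c.
have -> : e = d `^ be by rewrite /d -powRrM mulVf ?gt_eqF// powRr1// ltW.
apply: ge0_ler_powR; rewrite ?nnegrE.
- exact: ltW.
- by rewrite divr_ge0 ?addr_ge0// ltW.
- exact: ltW.
rewrite ler_pdivrMr ?ltr_wpDr//.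
by move: cdN; rewrite ler_pdivrMr// => /le_trans; apply; rewrite mulrC ler_wpM2l ?(ltW d0)// lerDr ltW.
Qed.

(* Used with [a i n = (s)_n / n! * E(X^n)], [s = i al], the coefficients of E((1 - z X)^(-s))
   for the mean X of PD(al, s), and [b j] likewise with [s = th + j al]; the hypotheses on [a]
   and [b] are the stick-breaking recursion. The defect [b (i + j) - conv (a i) (b j)]
   contracts by a factor (s + al) / (s + 1) at each step s -> s + al. *)
Lemma conv_coef_add (al th M : R) (h : nat -> R) (a b : nat -> nat -> R) :
  0 < al < 1 -> 0 <= th -> 0 <= M -> h 0%N = 1 ->
  (forall i, a i 0%N = 1) -> (forall i, b i 0%N = 1) ->
  (forall i n, 0 <= a i n <= M ^+ n * rising_coef (i%:R * al) n) ->
  (forall i n, 0 <= b i n <= M ^+ n * rising_coef (th + i%:R * al) n) ->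
  (forall i n, (i%:R * al + n%:R) * a i n = i%:R * al * conv h (a i.+1) n) ->
  (forall i n, (th + i%:R * al + n%:R) * b i n =
               (th + i%:R * al) * conv h (b i.+1) n) ->
  forall n i j, b (i + j)%N n = conv (a i) (b j) n.
Proof.
move=> al01 th0 M0 h0 a0 b0 aM bM ha hb; have [al0 al1] := andP al01.
pose D i j n := b (i + j)%N n - conv (a i) (b j) n.
have r0 m : 0 <= th + m%:R * al by rewrite addr_ge0// mulr_ge0// ltW.
have rD i j n : (th + (i + j)%:R * al + n%:R) * D i j n =
    i%:R * al * conv h (D i.+1 j) n + (th + j%:R * al) * conv h (D i j.+1) n.
  rewrite /D !convB mulrBr hb.
  (* In the k-th term n = k + (n - k), so the prefactor splits into those of [ha] at k and of [hb]
     at n - k. *)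
  have -> : (th + (i + j)%:R * al + n%:R) * conv (a i) (b j) n =
      i%:R * al * conv h (conv (a i.+1) (b j)) n +
      (th + j%:R * al) * conv h (conv (a i) (b j.+1)) n.
    rewrite [conv h (conv (a i) _) n]convCA convA /conv !mulr_sumr -big_split/=.
    apply: eq_bigr => k _.
    have kn : (k <= n)%N by rewrite -ltnS.
    have := ha i k; have := hb j (n - k)%N.
    rewrite /conv natrB// natrD => e1 e2.
    set s1 := \sum_(_ < (n - k).+1) _ in e1 *; set s2 := \sum_(_ < k.+1) _ in e2 *.
    transitivity (((i%:R * al + k%:R) * a i k) * b j (n - k)%N +
       a i k * ((th + j%:R * al + (n%:R - k%:R)) * b j (n - k)%N)); first ring.
    by rewrite e1 e2; ring.
  by rewrite addnS addSn natrD; ring.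
elim/ltn_ind => n IH i j.
have [->|n0] := posnP n.
  by rewrite b0 /conv big_ord_recl big_ord0 a0 b0 mulr1 addr0.
have lead i' j' : conv h (D i' j') n = D i' j' n.
  by rewrite conv_lead// => k kn; rewrite /D IH// subrr.
(* Induction on the number N of steps upwards, for all indices of sum m at once, because one step
   replaces (i, j) by both (i + 1, j) and (i, j + 1). *)
have bound N m i' j' : (i' + j')%N = m -> `|D i' j' n| <=
    M ^+ n * rising_coef (th + m%:R * al) n *
    \prod_(k < N) ((th + m%:R * al + k.+1%:R * al) / (th + m%:R * al + k%:R * al + 1)).
  elim: N m i' j' => [|N IHN] m i' j' mE.
    rewrite big_ord0 mulr1 /D mE.
    have /andP[b_ge0 b_le] := bM m n.
    have c_ge0 : 0 <= conv (a i') (b j') n.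
      by apply: sumr_ge0 => k _; case/andP: (aM i' k) (bM j' (n - k)%N) => ? _ /andP[? _]; rewrite mulr_ge0.
    (* Chu-Vandermonde gives the convolution the same bound as [b], so the difference of two numbers
       in the same interval is controlled. *)
    have c_le : conv (a i') (b j') n <= M ^+ n * rising_coef (th + m%:R * al) n.
      have -> : th + m%:R * al = i'%:R * al + (th + j'%:R * al) by rewrite -mE natrD; ring.
      rewrite -rising_coef_vandermonde /conv mulr_sumr; apply: ler_sum => k _.
      have kn : (k <= n)%N by rewrite -ltnS.
      have /andP[? ?] := aM i' k; have /andP[? ?] := bM j' (n - k)%N.
      have -> : M ^+ n = M ^+ k * M ^+ (n - k) by rewrite -exprD subnKC.
      by rewrite mulrACA; exact: ler_pM.
    by rewrite ler_norml; apply/andP; split; lra.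
  have rn0 : 0 < th + m%:R * al + n%:R by rewrite ltr_wpDl// ltr0n.
  rewrite -(ler_pM2l rn0) -{1}(ger0_norm (ltW rn0)) -normrM -mE rD !lead.
  set P := \prod_(k < N) ((th + m.+1%:R * al + k.+1%:R * al) /
                          (th + m.+1%:R * al + k%:R * al + 1)) in IHN.
  have -> : \prod_(k < N.+1) ((th + (i' + j')%:R * al + k.+1%:R * al) /
       (th + (i' + j')%:R * al + k%:R * al + 1)) =
     (th + m%:R * al + al) / (th + m%:R * al + 1) * P.
    rewrite big_ord_recl/= mE mul1r mul0r addr0; congr (_ * _).
    apply: eq_bigr => k _; rewrite /bump/= add1n -![_.+1%:R]natr1.
    by congr (_ / _); ring.
  set B := M ^+ n * rising_coef (th + m.+1%:R * al) n * P.
  have B1 : `|D i'.+1 j' n| <= B by apply: IHN; rewrite addSn mE.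
  have B2 : `|D i' j'.+1 n| <= B by apply: IHN; rewrite addnS mE.
  have P0 : 0 <= P.
    apply: prodr_ge0 => k _; rewrite divr_ge0// !addr_ge0// mulr_ge0// ltW//.
  apply: (@le_trans _ _ ((th + m%:R * al) * B)).
    apply: le_trans (ler_normD _ _) _; rewrite !normrM !(ger0_norm (r0 _)) (gtr0_norm al0) (ger0_norm (ler0n _ _)).
    have -> : th + m%:R * al = i'%:R * al + (th + j'%:R * al) by rewrite -mE natrD; ring.
    by rewrite [leRHS]mulrDl lerD// ler_wpM2l// mulr_ge0// ltW.
  rewrite /B mE -!mulrA mulrCA [X in _ <= X]mulrCA ler_wpM2l ?exprn_ge0//.
  rewrite !mulrA ler_wpM2r//.
  have -> : th + m.+1%:R * al = th + m%:R * al + al by rewrite -natr1; ring.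
  by have := rising_coef_step al01 (r0 m) n0; rewrite !mulrA.
apply/eqP; rewrite -subr_eq0 -normr_le0 -/(D i j n); apply/ler_addgt0Pl => e e0.
rewrite addr0.
set K := M ^+ n * rising_coef (th + (i + j)%:R * al) n.
have K0 : 0 <= K by rewrite mulr_ge0 ?exprn_ge0 ?rising_coef_ge0.
(* [K] may vanish, hence the division by [K + 1]. *)
have eK : 0 < e / (K + 1) by rewrite divr_gt0// ltr_wpDl.
have [N NP] := @prod_stick_mean_small al (th + (i + j)%:R * al) _ al01 (r0 _) eK.
apply: le_trans (bound N _ i j erefl) _; rewrite -/K.
apply: le_trans (ler_wpM2l K0 NP) _.
by rewrite mulrCA -[leRHS]mulr1 ler_wpM2l ?(ltW e0)// ler_pdivrMr ?ltr_wpDl//; lra.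
Qed.

End rising_factorials.

(** * Integration against a density *)

Section integral_density.
Local Open Scope ereal_scope.
Context d (T : measurableType d) (R : realType).
Variables (mu nu : {measure set T -> \bar R}) (g : T -> R).
Hypotheses (mg : measurable_fun setT g) (g0 : forall x, (0 <= g x)%R).
Hypothesis nuE : forall A, measurable A -> nu A = \int[mu]_(x in A) (g x)%:E.

Import HBNNSimple.

Let integral_density_nnsfun (h : {nnsfun T >-> R}) :
  \int[nu]_x (h x)%:E = \int[mu]_x ((h x)%:E * (g x)%:E).
Proof.
under eq_integral do rewrite fimfunE -fsumEFin//.
under [RHS]eq_integral => x _.
  rewrite fimfunE -fsumEFin// ge0_mule_fsuml; last by move=> y; exact: nnfun_muleindic_ge0.
  over.
have mh r : measurable_fun setT (fun x => (r * \1_(h @^-1` [set r]) x)%:E).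
  by apply/measurable_EFinP; exact: measurable_funM.
rewrite !ge0_integral_fsum//; last first.
- by move=> r x _; exact: nnfun_muleindic_ge0.
- by move=> r x _; rewrite mule_ge0 ?lee_fin//; exact: nnfun_muleindic_ge0.
- by move=> r; apply: emeasurable_funM => //; exact/measurable_EFinP.
apply: eq_fsbigr => r; rewrite inE => -[t _ <-].
under eq_integral do rewrite EFinM.
under [RHS]eq_integral do rewrite EFinM -muleA.
rewrite integralZl_indic_nnsfun// ge0_integralZl//; last 3 first.
- by apply: emeasurable_funM; exact/measurable_EFinP.
- by move=> x _; rewrite mule_ge0 ?lee_fin.
- by rewrite lee_fin.
congr (_ * _); rewrite integral_indic// setIT nuE// integral_mkcond.
by apply: eq_integral => x _; rewrite epatch_indic muleC.
Qed.

Lemma integral_density (f : T -> \bar R) : measurable_fun setT f ->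
  (forall x, 0 <= f x) -> \int[nu]_x f x = \int[mu]_x (f x * (g x)%:E).
Proof.
move=> mf f0; pose h := nnsfun_approx measurableT mf.
have fE x : f x = limn (fun n => (h n x)%:E).
  by apply/esym/cvg_lim => //; apply: cvg_nnsfun_approx.
have fgE x : f x * (g x)%:E = limn (fun n => (h n x)%:E * (g x)%:E).
  by apply/esym/cvg_lim => //; apply: cvgeZr => //; exact: cvg_nnsfun_approx.
under eq_integral do rewrite fE.
under [RHS]eq_integral do rewrite fgE.
rewrite !monotone_convergence//.
- by congr (limn _); apply/funext => n; exact: integral_density_nnsfun.
- by move=> n; apply: emeasurable_funM; exact/measurable_EFinP.
- by move=> n x _; rewrite mule_ge0// lee_fin.
- by move=> x _ m n mn; rewrite lee_wpmul2r ?lee_fin//; exact/lefP/nd_nnsfun_approx.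
- by move=> n; exact/measurable_EFinP.
- by move=> n x _; rewrite lee_fin.
- by move=> x _ m n mn; rewrite lee_fin; exact/lefP/nd_nnsfun_approx.
Qed.

End integral_density.

(** * Beta integrals and Beta moments *)

Definition beta_int {R : realType} (a b : R) : \bar R :=
  (\int[lebesgue_measure]_(x in `]0%R, 1%R[) (beta_dens a b x)%:E)%E.

Section beta_integrals.
Variable R : realType.
Local Notation mu := (@lebesgue_measure R).
Implicit Types a b p q x : R.

Lemma beta_dens_ge0 a b x : 0 <= beta_dens a b x.
Proof. by rewrite mulr_ge0 ?powR_ge0. Qed.

Lemma measurable_beta_dens a b : measurable_fun setT (beta_dens a b).
Proof.
apply: measurable_funM; first exact: measurable_powR.
have m1 : measurable_fun setT (fun x : R => 1 - x) by exact: measurable_funB.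
exact: (measurableT_comp (measurable_powR _) m1).
Qed.

Lemma measurable_EFin_beta_dens (D : set (measurableTypeR R)) a b :
  measurable_fun D (fun x : measurableTypeR R => (beta_dens a b x)%:E).
Proof.
by apply/measurable_EFinP; apply: measurable_funTS; exact: measurable_beta_dens.
Qed.

Lemma beta_densD a b x j k : 0 < x < 1 ->
  x ^+ j * (1 - x) ^+ k * beta_dens a b x = beta_dens (a + j%:R) (b + k%:R) x.
Proof.
move=> /andP[x0 x1]; have y0 : 0 < 1 - x by rewrite subr_gt0.
have xn0 : x != 0 by rewrite gt_eqF.
have yn0 : 1 - x != 0 by rewrite gt_eqF.
rewrite /beta_dens -!powR_mulrn ?ltW// mulrACA -!powRD ?xn0 ?yn0 ?implybT//.
by congr (_ `^ _ * _ `^ _); ring.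
Qed.

Lemma is_derive_beta_dens p q x : 0 < x < 1 ->
  is_derive x 1 (beta_dens (p + 1) (q + 1)) (p * beta_dens p (q + 1) x - q * beta_dens (p + 1) q x).
Proof.
move=> /andP[x0 x1]; have y0 : 0 < 1 - x by rewrite subr_gt0.
have d1 : is_derive x 1 (fun x => x `^ (p + 1 - 1)) (p * x `^ (p - 1)).
  by rewrite addrK; exact: is_derive1_powR.
have d2 : is_derive x 1 (fun x => (1 - x) `^ (q + 1 - 1)) (- (q * (1 - x) `^ (q - 1))).
  rewrite addrK.
  have h1 : is_derive x 1 (fun x : R => 1 - x) (-1).
    by have := is_deriveB (is_derive_cst (1 : R) x 1) (is_derive_id x 1); rewrite sub0r.
  have h2 : is_derive (1 - x) 1 (fun y => y `^ q) (q * (1 - x) `^ (q - 1)).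
    exact: is_derive1_powR.
  have := @is_derive1_comp R (fun y => y `^ q) (fun x => 1 - x) x _ _ h2 h1.
  by rewrite mulrN1.
have := @is_deriveM R R (fun x => x `^ (p + 1 - 1)) (fun x => (1 - x) `^ (q + 1 - 1)) x 1 _ _ d1 d2.
have -> : beta_dens (p + 1) (q + 1) =
  (fun x => x `^ (p + 1 - 1)) * (fun x => (1 - x) `^ (q + 1 - 1)) by apply/funext.
move=> h; apply: (is_derive_eq h); rewrite /beta_dens /GRing.scale/=; ring.
Qed.

Lemma beta_dens_continuous p q x : 0 < x < 1 -> {for x, continuous (beta_dens p q)}.
Proof.
move=> x01; have := @is_derive_beta_dens (p - 1) (q - 1) x x01.
rewrite !subrK => -[dx _]; exact/differentiable_continuous/derivable1_diffP.
Qed.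

(** The derivative of x^a (1 - x)^b is integrated over compact subintervals, where the fundamental
    theorem of calculus applies although the densities may blow up at 0 and 1; the boundary terms
    vanish in the limit because a, b > 0. *)
Lemma beta_int_ibp a b : 0 < a -> 0 < b -> (beta_int (a + 1) b < +oo)%E ->
  (beta_int a (b + 1) < +oo)%E ->
  (a%:E * beta_int a (b + 1) = b%:E * beta_int (a + 1) b)%E.
Proof.
move=> a0 b0 fin1 fin2.
(* At most 1/3, so that every [F n] is a nondegenerate interval. *)
pose e n : R := n.+3%:R^-1.
have e0 n : 0 < e n by rewrite invr_gt0.
have e1 n : e n < 1 - e n.
  by rewrite ltrBrDr -mulr2n -mulr_natr /e mulrC ltr_pdivrMr// mul1r ltr_nat.
pose F n : set R := [set` `[e n, 1 - e n]].
have F01 n x : F n x -> 0 < x < 1.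
  rewrite /F/= in_itv/= => /andP[ex xe]; rewrite (lt_le_trans (e0 n) ex)/=.
  by rewrite (le_lt_trans xe)// ltrBlDr ltrDl.
have FU : \bigcup_n F n = `]0, 1[%classic.
  apply/seteqP; split=> x /=; first by move=> [n _] /F01; rewrite in_itv.
  rewrite in_itv/= => /andP[x0 x1].
  have y0 : 0 < 1 - x by rewrite subr_gt0.
  pose n := Num.truncn (x^-1 + (1 - x)^-1).
  have nE : x^-1 + (1 - x)^-1 <= n.+3%:R.
    rewrite (le_trans (ltW (truncnS_gt _)))// ler_nat /n; exact: leqW.
  exists n => //; rewrite /F/= in_itv/= lerBrDr -lerBrDl /e -[x in _ <= x]invrK -[1 - x]invrK.
  rewrite !lef_pV2 ?posrE ?invr_gt0//.
  by apply/andP; split; apply: le_trans nE; rewrite ?lerDl ?lerDr invr_ge0 ltW.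
have ndF : nondecreasing_seq F.
  move=> m n mn; apply/subsetPset => x; rewrite /F/= !in_itv/= => /andP[ex xe].
  have enm : e n <= e m by rewrite /e lef_pV2 ?posrE// ler_nat.
  by rewrite (le_trans enm ex)/= (le_trans xe)// lerD2l lerN2.
have mF n : measurable (F n : set (measurableTypeR R)) by exact: measurable_itv.
have cvgF (p q : R) : (\int[mu]_(x in F n) (beta_dens p q x)%:E @[n --> \oo] --> beta_int p q)%E.
  rewrite /beta_int -FU; apply: ge0_nondecreasing_set_cvg_integral => //.
  - by move=> n; exact: measurable_EFin_beta_dens.
  - by move=> n x _; rewrite lee_fin beta_dens_ge0.
pose G n := beta_dens (a + 1) (b + 1) (1 - e n) - beta_dens (a + 1) (b + 1) (e n).
have cw n p q : {within F n, continuous (beta_dens p q)}.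
  apply: continuous_in_subspaceT => x; rewrite inE => /F01.
  exact: beta_dens_continuous.
have intF n p q : mu.-integrable (F n) (EFin \o beta_dens p q).
  by apply: continuous_compact_integrable => //; exact: segment_compact.
have FTC n : (a%:E * \int[mu]_(x in F n) (beta_dens a (b + 1) x)%:E =
    b%:E * \int[mu]_(x in F n) (beta_dens (a + 1) b x)%:E + (G n)%:E)%E.
  have : (\int[mu]_(x in F n) (a * beta_dens a (b + 1) x - b * beta_dens (a + 1) b x)%:E = (G n)%:E)%E.
    rewrite /G EFinB; apply: continuous_FTC2 => //.
    - pose fd : R -> R := fun x => a * beta_dens a (b + 1) x - b * beta_dens (a + 1) b x.
      suff : {within F n, continuous fd} by [].
      apply: continuous_in_subspaceT => x; rewrite inE => /F01 x01.
      exact: (cvgB (cvgM (cvg_cst a) (beta_dens_continuous (p := a) (q := b + 1) x01))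
                   (cvgM (cvg_cst b) (beta_dens_continuous (p := a + 1) (q := b) x01))).
    - split.
      + by move=> x xe; have [] := @is_derive_beta_dens a b x (F01 n x (subset_itv_oo_cc xe)).
      + apply: cvg_at_right_filter; apply: beta_dens_continuous; apply: (F01 n).
        by rewrite /F/= in_itv/= lexx ltW.
      + apply: cvg_at_left_filter; apply: beta_dens_continuous; apply: (F01 n).
        by rewrite /F/= in_itv/= lexx ltW.
    - move=> x xe; rewrite derive1E.
      by have [_ ->] := @is_derive_beta_dens a b x (F01 n x (subset_itv_oo_cc xe)).
  move=> <-.
  under [X in (_ = _ + X)%E]eq_integral do rewrite EFinB (EFinM a) (EFinM b).
  rewrite integralB//; last 2 first.
  - by apply: integrableZl; [exact: mF|exact: intF].
  - by apply: integrableZl; [exact: mF|exact: intF].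
  have iF := intF n; rewrite /= in iF.
  rewrite (integralZl (mF n) (iF a (b + 1)))// (integralZl (mF n) (iF (a + 1) b))// [RHS]addeC subeK//.
  by apply: fin_numM => //; apply: integrable_fin_num; [exact: mF|exact: intF].
have ecvg : e n @[n --> \oo] --> 0.
  apply: (squeeze_cvgr (f := cst 0) (h := @harmonic R)).
  - apply: nearW => n; rewrite ltW//= /e /harmonic/= lef_pV2 ?posrE// ler_nat.
    exact: (leqW (leqW (leqnn _))).
  - exact: cvg_cst.
  - exact: cvg_harmonic.
have G0 : G n @[n --> \oo] --> 0.
  have pe r : 0 < r -> e n `^ r @[n --> \oo] --> 0.
    by move=> r0; have /cvg_at_rightP := powR_cvg0 r0; apply; split.
  have eb n : e n `^ b <= 1 /\ (1 - e n) `^ b <= 1 /\ (1 - e n) `^ a <= 1.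
    have [n0 n1] : 0 <= e n /\ e n <= 1.
      split; first exact: ltW.
      by rewrite /e invf_le1// ler1n.
    have le1 r x : 0 <= x <= 1 -> 0 < r -> x `^ r <= 1.
      move=> /andP[x0 x1] r0; have -> : 1 = (1 : R) `^ r by rewrite powR1.
      by apply: ge0_ler_powR; rewrite ?nnegrE// ltW.
    by split; [|split]; apply: le1 => //; apply/andP; split; lra.
  (* The right endpoint contributes the small factor (e n)^b, the left one (e n)^a. *)
  have nG n : - (e n `^ a) <= G n <= e n `^ b.
    rewrite /G /beta_dens !addrK.
    have -> : 1 - (1 - e n) = e n by ring.
    have [g1 [g2 g3]] := eb n.
    have h1 : (1 - e n) `^ a * e n `^ b <= e n `^ b by rewrite ler_piMl ?powR_ge0.
    have h2 : e n `^ a * (1 - e n) `^ b <= e n `^ a by rewrite ler_piMr ?powR_ge0.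
    have h3 : 0 <= (1 - e n) `^ a * e n `^ b by rewrite mulr_ge0 ?powR_ge0.
    have h4 : 0 <= e n `^ a * (1 - e n) `^ b by rewrite mulr_ge0 ?powR_ge0.
    by apply/andP; split; lra.
  apply: (squeeze_cvgr (f := fun n => - (e n `^ a)) (h := fun n => e n `^ b)).
  - exact: nearW.
  - by rewrite -oppr0; apply: cvgN; exact: pe.
  - exact: pe.
have c1 : (a%:E * \int[mu]_(x in F n) (beta_dens a (b + 1) x)%:E @[n --> \oo] -->
   a%:E * beta_int a (b + 1))%E.
  by apply: cvgeZl => //; exact: cvgF.
have c2 : (a%:E * \int[mu]_(x in F n) (beta_dens a (b + 1) x)%:E @[n --> \oo] -->
   b%:E * beta_int (a + 1) b + 0%:E)%E.
  rewrite (_ : (fun n => _) = (fun n => b%:E * \int[mu]_(x in F n) (beta_dens (a + 1) b x)%:E + (G n)%:E)%E); last first.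
    by apply/funext => n; exact: FTC.
  apply: cvgeD.
  - by rewrite fin_num_adde_defl.
  - by apply: cvgeZl => //; exact: cvgF.
  - by apply: cvg_EFin; [exact: nearW|exact: G0].
by rewrite -(cvg_lim _ c1)// (cvg_lim _ c2)// adde0.
Qed.

(** The identity x + (1 - x) = 1 gives the sum of the two integrals and integration by parts their
    ratio. *)
Lemma beta_int_shift a b B : 0 < a -> 0 < b -> beta_int a b = B%:E ->
  beta_int (a + 1) b = (a / (a + b) * B)%:E /\ beta_int a (b + 1) = (b / (a + b) * B)%:E.
Proof.
move=> a0 b0 BE.
have ge0 p q : (0 <= beta_int p q)%E.
  by apply: integral_ge0 => x _; rewrite lee_fin beta_dens_ge0.
have sumE : (beta_int (a + 1) b + beta_int a (b + 1) = B%:E)%E.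
  rewrite -BE /beta_int -ge0_integralD//.
  - apply: eq_integral => x; rewrite inE/= in_itv/= => x01; rewrite -EFinD; congr EFin.
    have := beta_densD a b 1 0 x01; have := beta_densD a b 0 1 x01.
    by rewrite !addr0 => <- <-; ring.
  - by move=> x _; rewrite lee_fin beta_dens_ge0.
  - exact: measurable_EFin_beta_dens.
  - by move=> x _; rewrite lee_fin beta_dens_ge0.
  - exact: measurable_EFin_beta_dens.
have f1 : (beta_int (a + 1) b < +oo)%E.
  by apply: (@le_lt_trans _ _ B%:E); rewrite ?ltry// -sumE leeDl.
have f2 : (beta_int a (b + 1) < +oo)%E.
  by apply: (@le_lt_trans _ _ B%:E); rewrite ?ltry// -sumE leeDr.
have := beta_int_ibp a0 b0 f1 f2; move: sumE.
have /fineK <- : beta_int (a + 1) b \is a fin_num by rewrite ge0_fin_numE.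
have /fineK <- : beta_int a (b + 1) \is a fin_num by rewrite ge0_fin_numE.
set x := fine _; set y := fine _.
rewrite -EFinD -!EFinM => -[xyB] -[ab].
have ab0 : a + b != 0 by rewrite gt_eqF// addr_gt0.
split; congr EFin; rewrite -xyB.
  have -> : a / (a + b) * (x + y) = (a * x + a * y) / (a + b) by field.
  by rewrite ab; field.
have -> : b / (a + b) * (x + y) = (b * x + b * y) / (a + b) by field.
by rewrite -ab; field.
Qed.

Lemma beta_int_moments a b B j k : 0 < a -> 0 < b -> beta_int a b = B%:E ->
  beta_int (a + j%:R) (b + k%:R) =
  (rising a j * rising b k / rising (a + b) (j + k) * B)%:E.
Proof.
move=> a0 b0 BE; elim: j => [|j IHj].
  elim: k => [|k IHk].
    by rewrite !addr0 !rising0 mulr1 divr1 mul1r.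
  have bk0 : 0 < b + k%:R by rewrite ltr_wpDr.
  have a0' : 0 < a + 0%:R by rewrite addr0.
  have [_ +] := beta_int_shift a0' bk0 IHk.
  rewrite -addrA natr1 => ->; congr EFin.
  rewrite !add0n !risingS rising0 addr0.
  have r0 : rising (a + b) k != 0 by rewrite gt_eqF// rising_gt0// addr_gt0.
  have r1 : a + b + k%:R != 0 by rewrite gt_eqF// ltr_wpDr// addr_gt0.
  by rewrite addrA; field; rewrite r0 r1.
have aj0 : 0 < a + j%:R by rewrite ltr_wpDr.
have bk0 : 0 < b + k%:R by rewrite ltr_wpDr.
have [+ _] := beta_int_shift aj0 bk0 IHj.
rewrite -addrA natr1 => ->; congr EFin.
rewrite addSn !risingS.
have r0 : rising (a + b) (j + k) != 0 by rewrite gt_eqF// rising_gt0// addr_gt0.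
have r1 : a + b + (j + k)%:R != 0 by rewrite gt_eqF// ltr_wpDr// addr_gt0.
rewrite natrD in r1 *.
have -> : a + j%:R + (b + k%:R) = a + b + (j%:R + k%:R) by ring.
by field; rewrite r0 r1.
Qed.

End beta_integrals.

Section beta_law_moments.
Context d (T : measurableType d) (R : realType) (P : probability T R).
Variables (V : T -> R) (a b : R).
Hypotheses (mV : measurable_fun setT V) (lawV : has_law P V (beta_law a b)).
Local Notation mu := (@lebesgue_measure R).

(** Finiteness and positivity of the normalising integral are not computed but read off from the
    law: were the integral 0 or infinite, [fine] and division by zero would give [beta_law] total
    mass 0 instead of 1. *)
Lemma beta_int_fin : exists2 B : R, 0 < B & beta_int a b = B%:E.
Proof.
have b0 : (0 <= beta_int a b)%E.
  by apply: integral_ge0 => x _; rewrite lee_fin beta_dens_ge0.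
have := lawV measurableT; rewrite preimage_setT probability_setT /beta_law setTI.
rewrite -/(beta_int a b) => -[/esym/eqP].
move: b0; case: (beta_int a b) => [r|_|//] /=.
  rewrite lee_fin => r0; have [->|r_neq0] := eqVneq r 0.
    by rewrite mul0r eq_sym oner_eq0.
  by move=> _; exists r => //; rewrite lt_neqAle eq_sym r_neq0.
by rewrite mul0r eq_sym oner_eq0.
Qed.

(** [B] times the law of [V] has the unnormalised density [beta_dens] on ]0, 1[; keeping the factor
    on the left avoids a division in the extended reals. *)
Lemma beta_law_integral B (phi : R -> \bar R) : beta_int a b = B%:E -> 0 < B ->
  measurable_fun setT phi -> (forall x, 0 <= phi x)%E ->
  (B%:E * \int[P]_w phi (V w) = \int[mu]_(x in `]0%R, 1%R[) (phi x * (beta_dens a b x)%:E))%E.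
Proof.
move=> BE B0 mphi phi0.
pose V' : T -> measurableTypeR R := V.
have mV' : measurable_fun setT V' by exact: mV.
pose PV := distribution P (mfun_Sub (mem_set mV') : {mfun T >-> measurableTypeR R}).
pose nu : {measure set (measurableTypeR R) -> \bar R} := mscale (NngNum (ltW B0)) PV.
pose mu' : {measure set (measurableTypeR R) -> \bar R} := lebesgue_measure.
pose g := beta_dens a b \_ `]0%R, 1%R[.
have mg : measurable_fun setT g.
  by apply/measurable_restrict => //; rewrite setTI; apply: measurable_funTS; exact: measurable_beta_dens.
have g0 x : 0 <= g x by rewrite /g patchE; case: ifP => // _; exact: beta_dens_ge0.
have gE x : (g x)%:E = ((EFin \o beta_dens a b) \_ `]0%R, 1%R[) x.
  by rewrite /g !patchE; case: ifP.
have nuE (A : set (measurableTypeR R)) : measurable A -> nu A = (\int[mu']_(x in A) (g x)%:E)%E.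
  move=> mA; rewrite /mu' /nu/= /mscale/= /PV /distribution/= /pushforward.
  have -> := lawV mA.
  rewrite /beta_law -/(beta_int a b) BE/=.
  have -> : (\int[mu]_(x in A) (g x)%:E = \int[mu]_(x in A `&` `]0%R, 1%R[) (beta_dens a b x)%:E)%E.
    by rewrite integral_mkcondr; apply: eq_integral => x _; rewrite gE.
  rewrite -EFinM mulrCA divff ?gt_eqF// mulr1 fineK//.
  rewrite ge0_fin_numE; last by apply: integral_ge0 => x _; rewrite lee_fin beta_dens_ge0.
  apply: (@le_lt_trans _ _ (beta_int a b)); last by rewrite BE ltry.
  apply: ge0_subset_integral => //.
  - exact: measurableI.
  - exact: measurable_EFin_beta_dens.
  - by move=> x _; rewrite lee_fin beta_dens_ge0.
have -> : (\int[P]_w phi (V w) = \int[PV]_x phi x)%E by rewrite ge0_integral_pushforward.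
rewrite -(ge0_integral_mscale _ measurableT (NngNum (ltW B0)))//.
rewrite (@integral_density _ _ R mu' nu g mg g0 nuE phi mphi phi0) [RHS]integral_mkcond.
by apply: eq_integral => x _; rewrite gE !patchE; case: ifP => //; rewrite mule0.
Qed.

(** [V] lies in ]0, 1[ only almost surely; the absolute values keep the integrand nonnegative
    everywhere. *)
Lemma beta_law_moments j k : 0 < a -> 0 < b ->
  (\int[P]_w (`|V w| ^+ j * `|1 - V w| ^+ k)%:E =
   (rising a j * rising b k / rising (a + b) (j + k))%:E)%E.
Proof.
move=> a0 b0; have [B B0 BE] := beta_int_fin.
have mphi : measurable_fun setT (fun x : R => (`|x| ^+ j * `|1 - x| ^+ k)%:E).
  apply/measurable_EFinP; apply: measurable_funM; apply: measurable_funX.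
    exact: normr_measurable.
  by apply: measurableT_comp => //; exact: measurable_funB.
have phi0 (x : R) : (0 <= (`|x| ^+ j * `|1 - x| ^+ k)%:E)%E by rewrite lee_fin mulr_ge0.
have := beta_law_integral BE B0 mphi phi0.
have -> : (\int[mu]_(x in `]0%R, 1%R[) ((`|x| ^+ j * `|1 - x| ^+ k)%:E * (beta_dens a b x)%:E)
    = beta_int (a + j%:R) (b + k%:R))%E.
  apply: eq_integral => x; rewrite inE/= in_itv/= => x01; have /andP[x0 x1] := x01.
  by rewrite -EFinM gtr0_norm// gtr0_norm ?subr_gt0// beta_densD.
rewrite (beta_int_moments j k a0 b0 BE) => h.
have : (B^-1%:E * (B%:E * \int[P]_w (`|V w| ^+ j * `|1 - V w| ^+ k)%:E) =
  B^-1%:E * (rising a j * rising b k / rising (a + b) (j + k) * B)%:E)%E by rewrite h.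
by rewrite muleA -!EFinM mulVf ?gt_eqF// mul1e => ->; congr EFin; rewrite mulrC mulfK ?gt_eqF.
Qed.

Lemma beta_law_null (N : set R) : measurable N -> mu N = 0%E -> P (V @^-1` N) = 0%E.
Proof.
move=> mN N0; rewrite lawV// /beta_law.
rewrite (_ : (\int[mu]_(x in N `&` _) _)%E = 0%E) ?mul0r//.
apply: null_set_integral => //.
- exact: measurableI.
- exact: measurable_EFin_beta_dens.
- by apply: (subset_measure0 _ _ _ N0) => //; exact: measurableI.
Qed.

Lemma beta_law_01 : P (V @^-1` `]0%R, 1%R[) = 1%E.
Proof.
by rewrite lawV// -(@probability_setT _ _ _ P) -(preimage_setT V) lawV// /beta_law setTI setIid.
Qed.

End beta_law_moments.

(** * Independence of sticks and atoms *)

Definition indep_pair {d d1 d2} {T : measurableType d} {T1 : measurableType d1}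
    {T2 : measurableType d2} {R : realType} (P : probability T R)
    (A : T -> T1) (B : T -> T2) : Prop :=
  forall a b, measurable a -> measurable b ->
    P (A @^-1` a `&` B @^-1` b) = (P (A @^-1` a) * P (B @^-1` b))%E.

Section independent_pairs.
Local Open Scope ereal_scope.
Context d d1 d2 (T : measurableType d) (T1 : measurableType d1)
  (T2 : measurableType d2) (R : realType) (P : probability T R).
Variables (A : T -> T1) (B : T -> T2).
Hypotheses (mA : measurable_fun setT A) (mB : measurable_fun setT B).

Lemma measurable_preimageT (a : set T1) : measurable a -> measurable (A @^-1` a).
Proof. by move=> ma; rewrite -[X in measurable X]setTI; exact: mA. Qed.

(** The joint law agrees with the product of the marginals on rectangles, hence everywhere; the rest
    is Tonelli. *)
Lemma indep_pair_integral (phi : T1 * T2 -> \bar R) : indep_pair P A B ->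
  measurable_fun setT phi -> (forall x, 0 <= phi x) ->
  \int[P]_w phi (A w, B w) = \int[P]_w \int[P]_w' phi (A w, B w').
Proof.
move=> AB mphi phi0.
have mAB : measurable_fun setT (fun w => (A w, B w)) by exact: measurable_fun_pair.
pose PA := distribution P (mfun_Sub (mem_set mA) : {mfun T >-> T1}).
pose PB := distribution P (mfun_Sub (mem_set mB) : {mfun T >-> T2}).
pose PAB := distribution P (mfun_Sub (mem_set mAB) : {mfun T >-> _}).
have -> : \int[P]_w phi (A w, B w) = \int[PAB]_x phi x.
  by rewrite ge0_integral_pushforward.
have -> : \int[PAB]_x phi x = \int[PA \x PB]_x phi x.
  apply: eq_measure_integral => X mX _; apply/esym; move: X mX.
  by apply: product_measure_unique => a b ma mb; exact: (AB a b ma mb).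
rewrite fubini_tonelli1// /fubini_F.
rewrite ge0_integral_pushforward//=.
- by apply: eq_integral => w _ /=; rewrite ge0_integral_pushforward//; exact: measurableT_comp.
- exact: measurable_fun_fubini_tonelli_F.
- by move=> x _; exact: integral_ge0.
Qed.

End independent_pairs.

Lemma eq_law_integral {d d1 d2} {T : measurableType d} {T1 : measurableType d1}
    {S : measurableType d2} {R : realType} (P : probability T R) (P1 : probability T1 R)
    (A : T -> S) (B : T1 -> S) (phi : S -> \bar R) :
  measurable_fun setT A -> measurable_fun setT B ->
  (forall a, measurable a -> P (A @^-1` a) = P1 (B @^-1` a)) ->
  measurable_fun setT phi -> (forall x, 0 <= phi x)%E ->
  (\int[P]_w phi (A w) = \int[P1]_w phi (B w))%E.
Proof.
move=> mA mB AB mphi phi0.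
pose PA := distribution P (mfun_Sub (mem_set mA) : {mfun T >-> S}).
pose PB := distribution P1 (mfun_Sub (mem_set mB) : {mfun T1 >-> S}).
transitivity (\int[PA]_x phi x)%E; first by rewrite ge0_integral_pushforward.
transitivity (\int[PB]_x phi x)%E; last by rewrite ge0_integral_pushforward.
by apply: eq_measure_integral => a ma _; exact: AB.
Qed.

(** No convergence is assumed: [limn] of a divergent sequence is the default [point], so the limit
    is the upper limit on the measurable set where it meets the lower limit, and constant
    elsewhere. *)
Lemma measurable_lim_ereal {d} {T : measurableType d} {R : realType}
    (u : nat -> T -> \bar R) : (forall n, measurable_fun setT (u n)) ->
  measurable_fun setT (fun w => limn (u ^~ w)).
Proof.
move=> mu.
have msup := measurable_fun_limn_esup mu.
have minf : measurable_fun setT (fun w => limn_einf (u ^~ w)).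
  exact: measurableT_comp (measurable_fun_limn_esup (fun n => measurableT_comp _ (mu n))).
have cvgE w : cvgn (u ^~ w) <-> limn_einf (u ^~ w) = limn_esup (u ^~ w).
  split=> [cu|e]; first by rewrite is_cvg_limn_einfE// is_cvg_limn_esupE.
  apply/cvg_ex; exists (limn_esup (u ^~ w)).
  have := @is_cvg_esups R (u ^~ w); have := @is_cvg_einfs R (u ^~ w).
  rewrite -limn_esup_lim -limn_einf_lim e.
  apply: squeeze_cvge; apply: nearW => n.
  by rewrite ereal_inf_lbound ?ereal_sup_ubound//; exists n => /=.
rewrite (_ : (fun w => _) = (fun w => if limn_einf (u ^~ w) == limn_esup (u ^~ w)
   then limn_esup (u ^~ w) else point)); last first.
  apply/funext => w; case: ifPn => [/eqP/cvgE cu|/eqP ncu].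
    by rewrite is_cvg_limn_esupE.
  apply: dvgP => cu; apply: ncu; exact/cvgE.
apply: measurable_fun_ifT => //.
exact: measurable_fun_eqe.
Qed.

Section stick_independence.
Context d d1 d2 (T : measurableType d) (T1 : measurableType d1)
  (T2 : measurableType d2) (R : realType) (P : probability T R).
Implicit Types (V : nat -> T -> T1) (Y : nat -> T -> T2).

Lemma stick_indep_shift V Y : stick_indep P V Y ->
  stick_indep P (fun k => V k.+1) (fun k => Y k.+1).
Proof.
move=> VY A B mA mB s us.
pose A' k := if k is k'.+1 then A k' else setT.
pose B' k := if k is k'.+1 then B k' else setT.
have mA' k : measurable (A' k) by case: k => //=.
have mB' k : measurable (B' k) by case: k => //=.
pose sh (i : nat + nat) : nat + nat := match i with inl k => inl k.+1 | inr k => inr k.+1 end.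
have sh_inj : injective sh by move=> [i|i] [j|j] //= [->].
have /= := VY A' B' mA' mB' (map sh s).
rewrite map_inj_uniq// => /(_ us); rewrite !big_map.
have E i : match sh i with inl k => V k @^-1` A' k | inr k => Y k @^-1` B' k end =
    match i with inl k => V k.+1 @^-1` A k | inr k => Y k.+1 @^-1` B k end by case: i.
by rewrite (eq_bigr _ (fun i _ => E i)) => ->; apply: eq_bigr => i _; rewrite E.
Qed.

Lemma stick_indep_comp V Y d3 d4 (T3 : measurableType d3) (T4 : measurableType d4)
    (g : T1 -> T3) (h : T2 -> T4) :
  measurable_fun setT g -> measurable_fun setT h -> stick_indep P V Y ->
  stick_indep P (fun k => g \o V k) (fun k => h \o Y k).
Proof.
move=> mg mh VY A B mA mB s us.
have mA' k : measurable (g @^-1` A k) by exact: measurable_preimageT.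
have mB' k : measurable (h @^-1` B k) by exact: measurable_preimageT.
exact: (VY _ _ mA' mB' s us).
Qed.

(** A pi-system generating the sigma-algebra of all sticks and atoms after the first ones. *)
Definition tail_cylinders V Y : set (set T) :=
  [set C | exists (n : nat) (A : nat -> set T1) (B : nat -> set T2),
    [/\ forall k, measurable (A k), forall k, measurable (B k) &
    C = [set w | forall k, (k < n)%N -> A k (V k.+1 w) /\ B k (Y k.+1 w)]]].

Lemma tail_cylinders_setI V Y : setI_closed (tail_cylinders V Y).
Proof.
move=> _ _ [n [A [B [mA mB ->]]]] [n' [A' [B' [mA' mB' ->]]]].
exists (maxn n n').
exists (fun k => (if (k < n)%N then A k else setT) `&` (if (k < n')%N then A' k else setT)).
exists (fun k => (if (k < n)%N then B k else setT) `&` (if (k < n')%N then B' k else setT)).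
split=> [k|k|].
- by apply: measurableI; case: ifP.
- by apply: measurableI; case: ifP.
apply/seteqP; split => w /= => [[h1 h2] k kn|h].
  have [a1 b1] : (if (k < n)%N then A k else setT) (V k.+1 w) /\
      (if (k < n)%N then B k else setT) (Y k.+1 w) by case: ifP => // /h1.
  have [a2 b2] : (if (k < n')%N then A' k else setT) (V k.+1 w) /\
      (if (k < n')%N then B' k else setT) (Y k.+1 w) by case: ifP => // /h2.
  by [].
split=> k kn; have := h k; rewrite leq_max kn ?orbT => /(_ isT) [[h1 h2] [h3 h4]] //.
Qed.

Lemma tail_cylinders_setT V Y : tail_cylinders V Y setT.
Proof.
exists 0%N, (fun=> setT), (fun=> setT); split=> //.
by apply/seteqP; split.
Qed.

Lemma bigsetI_prefix n V Y (A : nat -> set T1) (B : nat -> set T2) :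
  \big[setI/setT]_(i <- map inl (map succn (iota 0 n)) ++ map inr (map succn (iota 0 n)))
      (match i with inl k => V k @^-1` A k | inr k => Y k @^-1` B k end : set T) =
  [set w | forall k, (k < n)%N -> A k.+1 (V k.+1 w) /\ B k.+1 (Y k.+1 w)].
Proof.
rewrite big_cat/= !big_map -!bigcap_seq; apply/seteqP; split => w /= => [[h1 h2] k kn|h].
  by split; [apply: h1|apply: h2]; rewrite /= mem_iota.
by split=> k /=; rewrite mem_iota/= add0n => /h [].
Qed.

Lemma tail_cylinders_measurable V Y : (forall k, measurable_fun setT (V k)) ->
  (forall k, measurable_fun setT (Y k)) -> tail_cylinders V Y `<=` measurable.
Proof.
move=> mV mY _ [n [A [B [mA mB ->]]]].
pose A' k := A k.-1; pose B' k := B k.-1.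
rewrite -[X in measurable X](bigsetI_prefix n V Y A' B').
apply: bigsetI_measurable => -[k|k] _.
  exact: (measurable_preimageT (mV _) (mA _)).
exact: (measurable_preimageT (mY _) (mB _)).
Qed.

(** [stick_indep] is used for two index lists, the one describing the cylinder and its extension by
    the two indices 0, and the product formulas are compared. *)
Lemma indep_head_cylinder V Y (a : set T1) (b : set T2) (C : set T) :
  stick_indep P V Y -> measurable a -> measurable b -> tail_cylinders V Y C ->
  P ((V 0%N @^-1` a `&` Y 0%N @^-1` b) `&` C) =
  (P (V 0%N @^-1` a) * P (Y 0%N @^-1` b) * P C)%E.
Proof.
move=> VY ma mb [n [A [B [mA mB CE]]]].
pose A' k := if k is k'.+1 then A k' else a.
pose B' k := if k is k'.+1 then B k' else b.
have mA' k : measurable (A' k) by case: k => //=.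
have mB' k : measurable (B' k) by case: k => //=.
pose s : seq (nat + nat) := map inl (map succn (iota 0 n)) ++ map inr (map succn (iota 0 n)).
have us : uniq [:: inl 0%N, inr 0%N & s].
  have inl_inj : injective (@inl nat nat) by move=> x y [].
  have inr_inj : injective (@inr nat nat) by move=> x y [].
  have notin (f : nat -> nat + nat) (g : nat -> nat + nat) : 
    (forall i j, f i != g j) -> forall k, f k \notin map g (map succn (iota 0 n)).
    by move=> fg k; apply/mapP => -[j _ /eqP]; rewrite (negbTE (fg _ _)).
  have notin0 (f : nat -> nat + nat) : injective f -> f 0%N \notin map f (map succn (iota 0 n)).
    by move=> fi; rewrite mem_map//; apply/mapP => -[].
  rewrite /= inE/= /s !mem_cat !negb_or cat_uniq.
  rewrite !notin0// !notin//= !map_inj_uniq//; try exact: succn_inj.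
  rewrite iota_uniq/= andbT; apply/hasPn => x /mapP[j _ ->]; exact: notin.
have us' : uniq s by move: us => /= /andP[_ /andP[_]].
have := VY A' B' mA' mB' _ us; rewrite !big_cons/=.
have /= <- := VY A' B' mA' mB' _ us'.
have -> : \big[setI/setT]_(i <- s)
   match i with inl k => V k @^-1` A' k | inr k => Y k @^-1` B' k end = C.
  by rewrite /s bigsetI_prefix CE.
by rewrite setIA muleA.
Qed.

Lemma indep_head V Y : stick_indep P V Y -> indep_pair P (V 0%N) (Y 0%N).
Proof.
move=> VY a b ma mb; have := indep_head_cylinder VY ma mb (tail_cylinders_setT V Y).
by rewrite setIT probability_setT mule1.
Qed.

(** Uniqueness of finite measures is used twice: for a fixed head rectangle, from cylinders to the
    tail sigma-algebra; then for a fixed tail event, from rectangles to all measurable head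
    events. *)
Lemma indep_head_tail V Y d3 (T3 : measurableType d3) (W : T -> T3) :
  (forall k, measurable_fun setT (V k)) -> (forall k, measurable_fun setT (Y k)) ->
  stick_indep P V Y ->
  (forall c, measurable c -> <<s tail_cylinders V Y >> (W @^-1` c)) ->
  indep_pair P (fun w => (V 0%N w, Y 0%N w)) W.
Proof.
move=> mV mY VY tW ab c mab mc.
have mVY : measurable_fun setT (fun w => (V 0%N w, Y 0%N w)) by exact: measurable_fun_pair.
have tail_m : <<s tail_cylinders V Y >> `<=` measurable.
  apply: smallest_sub; first exact: sigma_algebra_measurable.
  exact: tail_cylinders_measurable.
have Phead a b C : measurable a -> measurable b -> <<s tail_cylinders V Y >> C ->
    P (V 0%N @^-1` a `&` Y 0%N @^-1` b `&` C) =
    (P (V 0%N @^-1` a) * P (Y 0%N @^-1` b) * P C)%E.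
  move=> ma mb tC; rewrite -(indep_head VY ma mb).
  set h := V 0%N @^-1` a `&` Y 0%N @^-1` b.
  have mh : measurable h.
    by apply: measurableI; [exact: (measurable_preimageT (mV _) ma)|exact: (measurable_preimageT (mY _) mb)].
  have r0 : 0 <= fine (P h) by apply: fine_ge0.
  have rE : (fine (P h))%:E = P h by rewrite fineK// fin_num_measure.
  (* [P] restricted to the head event, and [P] multiplied by its probability, agree on cylinders. *)
  pose m1 : {measure set T -> \bar R} := mrestr P mh.
  pose m2 : {measure set T -> \bar R} := mscale (NngNum r0) P.
  have -> : P (h `&` C) = m1 C by rewrite /m1/= /mrestr setIC.
  have -> : (P h * P C)%E = m2 C by rewrite /m2/= /mscale/= rE.
  apply: (@g_sigma_algebra_measure_unique _ R T (tail_cylinders V Y)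
    (tail_cylinders_measurable mV mY) (fun=> setT) (fun=> tail_cylinders_setT V Y) _
    m1 m2 (@tail_cylinders_setI V Y) _ _ C tC).
  - by rewrite bigcup_const//; exists 0%N.
  - move=> D tD; rewrite /m1/= /m2/= /mrestr /mscale/= rE setIC.
    by rewrite (indep_head_cylinder VY ma mb tD) (indep_head VY ma mb).
  - move=> k; rewrite /m1/= /mrestr; apply: (le_lt_trans (probability_le1 _ _)).
      exact: measurableI.
    exact: ltry.
set C := W @^-1` c; have tC : <<s tail_cylinders V Y >> C := tW c mc.
have mC : measurable C := tail_m _ tC.
have r0 : 0 <= fine (P C) by apply: fine_ge0.
have rE : (fine (P C))%:E = P C by rewrite fineK// fin_num_measure.
pose VY0 : {mfun T >-> (T1 * T2)%type} := mfun_Sub (mem_set mVY).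
pose m1' : {measure set (T1 * T2) -> \bar R} := pushforward (mrestr P mC) VY0.
pose m1 := m1' mVY.
pose m2 : {measure set (T1 * T2) -> \bar R} := mscale (NngNum r0) (distribution P VY0).
have -> : P ((fun w => (V 0%N w, Y 0%N w)) @^-1` ab `&` C) = m1 ab by [].
have -> : (P ((fun w => (V 0%N w, Y 0%N w)) @^-1` ab) * P C)%E = m2 ab.
  by rewrite /m2/= /mscale/= rE muleC.
apply: (measure_unique [set A `*` B | A in measurable & B in measurable] (fun=> setT)) => //.
- exact: measurable_prod_measurableType.
- move=> _ _ [A mA [B mB <-]] [A' mA' [B' mB' <-]].
  exists (A `&` A'); first exact: measurableI.
  exists (B `&` B'); first exact: measurableI.
  by rewrite setXI.
- by move=> _; exists setT => //; exists setT => //; rewrite setXTT.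
- by rewrite bigcup_const//; exists 0%N.
- move=> _ [A mA [B mB <-]].
  rewrite /m1/= /m2/= /mscale/= /pushforward /mrestr /distribution/= /pushforward rE muleC.
  have -> : (fun w => (V 0%N w, Y 0%N w)) @^-1` (A `*` B) = V 0%N @^-1` A `&` Y 0%N @^-1` B by [].
  by rewrite Phead// (indep_head VY mA mB).
- move=> k; rewrite /m1/= /pushforward /mrestr; apply: (le_lt_trans (probability_le1 _ _)).
    by rewrite preimage_setT setTI.
  exact: ltry.
Qed.

End stick_independence.

(** * Bounded laws are determined by their moments *)

(* The Bernstein operator sum_k C(n,k) u^k (1-u)^(n-k) phi(k), by its recursion in n. *)
Fixpoint bernstein {R : realType} (n : nat) (phi : nat -> R) (u : R) : R :=
  if n is m.+1 then
    u * bernstein m (phi \o succn) u + (1 - u) * bernstein m phi u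
  else phi 0%N.

Section bernstein_operator.
Variable R : realType.
Implicit Types (phi psi : nat -> R) (u c : R).

Lemma ler_bernstein n phi psi u : 0 <= u <= 1 -> (forall k, phi k <= psi k) ->
  bernstein n phi u <= bernstein n psi u.
Proof.
move=> /andP[u0 u1]; elim: n phi psi => //= n IH phi psi le.
by rewrite lerD// ler_wpM2l ?subr_ge0//; apply: IH => k /=.
Qed.

Lemma bernstein_affine n phi (x y : R) u :
  bernstein n (fun k => x + y * phi k) u = x + y * bernstein n phi u.
Proof.
elim: n phi => //= n IH phi.
have -> : (fun k => x + y * phi k) \o succn = (fun k => x + y * (phi \o succn) k) by [].
by rewrite !IH; ring.
Qed.

(** Variance plus squared bias of a Binomial(n, u) variable around c. *)
Lemma bernstein_sqr n c u :
  bernstein n (fun k => (k%:R - c) ^+ 2) u = n%:R * (u * (1 - u)) + (n%:R * u - c) ^+ 2.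
Proof.
elim: n c => [|n IH] c /=; first by rewrite /bernstein; ring.
have -> : (fun k => (k%:R - c) ^+ 2) \o succn = (fun k => (k%:R - (c - 1)) ^+ 2) :> (nat -> R).
  by apply/funext => k /=; rewrite -natr1; congr (_ ^+ 2); ring.
by rewrite !IH -natr1; ring.
Qed.

(** Chebyshev's argument: |x| <= e + x^2 / e trades the Lipschitz bound for the second moment, and u
    (1 - u) <= 1. *)
Lemma bernstein_approx (h : R -> R) (L e u : R) n : 0 <= L -> 0 < e ->
  (forall x y, `|h x - h y| <= L * `|x - y|) -> 0 <= u <= 1 -> (0 < n)%N ->
  `|bernstein n (fun k => h (k%:R / n%:R)) u - h u| <= L * (e + (e * n%:R)^-1).
Proof.
move=> L0 e0 hL u01 n0; have /andP[u0 u1] := u01.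
have n0' : 0 < n%:R :> R by rewrite ltr0n.
have nn0 : n%:R != 0 :> R by rewrite gt_eqF.
have key k : `|h (k%:R / n%:R) - h u| <=
    L * e + L / (e * n%:R ^+ 2) * (k%:R - n%:R * u) ^+ 2.
  apply: le_trans (hL _ _) _.
  have -> : L * e + L / (e * n%:R ^+ 2) * (k%:R - n%:R * u) ^+ 2 =
     L * (e + (k%:R / n%:R - u) ^+ 2 / e).
    by field; rewrite nn0 (gt_eqF e0).
  rewrite ler_wpM2l//; set x := _ - u.
  rewrite -real_normK ?num_real//; set y := `|x|.
  have y0 : 0 <= y by rewrite normr_ge0.
  have [ye|ey] := leP y e; first by rewrite (le_trans ye)// lerDl divr_ge0 ?sqr_ge0 ?ltW.
  apply: (@le_trans _ _ (y ^+ 2 / e)); last by rewrite lerDr ltW.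
  by rewrite ler_pdivlMr// expr2 ler_wpM2l// ltW.
set w := bernstein n (fun k => (k%:R - n%:R * u) ^+ 2) u.
have wE : L * e + L / (e * n%:R ^+ 2) * w <= L * (e + (e * n%:R)^-1).
  rewrite /w bernstein_sqr subrr expr0n addr0.
  have -> : L * e + L / (e * n%:R ^+ 2) * (n%:R * (u * (1 - u)))
     = L * (e + (e * n%:R)^-1 * (u * (1 - u))).
    by field; rewrite nn0 (gt_eqF e0).
  rewrite ler_wpM2l// lerD2l ler_piMr ?invr_ge0 ?mulr_ge0 ?ltW//.
  by nra.
rewrite ler_norml; apply/andP; split.
  rewrite -lerBlDr opprK addrC -[leLHS]opprK -[leRHS]opprK; rewrite !opprK.
  apply: (@le_trans _ _ (bernstein n (fun k => (h u - L * e) +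
     (- (L / (e * n%:R ^+ 2))) * (k%:R - n%:R * u) ^+ 2) u)).
    rewrite bernstein_affine -/w; lra.
  by apply: ler_bernstein => // k; have := key k; rewrite ler_norml => /andP[+ _]; lra.
rewrite lerBlDr.
apply: (@le_trans _ _ (bernstein n (fun k => (h u + L * e) +
     (L / (e * n%:R ^+ 2)) * (k%:R - n%:R * u) ^+ 2) u)).
  by apply: ler_bernstein => // k; have := key k; rewrite ler_norml => /andP[_]; lra.
rewrite bernstein_affine -/w; lra.
Qed.

Lemma bernstein_ge0 n phi u : 0 <= u <= 1 -> (forall k, 0 <= phi k) ->
  0 <= bernstein n phi u.
Proof.
move=> /andP[u0 u1]; elim: n phi => //= n IH phi phi0.
by rewrite addr_ge0// mulr_ge0 ?subr_ge0//; apply: IH => k /=.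
Qed.

Lemma measurable_bernstein n phi : measurable_fun setT (bernstein n phi).
Proof.
elim: n phi => [|n IH] phi /=; first exact: measurable_cst.
apply: measurable_funD; apply: measurable_funM => //.
exact: measurable_funB.
Qed.

End bernstein_operator.

Definition mixed_moment {d} {T : measurableType d} {R : realType}
    (P : probability T R) (X : T -> R) (j k : nat) : \bar R :=
  (\int[P]_w (X w ^+ j * (1 - X w) ^+ k)%:E)%E.

Section moments_determine_law.
Context d d' (T : measurableType d) (T' : measurableType d') (R : realType).
Variables (P : probability T R) (P' : probability T' R).
Variables (U : T -> R) (U' : T' -> R).
Hypotheses (mU : measurable_fun setT U) (mU' : measurable_fun setT U').
Hypotheses (U01 : forall w, 0 <= U w <= 1) (U'01 : forall w, 0 <= U' w <= 1).
Hypothesis moments : forall n,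
  (\int[P]_w (U w ^+ n)%:E = \int[P']_w (U' w ^+ n)%:E)%E.

Let split_mom d0 (T0 : measurableType d0) (Q : probability T0 R) (X : T0 -> R)
  (g : R -> R) : measurable_fun setT X -> (forall w, 0 <= X w <= 1) ->
  measurable_fun setT g -> (forall u, 0 <= u <= 1 -> 0 <= g u) -> forall j k,
  (\int[Q]_w (X w ^+ j * (1 - X w) ^+ k * g (X w))%:E =
   \int[Q]_w (X w ^+ j.+1 * (1 - X w) ^+ k * g (X w))%:E +
   \int[Q]_w (X w ^+ j * (1 - X w) ^+ k.+1 * g (X w))%:E)%E.
Proof.
move=> mX X01 mg g0 j k; rewrite -ge0_integralD//; last 4 first.
- move=> w _; have /andP[? ?] := X01 w.
  by rewrite lee_fin !mulr_ge0 ?exprn_ge0 ?subr_ge0 ?g0.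
- apply/measurable_EFinP; apply: measurable_funM; last exact: measurableT_comp.
  by apply: measurable_funM; apply: measurable_funX => //; exact: measurable_funB.
- move=> w _; have /andP[? ?] := X01 w.
  by rewrite lee_fin !mulr_ge0 ?exprn_ge0 ?subr_ge0 ?g0.
- apply/measurable_EFinP; apply: measurable_funM; last exact: measurableT_comp.
  by apply: measurable_funM; apply: measurable_funX => //; exact: measurable_funB.
by apply: eq_integral => w _; rewrite -EFinD !exprS; congr EFin; ring.
Qed.

Let mom_fin d0 (T0 : measurableType d0) (Q : probability T0 R) (X : T0 -> R) j k :
  measurable_fun setT X -> (forall w, 0 <= X w <= 1) -> mixed_moment Q X j k \is a fin_num.
Proof.
move=> mX X01; rewrite ge0_fin_numE; last first.
  by apply: integral_ge0 => w _; have /andP[? ?] := X01 w; rewrite lee_fin mulr_ge0 ?exprn_ge0 ?subr_ge0.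
apply: (@le_lt_trans _ _ (\int[Q]_w 1%:E)%E).
  apply: ge0_le_integral => //.
  - by move=> w _; have /andP[? ?] := X01 w; rewrite lee_fin mulr_ge0 ?exprn_ge0 ?subr_ge0.
  - by apply/measurable_EFinP; apply: measurable_funM; apply: measurable_funX => //; exact: measurable_funB.
  - move=> w _; have /andP[? ?] := X01 w.
    by rewrite lee_fin mulr_ile1 ?exprn_ge0 ?subr_ge0 ?exprn_ile1 ?subr_ge0//; lra.
by rewrite integral_cst//= mul1e probability_setT ltry.
Qed.

(** Induction on the power of 1 - U: [split_mom] expresses the moment (j, k + 1) as a difference of
    moments with power k, which is legitimate since all are finite. *)
Let mom_eq j k : mixed_moment P U j k = mixed_moment P' U' j k.
Proof.
elim: k j => [|k IH] j.
  rewrite /mixed_moment; under eq_integral do rewrite expr0 mulr1.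
  by under [RHS]eq_integral do rewrite expr0 mulr1.
have e1 := @split_mom _ _ P U (cst 1) mU U01 (measurable_cst _) (fun _ _ => ler01) j k.
have e2 := @split_mom _ _ P' U' (cst 1) mU' U'01 (measurable_cst _) (fun _ _ => ler01) j k.
have r d0 (T0 : measurableType d0) (Q : probability T0 R) (X : T0 -> R) i l :
  (\int[Q]_w (X w ^+ i * (1 - X w) ^+ l * cst 1 (X w))%:E = mixed_moment Q X i l)%E.
  by apply: eq_integral => w _ /=; rewrite mulr1.
rewrite !r in e1 e2; move: (IH j); rewrite e1 e2 IH.
move=> h; have f := @mom_fin _ _ P' U' j.+1 k mU' U'01.
by rewrite -(addeK (mixed_moment P U j k.+1) f) -(addeK (mixed_moment P' U' j k.+1) f) !(addeC _ (mixed_moment P' U' j.+1 k)) h.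
Qed.

(** The weight U^j (1 - U)^k is carried along because one step of the recursion for [bernstein]
    multiplies by U or by 1 - U. *)
Let bern_eq n phi j k : (forall i, 0 <= phi i) ->
  (\int[P]_w (U w ^+ j * (1 - U w) ^+ k * bernstein n phi (U w))%:E =
   \int[P']_w (U' w ^+ j * (1 - U' w) ^+ k * bernstein n phi (U' w))%:E)%E.
Proof.
elim: n phi j k => [|n IH] phi j k phi0 /=.
  have r d0 (T0 : measurableType d0) (Q : probability T0 R) (X : T0 -> R) :
    measurable_fun setT X -> (forall w, 0 <= X w <= 1) ->
    (\int[Q]_w (X w ^+ j * (1 - X w) ^+ k * phi 0%N)%:E = (phi 0%N)%:E * mixed_moment Q X j k)%E.
    move=> mX X01; rewrite /mixed_moment -ge0_integralZl_EFin//.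
    - by apply: eq_integral => w _; rewrite -EFinM mulrC.
    - by move=> w _; have /andP[? ?] := X01 w; rewrite lee_fin mulr_ge0 ?exprn_ge0 ?subr_ge0.
    - by apply/measurable_EFinP; apply: measurable_funM; apply: measurable_funX => //; exact: measurable_funB.
  by rewrite !r// mom_eq.
have r d0 (T0 : measurableType d0) (Q : probability T0 R) (X : T0 -> R) :
    measurable_fun setT X -> (forall w, 0 <= X w <= 1) ->
  (\int[Q]_w (X w ^+ j * (1 - X w) ^+ k * (X w * bernstein n (phi \o succn) (X w)
      + (1 - X w) * bernstein n phi (X w)))%:E =
   \int[Q]_w (X w ^+ j.+1 * (1 - X w) ^+ k * bernstein n (phi \o succn) (X w))%:E +
   \int[Q]_w (X w ^+ j * (1 - X w) ^+ k.+1 * bernstein n phi (X w))%:E)%E.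
  move=> mX X01; rewrite -ge0_integralD//; last 4 first.
  - move=> w _; have /andP[? ?] := X01 w.
    by rewrite lee_fin !mulr_ge0 ?exprn_ge0 ?subr_ge0 ?bernstein_ge0//= => i /=.
  - apply/measurable_EFinP; apply: measurable_funM; last exact: (measurableT_comp (measurable_bernstein _ _) mX).
    by apply: measurable_funM; apply: measurable_funX => //; exact: measurable_funB.
  - move=> w _; have /andP[? ?] := X01 w.
    by rewrite lee_fin !mulr_ge0 ?exprn_ge0 ?subr_ge0 ?bernstein_ge0.
  - apply/measurable_EFinP; apply: measurable_funM; last exact: (measurableT_comp (measurable_bernstein _ _) mX).
    by apply: measurable_funM; apply: measurable_funX => //; exact: measurable_funB.
  by apply: eq_integral => w _; rewrite -EFinD !exprS; congr EFin; ring.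
by rewrite !r// !IH// => i /=.
Qed.

Let bern n phi : (forall i, 0 <= phi i) ->
  (\int[P]_w (bernstein n phi (U w))%:E = \int[P']_w (bernstein n phi (U' w))%:E)%E.
Proof.
move=> phi0; have := bern_eq n 0 0 phi0.
by under eq_integral do rewrite !expr0 !mul1r;
   under [in X in _ = X -> _]eq_integral do rewrite !expr0 !mul1r.
Qed.

(** An inequality up to every e > 0 needs integrals of nonnegative functions only; equality follows
    by exchanging the two variables. *)
Lemma bernstein_le_lipschitz (h : R -> R) (L : R) : 0 <= L -> (forall x, 0 <= h x) ->
  measurable_fun setT h ->
  (forall x y, `|h x - h y| <= L * `|x - y|) ->
  (\int[P]_w (h (U w))%:E <= \int[P']_w (h (U' w))%:E)%E.
Proof.
move=> L0 h0 mh hL; apply/lee_addgt0Pr => e e0.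
have L1 : 0 < L + 1 by rewrite ltr_wpDl.
(* [e'] serves twice in the approximation error, as the cut-off and as a bound for 1 / (e' n), which
   is why n exceeds 1 / e'^2 below; L + 1 replaces L because L may be 0. *)
have [e' e'0 e'E] : exists2 e', 0 < e' & (L + 1) * (e' + e') <= e / 2.
  exists (e / (4 * (L + 1))); first by rewrite divr_gt0// mulr_gt0.
  by rewrite le_eqVlt; apply/orP; left; apply/eqP; field; rewrite gt_eqF.
pose n := (Num.truncn ((e' ^+ 2)^-1)).+1.
have n0 : 0 < n%:R :> R by rewrite ltr0n.
have e'n : (e' * n%:R)^-1 <= e'.
  rewrite -[leRHS]invrK lef_pV2 ?posrE ?mulr_gt0 ?invr_gt0//.
  rewrite -ler_pdivrMl// -invfM -expr2; apply: ltW; exact: truncnS_gt.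
pose B u := bernstein n (fun k => h (k%:R / n%:R)) u.
have B0 u : 0 <= u <= 1 -> 0 <= B u by move=> u01; exact: bernstein_ge0.
have Bh u : 0 <= u <= 1 -> `|B u - h u| <= e / 2.
  move=> u01; apply: le_trans (@bernstein_approx _ h L e' u n L0 e'0 hL u01 isT) _.
  apply: (@le_trans _ _ ((L + 1) * (e' + e'))).
    apply: ler_pM => //.
    - by rewrite addr_ge0 ?(ltW e'0)// invr_ge0 mulr_ge0// ltW.
    - by rewrite lerDl.
    - by rewrite lerD2l.
  exact: e'E.
have step d0 (T0 : measurableType d0) (Q : probability T0 R) (g1 g2 : T0 -> R) :
  measurable_fun setT g1 -> measurable_fun setT g2 -> (forall w, 0 <= g1 w) ->
  (forall w, 0 <= g2 w) -> (forall w, g1 w <= g2 w + e / 2) ->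
  (\int[Q]_w (g1 w)%:E <= \int[Q]_w (g2 w)%:E + (e / 2)%:E)%E.
  move=> mg1 mg2 g10 g20 le12.
  have -> : ((e / 2)%:E = \int[Q]_w (e / 2)%:E)%E.
    by rewrite integral_cst//= probability_setT mule1.
  rewrite -ge0_integralD//; last 3 first.
  - by move=> w _; rewrite lee_fin.
  - exact/measurable_EFinP.
  - by move=> w _; rewrite lee_fin divr_ge0// ltW.
  apply: ge0_le_integral => //.
  - by move=> w _; rewrite lee_fin.
  - exact/measurable_EFinP.
  - by apply: emeasurable_funD => //; exact/measurable_EFinP.
  - by move=> w _; rewrite -EFinD lee_fin.
apply: (@le_trans _ _ (\int[P]_w (B (U w))%:E + (e / 2)%:E)%E).
  apply: step => [||w|w|w]; [exact: measurableT_comp|exact: (measurableT_comp (measurable_bernstein _ _) mU)|exact: h0|exact: B0|].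
  by have := Bh _ (U01 w); rewrite ler_norml => /andP[+ _]; lra.
rewrite {1}/B bern//.
have -> : (e%:E = (e / 2)%:E + (e / 2)%:E)%E by rewrite -EFinD; congr EFin; field.
rewrite addeA leeD2r//.
apply: step => [||w|w|w]; [exact: (measurableT_comp (measurable_bernstein _ _) mU')|exact: measurableT_comp|exact: B0|exact: h0|].
by have := Bh _ (U'01 w); rewrite ler_norml => /andP[_]; rewrite /B; lra.
Qed.

End moments_determine_law.

Section moments_determine_law_unit.
Context d d' (T : measurableType d) (T' : measurableType d') (R : realType).
Variables (P : probability T R) (P' : probability T' R).

Lemma eq_integral_lipschitz (U : T -> R) (U' : T' -> R) (h : R -> R) (L : R) :
  measurable_fun setT U -> measurable_fun setT U' ->
  (forall w, 0 <= U w <= 1) -> (forall w, 0 <= U' w <= 1) ->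
  (forall n, \int[P]_w (U w ^+ n)%:E = \int[P']_w (U' w ^+ n)%:E)%E ->
  0 <= L -> (forall x, 0 <= h x) -> measurable_fun setT h ->
  (forall x y, `|h x - h y| <= L * `|x - y|) ->
  (\int[P]_w (h (U w))%:E = \int[P']_w (h (U' w))%:E)%E.
Proof.
move=> mU mU' U01 U'01 mom L0 h0 mh hL; apply/eqP; rewrite eq_le; apply/andP; split.
  exact: (@bernstein_le_lipschitz _ _ _ _ _ _ _ _ _ mU mU' U01 U'01 mom h L).
exact: (@bernstein_le_lipschitz _ _ _ _ _ _ _ _ _ mU' mU U'01 U01 (fun n => esym (mom n)) h L).
Qed.

(** The ramps min(1, n max(0, x - t)) are n-Lipschitz and increase to the indicator of x > t. *)
Lemma integral_indic_gt d0 (T0 : measurableType d0) (Q : probability T0 R)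
    (X : T0 -> R) (t : R) : measurable_fun setT X ->
  (\int[Q]_w (Num.min 1 (n%:R * Num.max 0 (X w - t)))%:E @[n --> \oo] -->
   Q [set w | (t < X w)%R])%E.
Proof.
move=> mX.
have mA : measurable [set w | t < X w].
  by rewrite -[X in measurable X]setTI; apply: (measurable_fun_ltr (measurable_cst _) mX).
have -> : Q [set w | t < X w] = (\int[Q]_w (\1_[set w | (t < X w)%R] w)%:E)%E.
  by rewrite integral_indic// setIT.
have -> : (fun w => (\1_[set w | (t < X w)%R] w)%:E) =
   (fun w => limn (fun n => (Num.min 1 (n%:R * Num.max 0 (X w - t)))%:E)).
  apply/funext => w; apply/esym/cvg_lim => //; rewrite indicE.
  have [tX|Xt] := ltP t (X w).
    rewrite mem_set//=; apply: cvg_near_cst; near=> n.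
    rewrite max_r ?subr_ge0 ?ltW//; congr EFin; apply/min_idPl.
    rewrite -ler_pdivrMr ?subr_gt0//.
    near: n; exact: nbhs_infty_ger.
  rewrite memNset/=; last by apply/negP; rewrite -leNgt.
  apply: cvg_near_cst; near=> n.
  by rewrite max_l ?subr_le0// mulr0 min_r.
apply: cvg_monotone_convergence => //.
- move=> n; apply/measurable_EFinP; apply: measurable_minr => //.
  apply: measurable_funM => //; apply: measurable_maxr => //.
  exact: measurable_funB.
- by move=> n w _; rewrite lee_fin le_min ler01 mulr_ge0// le_max lexx.
- move=> w _ m n mn; rewrite lee_fin le_min ge_min lexx/= ge_min.
  by rewrite ler_wpM2r ?orbT ?ler_nat// le_max lexx.
Unshelve. all: by end_near. Qed.

(** After scaling to [0, 1], equal moments give equal integrals of Bernstein polynomials, hence of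
    Lipschitz functions, hence of the ramps approximating the indicator of a ray. *)
Theorem moments_determine_law (U : T -> R) (U' : T' -> R) (M : R) :
  measurable_fun setT U -> measurable_fun setT U' -> 0 < M ->
  (forall w, 0 <= U w <= M) -> (forall w, 0 <= U' w <= M) ->
  (forall n, \int[P]_w (U w ^+ n)%:E = \int[P']_w (U' w ^+ n)%:E)%E ->
  forall t, P [set w | t < U w] = P' [set w | t < U' w].
Proof.
move=> mU mU' M0 UM U'M mom t.
have scale d0 (T0 : measurableType d0) (Q : probability T0 R) (X : T0 -> R) :
    measurable_fun setT X -> (forall w, 0 <= X w <= M) ->
    measurable_fun setT (fun w => M^-1 * X w) /\ (forall w, 0 <= M^-1 * X w <= 1).
  move=> mX XM; split; first exact: measurable_funM.
  move=> w; have /andP[? ?] := XM w; rewrite mulr_ge0 ?invr_ge0 ?(ltW M0)//=.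
  by rewrite mulrC ler_pdivrMr// mul1r.
have [mV V01] := scale _ _ P _ mU UM.
have [mV' V'01] := scale _ _ P' _ mU' U'M.
have momV n : (\int[P]_w ((M^-1 * U w) ^+ n)%:E = \int[P']_w ((M^-1 * U' w) ^+ n)%:E)%E.
  under eq_integral do rewrite exprMn EFinM.
  under [RHS]eq_integral do rewrite exprMn EFinM.
  have M1 : 0 <= M^-1 ^+ n by rewrite exprn_ge0// invr_ge0 ltW.
  rewrite ge0_integralZl_EFin//; last 2 first.
  - by move=> w _; have /andP[? ?] := UM w; rewrite lee_fin exprn_ge0.
  - by apply/measurable_EFinP; exact: measurable_funX.
  rewrite ge0_integralZl_EFin ?mom//.
  - by move=> w _; have /andP[? ?] := U'M w; rewrite lee_fin exprn_ge0.
  - by apply/measurable_EFinP; exact: measurable_funX.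
have tE d0 (T0 : measurableType d0) (Q : probability T0 R) (X : T0 -> R) :
    [set w | t < X w] = [set w | M^-1 * t < M^-1 * X w].
  by apply/funext => w /=; rewrite ltr_pM2l// invr_gt0.
rewrite (tE _ _ P) (tE _ _ P').
have c := @integral_indic_gt _ _ P' _ (M^-1 * t) mV'.
have c' := @integral_indic_gt _ _ P _ (M^-1 * t) mV.
rewrite -(cvg_lim _ c)// -(cvg_lim _ c')//; congr (lim (_ @ \oo)).
apply/funext => n.
apply: (@eq_integral_lipschitz _ _ (fun x => Num.min 1 (n%:R * Num.max 0 (x - M^-1 * t))) n%:R) => //.
- by move=> x; rewrite le_min ler01 mulr_ge0// le_max lexx.
- apply: measurable_minr => //.
  apply: measurable_funM => //; apply: measurable_maxr => //.
  exact: measurable_funB.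
- move=> x y; set s := M^-1 * t.
  have h1 (u v : R) : `|Num.min 1 u - Num.min 1 v| <= `|u - v|.
    by rewrite /Num.min; do 2 case: ifPn; rewrite ?ler_norml -?leNgt => ? ?; 
      case: (ler0P (u - v)) => ?; lra.
  have h2 (u v : R) : `|Num.max 0 u - Num.max 0 v| <= `|u - v|.
    by rewrite /Num.max; do 2 case: ifPn; rewrite ?ler_norml -?leNgt => ? ?; 
      case: (ler0P (u - v)) => ?; lra.
  apply: le_trans (h1 _ _) _; rewrite -mulrBr normrM ger0_norm// ler_wpM2l//.
  by apply: le_trans (h2 _ _) _; rewrite opprB addrA subrK.
Qed.

End moments_determine_law_unit.

(** * Stick-breaking integrals *)

Section stick_integral_theory.
Local Open Scope ereal_scope.
Context d (T : measurableType d) (R : realType).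
Implicit Types (V : nat -> T -> R) (Y : nat -> T -> \bar R).

Lemma measurable_stick_weight V k : (forall k, measurable_fun setT (V k)) ->
  measurable_fun setT (stick_weight V k).
Proof.
move=> mV; apply: measurable_funM; first exact: mV.
by apply: measurable_prod => j _; exact: measurable_funB.
Qed.

Lemma measurable_stick_integral V Y : (forall k, measurable_fun setT (V k)) ->
  (forall k, measurable_fun setT (Y k)) -> measurable_fun setT (stick_integral V Y).
Proof.
move=> mV mY; apply: measurable_lim_ereal => n; apply: emeasurable_sum => k.
by apply: emeasurable_funM => //; apply/measurable_EFinP; exact: measurable_stick_weight.
Qed.

Lemma stick_weight0 V w : stick_weight V 0 w = V 0%N w.
Proof. by rewrite /stick_weight big_ord0 mulr1. Qed.

Lemma stick_weightS V k w :
  stick_weight V k.+1 w = ((1 - V 0%N w) * stick_weight (fun k => V k.+1) k w)%R.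
Proof. by rewrite /stick_weight big_ord_recl/= mulrCA. Qed.

Section regular.
Variables (V : nat -> T -> R) (Y : nat -> T -> \bar R).
Hypotheses (V01 : forall k w, (0 < V k w < 1)%R) (Y0 : forall k w, 0 <= Y k w).

Lemma stick_weight_ge0 k w : (0 <= stick_weight V k w)%R.
Proof.
rewrite mulr_ge0//; first by have /andP[/ltW] := V01 k w.
by apply: prodr_ge0 => j _; have /andP[_ /ltW] := V01 j w; rewrite subr_ge0.
Qed.

Lemma stick_term_ge0 k w : 0 <= (stick_weight V k w)%:E * Y k w.
Proof. by rewrite mule_ge0 ?lee_fin ?stick_weight_ge0. Qed.

Lemma stick_integral_ge0 w : 0 <= stick_integral V Y w.
Proof. by apply: nneseries_ge0 => k _ _; exact: stick_term_ge0. Qed.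

Lemma sum_stick_weight n w :
  (\sum_(k < n) stick_weight V k w = 1 - \prod_(k < n) (1 - V k w))%R.
Proof.
elim: n => [|n IH]; first by rewrite !big_ord0 subrr.
by rewrite !big_ord_recr/= IH /stick_weight; ring.
Qed.

Lemma sum_stick_weight_le1 n w : (\sum_(k < n) stick_weight V k w <= 1)%R.
Proof.
rewrite sum_stick_weight lerBlDr lerDl; apply: prodr_ge0 => j _.
by have /andP[_ /ltW] := V01 j w; rewrite subr_ge0.
Qed.

Lemma stick_integral_le (M : R) : (forall k w, Y k w <= M%:E) -> forall w,
  stick_integral V Y w <= M%:E.
Proof.
move=> YM w; have M0 : (0 <= M)%R by rewrite -lee_fin (le_trans _ (YM 0%N w)).
apply: lime_le; first by apply: is_cvg_nneseries => k _ _; exact: stick_term_ge0.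
apply: nearW => n; rewrite big_mkord.
apply: (@le_trans _ _ (\sum_(k < n) (stick_weight V k w * M)%:E)).
  by apply: lee_sum => k _; rewrite [leRHS]EFinM lee_wpmul2l// lee_fin stick_weight_ge0.
by rewrite sumEFin lee_fin -mulr_suml ler_piMl// sum_stick_weight_le1.
Qed.

End regular.

Lemma stick_integral_rec V Y w : (forall k w, (0 < V k w < 1)%R) ->
  (forall k w, 0 <= Y k w) ->
  stick_integral V Y w = (V 0%N w)%:E * Y 0%N w +
    (1 - V 0%N w)%:E * stick_integral (fun k => V k.+1) (fun k => Y k.+1) w.
Proof.
move=> V01 Y0; rewrite /stick_integral nneseries_recl//; last first.
  by move=> k _; exact: stick_term_ge0.
rewrite stick_weight0; congr (_ + _).
rewrite -nneseriesZl; last first.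
  by move=> k _; apply: (stick_term_ge0 (V := fun k => V k.+1) (Y := fun k => Y k.+1)).
rewrite -(@nneseries_addn R (fun k => (stick_weight V k w)%:E * Y k w) 1); last first.
  by move=> k; exact: stick_term_ge0.
by apply: eq_eseriesr => k _; rewrite addn1 stick_weightS EFinM muleA.
Qed.

Lemma le_stick_integral V Y Y' w : (forall k w, (0 < V k w < 1)%R) ->
  (forall k w, 0 <= Y k w) -> (forall k, Y k w <= Y' k w) ->
  stick_integral V Y w <= stick_integral V Y' w.
Proof.
move=> V01 Y0 YY'; apply: lee_nneseries => k _; first by move=> _; exact: stick_term_ge0.
by rewrite lee_wpmul2l// lee_fin stick_weight_ge0.
Qed.

End stick_integral_theory.

Section tail.
Context d (T : measurableType d) (R : realType).
Variables (V : nat -> T -> R) (Y : nat -> T -> \bar R).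

(** [T] with the tail sigma-algebra. The generic measurability lemmas, applied over this space,
    prove that a function depends on the tail only, as [indep_head_tail] requires. *)
Let T' : measurableType _ := g_sigma_algebraType (tail_cylinders V Y).

Lemma tail_measurable_V k : measurable_fun setT (V k.+1 : T' -> R).
Proof.
move=> _ B mB; rewrite setTI; apply: sub_sigma_algebra.
exists k.+1, (fun j => if j == k then B else setT), (fun=> setT); split=> //.
  by move=> j; case: ifP.
apply/seteqP; split => w /= => [Bw j _|/(_ k (ltnSn k)) [+ _]]; last by rewrite eqxx.
by split=> //; case: eqP => // ->.
Qed.

Lemma tail_measurable_Y k : measurable_fun setT (Y k.+1 : T' -> \bar R).
Proof.
move=> _ B mB; rewrite setTI; apply: sub_sigma_algebra.
exists k.+1, (fun=> setT), (fun j => if j == k then B else setT); split=> //.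
  by move=> j; case: ifP.
apply/seteqP; split => w /= => [Bw j _|/(_ k (ltnSn k)) [_ +]]; last by rewrite eqxx.
by split=> //; case: eqP => // ->.
Qed.

Lemma tail_measurable_fun d3 (T3 : measurableType d3) (W : T -> T3) :
  measurable_fun setT (W : T' -> T3) ->
  forall c, measurable c -> <<s tail_cylinders V Y >> (W @^-1` c).
Proof. by move=> mW c mc; have := mW measurableT c mc; rewrite setTI. Qed.

Variable P : probability T R.
Hypotheses (mV : forall k, measurable_fun setT (V k))
  (mY : forall k, measurable_fun setT (Y k)) (VY : stick_indep P V Y).

Lemma indep_head_stick_integral :
  indep_pair P (fun w => (V 0%N w, Y 0%N w))
    (stick_integral (fun k => V k.+1) (fun k => Y k.+1)).
Proof.
apply: indep_head_tail => //; apply: tail_measurable_fun.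
exact: (measurable_stick_integral tail_measurable_V tail_measurable_Y).
Qed.

End tail.

Lemma indep_pair_integralM {d d1 d2} {T : measurableType d} {T1 : measurableType d1}
    {T2 : measurableType d2} {R : realType} (P : probability T R)
    (A : T -> T1) (B : T -> T2) (f : T1 -> \bar R) (g : T2 -> \bar R) :
  measurable_fun setT A -> measurable_fun setT B -> indep_pair P A B ->
  measurable_fun setT f -> (forall x, 0 <= f x)%E ->
  measurable_fun setT g -> (forall x, 0 <= g x)%E ->
  (\int[P]_w (f (A w) * g (B w)) = (\int[P]_w f (A w)) * (\int[P]_w g (B w)))%E.
Proof.
move=> mA mB AB mf f0 mg g0.
have := @indep_pair_integral _ _ _ _ _ _ _ P A B mA mB (fun x => f x.1 * g x.2)%E AB.
move=> ->/=.
- transitivity (\int[P]_w (f (A w) * \int[P]_w' g (B w')))%E.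
    by apply: eq_integral => w _; rewrite ge0_integralZl//; exact: measurableT_comp.
  by rewrite ge0_integralZr//; [exact: measurableT_comp|exact: integral_ge0].
- by apply: emeasurable_funM; exact: measurableT_comp.
- by move=> x; rewrite mule_ge0.
Qed.

(** * Moments of stick-breaking means and the coefficient recursion *)

Definition shift {T : Type} (u : nat -> T) : nat -> T := fun k => u k.+1.

(** The atoms are replaced by their values in [0, +oo], and the bounds hold at every sample point,
    not just almost surely, so that series can be split and compared pointwise;
    [regular_sticks_clip] supplies such versions. *)
Definition regular_sticks {d} {T : measurableType d} {R : realType} (al th : R)
    (nu : set (\bar R) -> \bar R) (P : probability T R)
    (V : nat -> T -> R) (Y : nat -> T -> \bar R) : Prop :=
  [/\ PD_stick al th nu P V Y, forall k w, 0 < V k w < 1 & forall k w, (0 <= Y k w)%E].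

(** Real-valued so that the coefficient algebra applies; by [moment_fin] it is the true moment for
    bounded nonnegative X. *)
Definition moment {d} {T : measurableType d} {R : realType} (P : probability T R)
    (X : T -> \bar R) (n : nat) : R :=
  fine (\int[P]_w (`|fine (X w)| ^+ n)%:E)%E.

Lemma fine_bounded {R : realType} (x : \bar R) (M : R) : (0 <= x <= M%:E)%E ->
  (fine x)%:E = x /\ 0 <= fine x <= M.
Proof.
move=> /andP[x0 xM].
have xE : (fine x)%:E = x by rewrite fineK// ge0_fin_numE// (le_lt_trans xM)// ltry.
by split=> //; rewrite fine_ge0//= -lee_fin xE.
Qed.

Section moments.
Context d (T : measurableType d) (R : realType) (P : probability T R).

Lemma moment_fin (X : T -> \bar R) (M : R) n : measurable_fun setT X ->
  (forall w, 0 <= X w <= M%:E)%E ->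
  (\int[P]_w (`|fine (X w)| ^+ n)%:E = (moment P X n)%:E)%E.
Proof.
move=> mX XM; rewrite /moment fineK// ge0_fin_numE; last first.
  by apply: integral_ge0 => w _; rewrite lee_fin exprn_ge0.
apply: (@le_lt_trans _ _ (\int[P]_w (M ^+ n)%:E)%E).
  apply: ge0_le_integral => //.
  - apply/measurable_EFinP; apply: measurable_funX; apply: measurableT_comp => //.
    exact: measurableT_comp.
  - move=> w _; rewrite lee_fin lerXn2r ?nnegrE//.
      by have /andP[h1 h2] := XM w; rewrite -lee_fin (le_trans h1).
    by have [_ /andP[r0 rM]] := fine_bounded (XM w); rewrite ger0_norm.
by rewrite integral_cst//= probability_setT mule1 ltry.
Qed.

Lemma moment_ge0 (X : T -> \bar R) n : 0 <= moment P X n.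
Proof. by apply: fine_ge0; apply: integral_ge0 => w _; rewrite lee_fin exprn_ge0. Qed.

Lemma moment0 (X : T -> \bar R) : moment P X 0 = 1.
Proof.
rewrite /moment; under eq_integral do rewrite expr0.
by rewrite integral_cst//= probability_setT mule1.
Qed.

Lemma moment_le (X : T -> \bar R) (M : R) n : measurable_fun setT X ->
  (forall w, 0 <= X w <= M%:E)%E -> moment P X n <= M ^+ n.
Proof.
move=> mX XM; rewrite -lee_fin -(moment_fin n mX XM).
have -> : (M ^+ n)%:E = (\int[P]_w (M ^+ n)%:E)%E.
  by rewrite integral_cst//= probability_setT mule1.
apply: ge0_le_integral => //.
- apply/measurable_EFinP; apply: measurable_funX; apply: measurableT_comp => //.
  exact: measurableT_comp.
- move=> w _; rewrite lee_fin lerXn2r ?nnegrE//.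
    by have /andP[h1 h2] := XM w; rewrite -lee_fin (le_trans h1).
  by have [_ /andP[r0 rM]] := fine_bounded (XM w); rewrite ger0_norm.
Qed.

End moments.

Section regular_sticks_theory.
Context d (T : measurableType d) (R : realType) (P : probability T R).
Implicit Types (al th : R) (V : nat -> T -> R) (Y : nat -> T -> \bar R).

Lemma regular_sticks_shift al th nu V Y : regular_sticks al th nu P V Y ->
  regular_sticks al (th + al) nu P (shift V) (shift Y).
Proof.
move=> [[mV mY VY lV lY] V01 Y0]; split=> //; last 2 first.
- by move=> k w; exact: V01.
- by move=> k w; exact: Y0.
split=> //.
- by move=> k; exact: mV.
- by move=> k; exact: mY.
- exact: stick_indep_shift.
- move=> k; have -> : th + al + k.+1%:R * al = th + k.+2%:R * al by rewrite -[k.+2%:R]natr1; ring.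
  exact: lV.
- by move=> k; exact: lY.
Qed.

Lemma regular_sticks_iter_shift al th nu V Y i : regular_sticks al th nu P V Y ->
  regular_sticks al (th + i%:R * al) nu P (iter i shift V) (iter i shift Y).
Proof.
move=> VY; elim: i => [|i IH]; first by rewrite mul0r addr0.
by rewrite -natr1 mulrDl mul1r addrA; exact: regular_sticks_shift.
Qed.

(** Coefficient form of E (1 - z X)^(-th-1) = E (1 - z Y)^(-(1-al)) E (1 - z X')^(-th-al), with X'
    the mean after the first stick: expand V Y + (1 - V) X' binomially and insert E V^j (1 -
    V)^(n-j) = (1 - al)_j (th + al)_(n-j) / (th + 1)_n. *)
Lemma stick_integral_moment_rec al th nu V Y (M : R) n : al < 1 -> 0 < th + al ->
  regular_sticks al th nu P V Y -> (forall k w, Y k w <= M%:E)%E ->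
  rising_coef (th + 1) n * moment P (stick_integral V Y) n =
  conv (fun j => rising_coef (1 - al) j * moment P (Y 0%N) j)
       (fun j => rising_coef (th + al) j * moment P (stick_integral (shift V) (shift Y)) j) n.
Proof.
move=> al1 tha VYr YM; have [[mV mY VY lV lY] V01 Y0] := VYr.
have [[mV' mY' VY' lV' lY'] V01' Y0'] := regular_sticks_shift VYr.
have M0 : (0 <= M)%R.
  by have w := point : T; rewrite -lee_fin (le_trans (Y0 0%N w)).
pose X := stick_integral V Y; pose X' := stick_integral (shift V) (shift Y).
have mX : measurable_fun setT X by exact: measurable_stick_integral.
have mX' : measurable_fun setT X' by exact: measurable_stick_integral.
have XM w : (0 <= X w <= M%:E)%E by rewrite stick_integral_ge0// stick_integral_le.
have XM' w : (0 <= X' w <= M%:E)%E.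
  by rewrite stick_integral_ge0// stick_integral_le// => k v; exact: YM.
have YM' w : (0 <= Y 0%N w <= M%:E)%E by rewrite Y0 YM.
have bfin (x : \bar R) : (0 <= x <= M%:E)%E -> (fine x)%:E = x /\ 0 <= fine x.
  by move=> /fine_bounded[? /andP[]].
have XE w : fine (X w) = V 0%N w * fine (Y 0%N w) + (1 - V 0%N w) * fine (X' w).
  have := stick_integral_rec w V01 Y0.
  rewrite -/(X w) -/(X' w).
  have [<- _] := bfin _ (XM w); have [<- _] := bfin _ (XM' w); have [<- _] := bfin _ (YM' w).
  by rewrite -!EFinM -EFinD => -[].
have mfn m : measurable_fun setT (fun x : \bar R => (`|fine x| ^+ m)%:E).
  apply/measurable_EFinP; apply: measurable_funX; apply: measurableT_comp => //.
have term j : (j <= n)%N ->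
  (\int[P]_w ((V 0%N w ^+ j * (1 - V 0%N w) ^+ (n - j)) * fine (Y 0%N w) ^+ j *
     fine (X' w) ^+ (n - j))%:E =
   (rising (1 - al) j * rising (th + al) (n - j) / rising (th + 1) n *
    moment P (Y 0%N) j * moment P X' (n - j))%:E)%E.
  move=> jn.
  pose fV (v : R) : \bar R := (`|v| ^+ j * `|1 - v| ^+ (n - j))%:E.
  have mfV : measurable_fun setT fV.
    apply/measurable_EFinP; apply: measurable_funM; apply: measurable_funX => //.
    by apply: measurableT_comp => //; exact: measurable_funB.
  have fV0 v : (0 <= fV v)%E by rewrite lee_fin mulr_ge0.
  pose fY (y : \bar R) : \bar R := (`|fine y| ^+ j)%:E.
  pose fX (x : \bar R) : \bar R := (`|fine x| ^+ (n - j))%:E.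
  transitivity (\int[P]_w ((fV (V 0%N w) * fY (Y 0%N w)) * fX (X' w)))%E.
    apply: eq_integral => w _; rewrite /fV /fY /fX -!EFinM.
    have /andP[v0 v1] := V01 0%N w.
    have [_ y0] := bfin _ (YM' w); have [_ x0] := bfin _ (XM' w).
    by rewrite (ger0_norm y0) (ger0_norm x0) (gtr0_norm v0) gtr0_norm ?subr_gt0.
  have mVY : measurable_fun setT (fun w => (V 0%N w, Y 0%N w)) by exact: measurable_fun_pair.
  (* Independence is used twice: the first stick and value against the tail mean, then the stick
     against its value. *)
  rewrite (@indep_pair_integralM _ _ _ _ _ _ _ P (fun w => (V 0%N w, Y 0%N w)) X'
    (fun p => fV p.1 * fY p.2)%E fX)//; last 5 first.
  - exact: indep_head_stick_integral.
  - by apply: emeasurable_funM; apply: measurableT_comp => //; exact: mfn.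
  - by move=> p; rewrite mule_ge0// lee_fin exprn_ge0.
  - exact: mfn.
  - by move=> x; rewrite lee_fin exprn_ge0.
  rewrite (@indep_pair_integralM _ _ _ _ _ _ _ P (V 0%N) (Y 0%N) fV fY)//; last 3 first.
  - exact: indep_head.
  - exact: mfn.
  - by move=> x; rewrite lee_fin exprn_ge0.
  rewrite /fY /fX (moment_fin P j (mY 0%N) YM') (moment_fin P (n - j) mX' XM').
  have := @beta_law_moments _ _ _ P _ _ _ (mV 0%N) (lV 0%N) j (n - j).
  rewrite mul1r subr_gt0 => -> //.
  rewrite -!EFinM subnKC//; congr (_ / rising _ _ * _ * _)%:E; ring.
have momE : moment P X n = \sum_(j < n.+1) (rising (1 - al) j * rising (th + al) (n - j) / rising (th + 1) n *
    moment P (Y 0%N) j * moment P X' (n - j)) *+ 'C(n, j).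
  apply: EFin_inj; rewrite -(moment_fin P n mX XM) -sumEFin.
  transitivity (\int[P]_w \sum_(j < n.+1) (((V 0%N w ^+ j * (1 - V 0%N w) ^+ (n - j)) *
      fine (Y 0%N w) ^+ j * fine (X' w) ^+ (n - j)) *+ 'C(n, j))%:E)%E.
    apply: eq_integral => w _; rewrite sumEFin; congr EFin.
    have [_ x0] := bfin _ (XM w); rewrite (ger0_norm x0) XE addrC exprDn.
    by apply: eq_bigr => j _; rewrite !exprMn; congr (_ *+ _); ring.
  rewrite ge0_integral_sum//; last 2 first.
  - move=> j; apply/measurable_EFinP; under eq_fun do rewrite -mulr_natr.
    apply: measurable_funM => //; apply: measurable_funM; last first.
      by apply: measurable_funX; exact: measurableT_comp.
    apply: measurable_funM; last by apply: measurable_funX; exact: measurableT_comp.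
    by apply: measurable_funM; apply: measurable_funX => //; exact: measurable_funB.
  - move=> j w _; rewrite lee_fin mulrn_wge0//.
    have /andP[/ltW v0 /ltW v1] := V01 0%N w.
    have [_ y0] := bfin _ (YM' w); have [_ x0] := bfin _ (XM' w).
    by rewrite !mulr_ge0// exprn_ge0// subr_ge0.
  apply: eq_bigr => j _; have jn : (j <= n)%N by rewrite -ltnS.
  under eq_integral do rewrite -mulr_natl EFinM.
  rewrite ge0_integralZl_EFin//; last 2 first.
  - move=> w _; rewrite lee_fin.
    have /andP[/ltW v0 /ltW v1] := V01 0%N w.
    have [_ y0] := bfin _ (YM' w); have [_ x0] := bfin _ (XM' w).
    by rewrite !mulr_ge0// exprn_ge0// subr_ge0.
  - apply/measurable_EFinP; apply: measurable_funM; last first.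
      by apply: measurable_funX; exact: measurableT_comp.
    apply: measurable_funM; last by apply: measurable_funX; exact: measurableT_comp.
    by apply: measurable_funM; apply: measurable_funX => //; exact: measurable_funB.
  by rewrite term// -EFinM mulr_natl.
rewrite -/X momE mulr_sumr /conv; apply: eq_bigr => j _.
have jn : (j <= n)%N by rewrite -ltnS.
rewrite -/X' /rising_coef -mulr_natl -(bin_fact jn) !natrM.
have th1 : 0 < th + 1 by lra.
have r0 : rising (th + 1) n != 0 by rewrite gt_eqF// rising_gt0.
have f1 : j`!%:R != 0 :> R by rewrite pnatr_eq0 -lt0n fact_gt0.
have f2 : (n - j)`!%:R != 0 :> R by rewrite pnatr_eq0 -lt0n fact_gt0.
have f3 : 'C(n, j)%:R != 0 :> R by rewrite pnatr_eq0 -lt0n bin_gt0.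
by field; rewrite r0 f1 f2 f3.
Qed.

End regular_sticks_theory.

Lemma moment_eq_law {d d'} {T : measurableType d} {T' : measurableType d'} {R : realType}
    (P : probability T R) (P' : probability T' R) (X : T -> \bar R) (X' : T' -> \bar R) n :
  measurable_fun setT X -> measurable_fun setT X' ->
  (forall B, measurable B -> P (X @^-1` B) = P' (X' @^-1` B)) ->
  moment P X n = moment P' X' n.
Proof.
move=> mX mX' e; congr fine.
apply: (@eq_law_integral _ _ _ _ _ _ _ P P' X X' (fun x => (`|fine x| ^+ n)%:E)) => //.
by apply/measurable_EFinP; apply: measurable_funX; apply: measurableT_comp.
Qed.

(* The right-hand side, divided by [rising_coef (th + 1) n], is the n-th moment of
   B X0 + (1 - B) X1 with B ~ Beta(1, th) independent of X0 and X1. *)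
Lemma stick_integral_moment_conv {d0 d1} {T0 : measurableType d0} {T1 : measurableType d1}
    {R : realType} (al th M : R) nu (P0 : probability T0 R) (P1 : probability T1 R)
    (V0 : nat -> T0 -> R) (Y0 : nat -> T0 -> \bar R)
    (V1 : nat -> T1 -> R) (Y1 : nat -> T1 -> \bar R) n :
  0 < al < 1 -> 0 <= th ->
  regular_sticks al 0 nu P0 V0 Y0 -> regular_sticks al th nu P1 V1 Y1 ->
  (forall k w, Y0 k w <= M%:E)%E -> (forall k w, Y1 k w <= M%:E)%E ->
  rising_coef (th + 1) n * moment P1 (stick_integral V1 Y1) n =
  conv (moment P0 (stick_integral V0 Y0))
       (fun j => rising_coef th j * moment P1 (stick_integral V1 Y1) j) n.
Proof.
move=> al01 th0 r0 r1 Y0M Y1M; have [al0 al1] := andP al01.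
have [[_ mY0 _ _ lY0] _ Y00] := r0; have [[_ mY1 _ _ lY1] _ Y10] := r1.
pose h j := rising_coef (1 - al) j * moment P0 (Y0 0%N) j.
pose a i j := rising_coef (i%:R * al) j *
  moment P0 (stick_integral (iter i shift V0) (iter i shift Y0)) j.
pose b i j := rising_coef (th + i%:R * al) j *
  moment P1 (stick_integral (iter i shift V1) (iter i shift Y1)) j.
have M0 : 0 <= M by have w := point : T0; rewrite -lee_fin (le_trans (Y00 0%N w)).
have iterM d (T : measurableType d) (Y : nat -> T -> \bar R) i :
  (forall k w, Y k w <= M%:E)%E -> (forall k w, iter i shift Y k w <= M%:E)%E.
  by move=> YM; elim: i => //= i IH k w; exact: IH.
have rec d (T : measurableType d) (P : probability T R) V Y s i k : 0 <= s ->
   regular_sticks al s nu P V Y -> (forall k w, Y k w <= M%:E)%E ->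
   rising_coef (s + i%:R * al + 1) k * moment P (stick_integral (iter i shift V) (iter i shift Y)) k =
   conv h (fun j => rising_coef (s + i.+1%:R * al) j *
      moment P (stick_integral (iter i.+1 shift V) (iter i.+1 shift Y)) j) k.
  move=> s0 r YM; have ri := regular_sticks_iter_shift i r.
  have [[_ mYi _ _ lYi] _ _] := ri.
  have sal : 0 < s + i%:R * al + al by rewrite ltr_wpDl// addr_ge0// mulr_ge0// ltW.
  rewrite (stick_integral_moment_rec k al1 sal ri (iterM _ _ _ i YM)).
  have -> : s + i.+1%:R * al = s + i%:R * al + al by rewrite -natr1 mulrDl mul1r addrA.
  apply: eq_conv => // j _; rewrite /h; congr (_ * _).
  by apply: moment_eq_law => // B mB; rewrite lYi// lY0.
(* Passes from exponent s + 1 to s, which brings the stick recursion [rec] into the form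
   [conv_coef_add] expects; it remains true at s = 0. *)
have step s k : 0 <= s -> (s + k%:R) * rising_coef s k = s * rising_coef (s + 1) k.
  move=> s0; rewrite /rising_coef !mulrA; congr (_ / _).
  by rewrite -risingSl mulrC -risingS.
have ria d (T : measurableType d) (P : probability T R) V Y s i k : 0 <= s ->
   regular_sticks al s nu P V Y -> (forall k w, Y k w <= M%:E)%E ->
   0 <= rising_coef (s + i%:R * al) k * moment P (stick_integral (iter i shift V) (iter i shift Y)) k
     <= M ^+ k * rising_coef (s + i%:R * al) k.
  move=> s0 r YM; have [[mVi mYi _ _ _] Vi01 Yi0] := regular_sticks_iter_shift i r.
  have sal : 0 <= s + i%:R * al by rewrite addr_ge0// mulr_ge0// ltW.
  rewrite mulr_ge0 ?rising_coef_ge0 ?moment_ge0//= mulrC ler_wpM2r ?rising_coef_ge0//.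
  apply: moment_le; first exact: measurable_stick_integral.
  by move=> w; rewrite stick_integral_ge0// stick_integral_le// => k' v; exact: iterM.
have key : forall n i j, b (i + j)%N n = conv (a i) (b j) n.
  apply: (@conv_coef_add R al th M h a b) => //.
  - by rewrite /h rising_coef0 moment0 mulr1.
  - by move=> i; rewrite /a rising_coef0 moment0 mulr1.
  - by move=> i; rewrite /b rising_coef0 moment0 mulr1.
  - by move=> i k; have := ria _ _ _ _ _ _ i k (lexx 0) r0 Y0M; rewrite add0r.
  - by move=> i k; exact: ria.
  - move=> i k; rewrite /a mulrA step; last by rewrite mulr_ge0// ltW.
    rewrite -[LHS]mulrA; congr (_ * _); have := rec _ _ _ _ _ _ i k (lexx 0) r0 Y0M.
    by rewrite add0r => ->; apply: eq_conv => // j _; rewrite add0r.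
  - move=> i k; rewrite /b mulrA step; last by rewrite addr_ge0// mulr_ge0// ltW.
    by rewrite -[LHS]mulrA rec.
have := rec _ _ _ _ _ _ 0%N n th0 r1 Y1M; rewrite mul0r addr0 => ->.
(* Multiplicativity at i = 1, j = 0: the coefficients at th + al are those at al convolved with
   those at th. *)
transitivity (conv h (conv (a 1%N) (b 0%N)) n).
  by apply: eq_conv => // k _; rewrite -key.
rewrite convA; apply: eq_conv => k _; last by rewrite /b mul0r addr0.
have := rec _ _ _ _ _ _ 0%N k (lexx 0) r0 Y0M; rewrite mul0r !add0r.
(* Because (1)_k / k! = 1, the recursion at s = 0 identifies [conv h (a 1)] with the plain moments
   of the PD(al, 0) mean. *)
have -> : rising_coef (1 : R) k = 1.
  rewrite /rising_coef; have -> : rising (1 : R) k = k`!%:R.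
    elim: k => [|k IH]; first by rewrite rising0.
    by rewrite risingS IH factS natrM mulrC nat1r.
  by rewrite divff// pnatr_eq0 -lt0n fact_gt0.
rewrite mul1r => ->; apply: eq_conv => // j _; by rewrite add0r.
Qed.

Lemma rising1 {R : realType} k : rising (1 : R) k = k`!%:R.
Proof.
elim: k => [|k IH]; first by rewrite rising0.
by rewrite risingS IH factS natrM mulrC nat1r.
Qed.

(** The rays above real levels form a pi-system generating the Borel sets of the extended line, so
    Dynkin's theorem applies. *)
Lemma eq_law_rays {d d'} {T : measurableType d} {T' : measurableType d'} {R : realType}
    (P : probability T R) (P' : probability T' R) (X : T -> \bar R) (X' : T' -> \bar R) :
  measurable_fun setT X -> measurable_fun setT X' ->
  (forall t : R, P [set w | t%:E < X w]%E = P' [set w | t%:E < X' w]%E) ->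
  forall B, measurable B -> P (X @^-1` B) = P' (X' @^-1` B).
Proof.
move=> mX mX' XX'.
have mpre B : measurable B -> measurable (X @^-1` B) by exact: measurable_preimageT.
have mpre' B : measurable B -> measurable (X' @^-1` B) by exact: measurable_preimageT.
move=> B mB.
have mE : @measurable _ (\bar R) = <<s @ErealGenOInfty.G R >> by exact: ErealGenOInfty.measurableE.
apply: (@dynkin_induction _ (\bar R) (@ErealGenOInfty.G R)
   (fun B => P (X @^-1` B) = P' (X' @^-1` B)) mE); last by rewrite -mE.
- move=> _ _ [r ->] [s ->]; exists (Num.max r s).
  apply/seteqP; split => x /=; rewrite !in_itv/= !andbT.
    by move=> [rx sx]; rewrite EFin_max gt_max rx sx.
  by rewrite EFin_max gt_max => /andP[].
- by rewrite !preimage_setT !probability_setT.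
- move=> _ [r ->]; have := XX' r.
  by congr (P _ = P' _); apply/seteqP; split => w /=; rewrite in_itv/= andbT.
- move=> S mS PS.
  have -> : X @^-1` (~` S) = ~` (X @^-1` S) by [].
  have -> : X' @^-1` (~` S) = ~` (X' @^-1` S) by [].
  by rewrite (probability_setC P (mpre S mS)) (probability_setC P' (mpre' S mS)) PS.
- move=> F mF tF PF.
  have tpre (S : Type) (Z : S -> \bar R) : trivIset setT (fun n => Z @^-1` F n).
    apply/trivIsetP => i j _ _ ij.
    have -> : Z @^-1` F i `&` Z @^-1` F j = Z @^-1` (F i `&` F j) by [].
    by move/trivIsetP : tF => /(_ i j I I ij) ->; rewrite preimage_set0.
  rewrite (preimage_bigcup _ X) (preimage_bigcup _ X').
  rewrite measure_bigcup; [|by move=> i _; exact: mpre|exact: tpre].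
  rewrite measure_bigcup; [|by move=> i _; exact: mpre'|exact: tpre].
  by apply: eq_eseriesr => i _; exact: PF.
Qed.

Lemma integral_prodM {d1 d2} {T1 : measurableType d1} {T2 : measurableType d2}
    {R : realType} (P : probability T1 R) (Q : probability T2 R)
    (f : T1 -> \bar R) (g : T2 -> \bar R) :
  measurable_fun setT f -> (forall x, 0 <= f x)%E ->
  measurable_fun setT g -> (forall x, 0 <= g x)%E ->
  (\int[P \x Q]_p (f p.1 * g p.2) = (\int[P]_x f x) * (\int[Q]_y g y))%E.
Proof.
move=> mf f0 mg g0; rewrite fubini_tonelli1/=; last 2 first.
- by apply: emeasurable_funM; exact: measurableT_comp.
- by move=> p; rewrite mule_ge0.
rewrite /fubini_F/=; transitivity (\int[P]_x (f x * \int[Q]_y g y))%E.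
  by apply: eq_integral => x _; rewrite ge0_integralZl.
by rewrite ge0_integralZr//; exact: integral_ge0.
Qed.

(** The strict inequality makes {v > t} exactly the increasing union of the events {u n > t}. *)
Lemma cvg_probability_gt {d} {T : measurableType d} {R : realType} (P : probability T R)
    (u : nat -> T -> \bar R) (v : T -> \bar R) (t : R) :
  (forall n, measurable_fun setT (u n)) ->
  (forall w, nondecreasing_seq (u ^~ w)) ->
  (forall w, u n w @[n --> \oo] --> v w) ->
  (P [set w | t%:E < u n w]%E @[n --> \oo] --> P [set w | t%:E < v w]%E)%E.
Proof.
move=> mu ndu uv.
have mF n : measurable [set w | (t%:E < u n w)%E].
  by rewrite -[X in measurable X]setTI; exact: emeasurable_fun_o_infty.
have -> : [set w | (t%:E < v w)%E] = \bigcup_n [set w | (t%:E < u n w)%E].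
  apply/seteqP; split => w /=.
    move=> tv; apply: contrapT => h.
    have : (v w <= t%:E)%E.
      rewrite -(cvg_lim _ (uv w))//; apply: lime_le; first by apply/cvg_ex; exists (v w).
      by apply: nearW => n; rewrite leNgt; apply/negP => tu; apply: h; exists n.
    by rewrite leNgt tv.
  move=> [n _ /= tu]; apply: (lt_le_trans tu).
  rewrite -(cvg_lim _ (uv w))//; apply: lime_ge; first by apply/cvg_ex; exists (v w).
  by exists n => // m /= nm; exact: ndu.
apply: nondecreasing_cvg_mu => //; first exact: bigcupT_measurable.
by move=> m n mn; apply/subsetPset => w /= h; apply: (lt_le_trans h); exact: ndu.
Qed.

(** * The Beta(1, theta) fixed-point equation *)

(** Living on a product space, its three ingredients are independent under the product measure. *)
Definition mix {T2 T0 T1 : Type} {R : realType} (B : T2 -> R)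
    (X0 : T0 -> \bar R) (X1 : T1 -> \bar R) (p : T2 * (T0 * T1)) : \bar R :=
  ((B p.1)%:E * X0 p.2.1 + (1 - B p.1)%:E * X1 p.2.2)%E.

Lemma measurable_mix {d2 d0 d1} {T2 : measurableType d2} {T0 : measurableType d0}
    {T1 : measurableType d1} {R : realType} (B : T2 -> R)
    (X0 : T0 -> \bar R) (X1 : T1 -> \bar R) :
  measurable_fun setT B -> measurable_fun setT X0 -> measurable_fun setT X1 ->
  measurable_fun setT (mix B X0 X1).
Proof.
move=> mB m0 m1; apply: emeasurable_funD; apply: emeasurable_funM.
- by apply/measurable_EFinP; exact: measurableT_comp.
- by apply: measurableT_comp => //; exact: measurableT_comp.
- apply/measurable_EFinP; apply: measurable_funB => //; exact: measurableT_comp.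
- by apply: measurableT_comp => //; exact: measurableT_comp.
Qed.

Lemma integral_prodM3 {d0 d1 d2} {T0 : measurableType d0} {T1 : measurableType d1}
    {T2 : measurableType d2} {R : realType} (P0 : probability T0 R)
    (P1 : probability T1 R) (P2 : probability T2 R)
    (f2 : T2 -> \bar R) (f0 : T0 -> \bar R) (f1 : T1 -> \bar R) :
  measurable_fun setT f2 -> (forall x, 0 <= f2 x)%E ->
  measurable_fun setT f0 -> (forall x, 0 <= f0 x)%E ->
  measurable_fun setT f1 -> (forall x, 0 <= f1 x)%E ->
  (\int[P2 \x (P0 \x P1)]_p (f2 p.1 * (f0 p.2.1 * f1 p.2.2)) =
   (\int[P2]_x f2 x) * ((\int[P0]_x f0 x) * (\int[P1]_x f1 x)))%E.
Proof.
move=> m2 p2 m0 p0 m1 p1.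
rewrite (@integral_prodM _ _ _ _ _ P2 (P0 \x P1)%E f2 (fun q => f0 q.1 * f1 q.2)%E m2 p2).
- by rewrite (integral_prodM P0 P1 m0 p0 m1 p1).
- by apply: emeasurable_funM; exact: measurableT_comp.
- by move=> q; rewrite mule_ge0.
Qed.

(** The binomial theorem matches the n-th moments, so that equality in law is reduced to the purely
    numerical identity between [m] and [c]. *)
Lemma convex_comb_law {d d1} {T : measurableType d} {T1 : measurableType d1}
    {R : realType} (Q : probability T R) (P1 : probability T1 R)
    (b x0 x1 : T -> R) (u : T1 -> R) (m : nat -> R) (c : nat -> nat -> R) (M : R) :
  0 < M -> measurable_fun setT b -> measurable_fun setT x0 -> measurable_fun setT x1 ->
  measurable_fun setT u ->
  (forall w, 0 < b w < 1) -> (forall w, 0 <= x0 w <= M) -> (forall w, 0 <= x1 w <= M) ->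
  (forall w, 0 <= u w <= M) ->
  (forall n, \int[P1]_w (u w ^+ n)%:E = (m n)%:E)%E ->
  (forall j k, \int[Q]_p ((b p ^+ j * (1 - b p) ^+ k) * (x0 p ^+ j * x1 p ^+ k))%:E =
     (c j k)%:E)%E ->
  (forall n, m n = \sum_(j < n.+1) 'C(n, j)%:R * c j (n - j)%N) ->
  forall t, P1 [set w | t < u w] = Q [set p | t < b p * x0 p + (1 - b p) * x1 p].
Proof.
move=> M0 mb mx0 mx1 mu b01 x0M x1M uM momu momQ mE.
pose U p := b p * x0 p + (1 - b p) * x1 p.
have mb1 : measurable_fun setT (fun p => 1 - b p) by exact: measurable_funB.
have mU : measurable_fun setT U by apply: measurable_funD; exact: measurable_funM.
have UM p : 0 <= U p <= M.
  have /andP[? ?] := b01 p; have /andP[? ?] := x0M p; have /andP[? ?] := x1M p.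
  by rewrite /U; nra.
apply: (moments_determine_law mu mU M0 uM UM) => n; rewrite momu mE.
have g0 j p : 0 <= (b p ^+ j * (1 - b p) ^+ (n - j)) * (x0 p ^+ j * x1 p ^+ (n - j)).
  have /andP[/ltW ? /ltW ?] := b01 p; have /andP[? ?] := x0M p; have /andP[? ?] := x1M p.
  by rewrite !mulr_ge0// exprn_ge0// subr_ge0.
have mg j : measurable_fun setT (fun p =>
    (b p ^+ j * (1 - b p) ^+ (n - j)) * (x0 p ^+ j * x1 p ^+ (n - j))).
  by apply: measurable_funM; apply: measurable_funM; exact: measurable_funX.
transitivity (\int[Q]_p \sum_(j < n.+1) ('C(n, j)%:R%:E *
    ((b p ^+ j * (1 - b p) ^+ (n - j)) * (x0 p ^+ j * x1 p ^+ (n - j)))%:E))%E; last first.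
  apply: eq_integral => p _; under eq_bigr do rewrite -EFinM.
  have UE : U p = (1 - b p) * x1 p + b p * x0 p by rewrite /U; ring.
  rewrite sumEFin -/(U p) UE exprDn; congr EFin.
  by apply: eq_bigr => j _; rewrite !exprMn -[RHS]mulr_natl; ring.
rewrite ge0_integral_sum//; last 2 first.
- by move=> j; apply: emeasurable_funM => //; exact/measurable_EFinP.
- by move=> j p _; rewrite mule_ge0// lee_fin.
rewrite -sumEFin; apply: eq_bigr => j _.
rewrite ge0_integralZl_EFin//; last 2 first.
- by move=> p _; rewrite lee_fin.
- exact/measurable_EFinP.
by rewrite momQ EFinM.
Qed.

Section fixed_point.
Context d0 d1 d2 (T0 : measurableType d0) (T1 : measurableType d1) (T2 : measurableType d2).
Context (R : realType) (al th : R).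
Variables (P0 : probability T0 R) (P1 : probability T1 R) (P2 : probability T2 R).
Variables (V0 : nat -> T0 -> R) (V1 : nat -> T1 -> R) (B : T2 -> R).
Hypotheses (al01 : 0 < al < 1) (th0 : 0 < th).
Hypotheses (mB : measurable_fun setT B) (B01 : forall w, 0 < B w < 1).
Hypothesis lB : has_law P2 B (beta_law 1 th).
Local Notation Q := (P2 \x (P0 \x P1))%E.

Lemma mix_fixed_point_bounded nu (Y0 : nat -> T0 -> \bar R) (Y1 : nat -> T1 -> \bar R) (M : R) :
  0 < M -> regular_sticks al 0 nu P0 V0 Y0 -> regular_sticks al th nu P1 V1 Y1 ->
  (forall k w, Y0 k w <= M%:E)%E -> (forall k w, Y1 k w <= M%:E)%E -> forall t : R,
  P1 [set w | t%:E < stick_integral V1 Y1 w]%E =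
  Q [set p | t%:E < mix B (stick_integral V0 Y0) (stick_integral V1 Y1) p]%E.
Proof.
move=> M0 r0 r1 Y0M Y1M t.
have [[mV0 mY0 _ _ _] V001 Y00] := r0; have [[mV1 mY1 _ _ _] V101 Y10] := r1.
have momconv := stick_integral_moment_conv _ al01 (ltW th0) r0 r1 Y0M Y1M.
move: momconv; set X0 := stick_integral V0 Y0; set X1 := stick_integral V1 Y1 => momconv.
have mX0 : measurable_fun setT X0 by exact: measurable_stick_integral.
have mX1 : measurable_fun setT X1 by exact: measurable_stick_integral.
have X0M w : (0 <= X0 w <= M%:E)%E by rewrite stick_integral_ge0// stick_integral_le.
have X1M w : (0 <= X1 w <= M%:E)%E by rewrite stick_integral_ge0// stick_integral_le.
move: X0 X1 momconv mX0 mX1 X0M X1M => X0 X1 momconv mX0 mX1 X0M X1M.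
have mx0 : measurable_fun setT (fun w => fine (X0 w)) by exact: measurableT_comp.
have mx1 : measurable_fun setT (fun w => fine (X1 w)) by exact: measurableT_comp.
have x0M w : 0 <= fine (X0 w) <= M by have [] := fine_bounded (X0M w).
have x1M w : 0 <= fine (X1 w) <= M by have [] := fine_bounded (X1M w).
have E0 w : X0 w = (fine (X0 w))%:E by have [] := fine_bounded (X0M w).
have E1 w : X1 w = (fine (X1 w))%:E by have [] := fine_bounded (X1M w).
have mom0 n : (\int[P0]_w (fine (X0 w) ^+ n)%:E = (moment P0 X0 n)%:E)%E.
  rewrite -(moment_fin P0 n mX0 X0M); apply: eq_integral => w _.
  by rewrite ger0_norm//; have /andP[] := x0M w.
have mom1 n : (\int[P1]_w (fine (X1 w) ^+ n)%:E = (moment P1 X1 n)%:E)%E.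
  rewrite -(moment_fin P1 n mX1 X1M); apply: eq_integral => w _.
  by rewrite ger0_norm//; have /andP[] := x1M w.
have -> : [set w | (t%:E < X1 w)%E] = [set w | t < fine (X1 w)].
  by apply/funext => w /=; rewrite E1 lte_fin.
have -> : [set p | (t%:E < mix B X0 X1 p)%E] =
    [set p | t < B p.1 * fine (X0 p.2.1) + (1 - B p.1) * fine (X1 p.2.2)].
  by apply/funext => p /=; rewrite /mix E0 E1 -!EFinM -EFinD lte_fin.
apply: (@convex_comb_law _ _ _ _ _ Q P1 (fun p => B p.1) (fun p => fine (X0 p.2.1))
  (fun p => fine (X1 p.2.2)) _ (moment P1 X1) (fun j k =>
    rising 1 j * rising th k / rising (1 + th) (j + k) * (moment P0 X0 j * moment P1 X1 k)) M) => //.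
- exact: measurableT_comp.
- by apply: (measurableT_comp mx0); exact: measurableT_comp.
- by apply: (measurableT_comp mx1); exact: measurableT_comp.
- move=> j k.
  transitivity (\int[Q]_p ((B p.1 ^+ j * (1 - B p.1) ^+ k)%:E *
     ((fine (X0 p.2.1) ^+ j)%:E * (fine (X1 p.2.2) ^+ k)%:E)))%E.
    by apply: eq_integral => p _; rewrite -!EFinM.
  rewrite (integral_prodM3 P0 P1 P2 (f2 := fun w => (B w ^+ j * (1 - B w) ^+ k)%:E)
    (f0 := fun w => (fine (X0 w) ^+ j)%:E) (f1 := fun w => (fine (X1 w) ^+ k)%:E)); last 6 first.
  + by apply/measurable_EFinP; apply: measurable_funM; apply: measurable_funX => //; exact: measurable_funB.
  + move=> w; have /andP[/ltW ? /ltW ?] := B01 w.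
    by rewrite lee_fin mulr_ge0// exprn_ge0// subr_ge0.
  + by apply/measurable_EFinP; exact: measurable_funX.
  + by move=> w; have /andP[? ?] := x0M w; rewrite lee_fin exprn_ge0.
  + by apply/measurable_EFinP; exact: measurable_funX.
  + by move=> w; have /andP[? ?] := x1M w; rewrite lee_fin exprn_ge0.
  rewrite mom0 mom1 -EFinM.
  suff -> : (\int[P2]_w (B w ^+ j * (1 - B w) ^+ k)%:E =
     (rising 1 j * rising th k / rising (1 + th) (j + k))%:E)%E by rewrite -EFinM.
  rewrite -(beta_law_moments mB lB j k ltr01 th0).
  apply: eq_integral => w _; have /andP[b0 b1] := B01 w.
  by rewrite (gtr0_norm b0) gtr0_norm// subr_gt0.
- move=> n.
  have rn : rising_coef (th + 1) n != 0 by rewrite gt_eqF// rising_coef_gt0// addr_gt0.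
  apply: (mulfI rn); rewrite momconv.
  rewrite /conv mulr_sumr; apply: eq_bigr => j _.
  have jn : (j <= n)%N by rewrite -ltnS.
  rewrite subnKC// rising1 /rising_coef [1 + th]addrC -(bin_fact jn) !natrM.
  have q0 : rising (th + 1) n != 0 by rewrite gt_eqF// rising_gt0// addr_gt0.
  have f1 : j`!%:R != 0 :> R by rewrite pnatr_eq0 -lt0n fact_gt0.
  have f2 : (n - j)`!%:R != 0 :> R by rewrite pnatr_eq0 -lt0n fact_gt0.
  have f3 : 'C(n, j)%:R != 0 :> R by rewrite pnatr_eq0 -lt0n bin_gt0.
  by field; rewrite q0 f1 f2 f3.
Qed.

End fixed_point.

(** * From bounded to unbounded values by truncation *)

Section truncation.
Context d (T : measurableType d) (R : realType).

(** The level n + 1 is positive also for n = 0, as the bounded case demands of its bound. *)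
Definition truncate (n : nat) (y : \bar R) : \bar R := Order.min y (n.+1%:R)%:E.

Lemma measurable_truncate n : measurable_fun setT (truncate n).
Proof. exact: measurable_mine. Qed.

Lemma truncate_ge0 n y : (0 <= y)%E -> (0 <= truncate n y)%E.
Proof. by move=> y0; rewrite /truncate le_min y0/= lee_fin. Qed.

Lemma truncate_le_nat n y : (truncate n y <= n.+1%:R%:E)%E.
Proof. by rewrite /truncate ge_min lexx orbT. Qed.

Lemma truncate_le n y : (truncate n y <= y)%E.
Proof. by rewrite /truncate ge_min lexx. Qed.

Lemma truncate_nd m n y : (m <= n)%N -> (truncate m y <= truncate n y)%E.
Proof.
by move=> mn; rewrite /truncate le_min !ge_min lexx/= lee_fin ler_nat ltnS mn orbT.
Qed.

Lemma truncate_id n y : (y <= n%:R%:E)%E -> truncate n y = y.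
Proof.
by move=> yn; apply/min_idPl; rewrite (le_trans yn)// lee_fin ler_nat.
Qed.

Lemma regular_sticks_truncate (P : probability T R) al th nu V Y n :
  regular_sticks al th nu P V Y ->
  regular_sticks al th (fun B => nu (truncate n @^-1` B)) P V (fun k => truncate n \o Y k).
Proof.
move=> [[mV mY VY lV lY] V01 Y0]; split=> //.
- split=> //.
  + by move=> k; apply: measurableT_comp; [exact: measurable_truncate|exact: mY].
  + apply: (@stick_indep_comp _ _ _ _ _ _ _ P V Y _ _ _ _ id (truncate n)) => //.
    exact: measurable_truncate.
  + move=> k B mB; rewrite comp_preimage; apply: lY.
    exact: (measurable_preimageT (measurable_truncate n)).
- by move=> k w; exact: truncate_ge0.
Qed.

Variables (V : nat -> T -> R) (Y : nat -> T -> \bar R).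
Hypotheses (V01 : forall k w, 0 < V k w < 1) (Y0 : forall k w, (0 <= Y k w)%E)
  (Yoo : forall k w, (Y k w < +oo)%E).

Let tY n k w : (0 <= (truncate n \o Y k) w)%E.
Proof. exact: truncate_ge0. Qed.

Lemma stick_integral_truncate_nd w :
  nondecreasing_seq (fun n => stick_integral V (fun k => truncate n \o Y k) w).
Proof.
move=> m n mn; apply: le_stick_integral => // k; last exact: truncate_nd.
Qed.

(** A partial sum involves finitely many finite values, all below some truncation level, so the
    truncated means overtake every partial sum. *)
Lemma stick_integral_truncate_cvg w :
  stick_integral V (fun k => truncate n \o Y k) w @[n --> \oo] --> stick_integral V Y w.
Proof.
have nd := stick_integral_truncate_nd w.
have := ereal_nondecreasing_is_cvgn nd; set u := (fun n => _) in nd *.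
suff -> : stick_integral V Y w = limn u by [].
apply/eqP; rewrite eq_le; apply/andP; split.
  apply: lime_le; first by apply: is_cvg_nneseries => k _ _; exact: stick_term_ge0.
  apply: nearW => N.
  have [n Yn] : exists n, forall k, (k < N)%N -> (Y k w <= n%:R%:E)%E.
    elim: N => [|N [n IH]]; first by exists 0%N.
    have YNf : Y N w \is a fin_num by rewrite ge0_fin_numE.
    exists (maxn n (Num.truncn (fine (Y N w))).+1) => k; rewrite ltnS leq_eqVlt => /orP[/eqP->|/IH h].
      rewrite -(fineK YNf) lee_fin (le_trans (ltW (truncnS_gt _)))// ler_nat.
      exact: leq_maxr.
    by rewrite (le_trans h)// lee_fin ler_nat leq_maxl.
  apply: (@le_trans _ _ (u n)); last first.
    by rewrite (cvg_lim _ (ereal_nondecreasing_cvgn nd))//; apply: ereal_sup_ubound; exists n.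
  apply: (@le_trans _ _ (\sum_(0 <= k < N) ((stick_weight V k w)%:E * (truncate n \o Y k) w))%E).
    rewrite !big_mkord; apply: lee_sum => k _; rewrite lee_wpmul2l ?lee_fin ?stick_weight_ge0//=.
    by rewrite truncate_id// Yn.
  by apply: nneseries_lim_ge => k _ _; apply: (@stick_term_ge0 _ _ _ _ (fun k => truncate n \o Y k)) => // *; exact: tY.
apply: lime_le; first exact: ereal_nondecreasing_is_cvgn.
apply: nearW => n; apply: le_stick_integral => // k; last exact: truncate_le.
Qed.

End truncation.

Section fixed_point_law.
Context d0 d1 d2 (T0 : measurableType d0) (T1 : measurableType d1) (T2 : measurableType d2).
Context (R : realType) (al th : R).
Variables (P0 : probability T0 R) (P1 : probability T1 R) (P2 : probability T2 R).
Variables (V0 : nat -> T0 -> R) (V1 : nat -> T1 -> R) (B : T2 -> R).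
Hypotheses (al01 : 0 < al < 1) (th0 : 0 < th).
Hypotheses (mB : measurable_fun setT B) (B01 : forall w, 0 < B w < 1).
Hypothesis lB : has_law P2 B (beta_law 1 th).
Local Notation Q := (P2 \x (P0 \x P1))%E.

(** For each ray, both probabilities are limits of the truncated ones: [mix] is increasing in its
    two means since 0 < B < 1. *)
Theorem mix_fixed_point nu (Y0 : nat -> T0 -> \bar R) (Y1 : nat -> T1 -> \bar R) :
  regular_sticks al 0 nu P0 V0 Y0 -> regular_sticks al th nu P1 V1 Y1 ->
  (forall k w, Y0 k w < +oo)%E -> (forall k w, Y1 k w < +oo)%E ->
  forall A, measurable A ->
  P1 (stick_integral V1 Y1 @^-1` A) =
  Q (mix B (stick_integral V0 Y0) (stick_integral V1 Y1) @^-1` A).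
Proof.
move=> r0 r1 Y0oo Y1oo.
have [[mV0 mY0 _ _ _] V001 Y00] := r0; have [[mV1 mY1 _ _ _] V101 Y10] := r1.
have mX0 : measurable_fun setT (stick_integral V0 Y0) by exact: measurable_stick_integral.
have mX1 : measurable_fun setT (stick_integral V1 Y1) by exact: measurable_stick_integral.
apply: eq_law_rays => //; first exact: measurable_mix.
move=> t.
pose X0 n := stick_integral V0 (fun k => truncate n \o Y0 k).
pose X1 n := stick_integral V1 (fun k => truncate n \o Y1 k).
have mtY0 n k : measurable_fun setT (truncate n \o Y0 k).
  by apply: measurableT_comp => //; exact: measurable_truncate.
have mtY1 n k : measurable_fun setT (truncate n \o Y1 k).
  by apply: measurableT_comp => //; exact: measurable_truncate.
have mX0n n : measurable_fun setT (X0 n) by exact: measurable_stick_integral.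
have mX1n n : measurable_fun setT (X1 n) by exact: measurable_stick_integral.
have X0n0 n w : (0 <= X0 n w)%E by apply: stick_integral_ge0 => // k v; exact: truncate_ge0.
have X1n0 n w : (0 <= X1 n w)%E by apply: stick_integral_ge0 => // k v; exact: truncate_ge0.
have c1 := @cvg_probability_gt _ _ _ P1 X1 (stick_integral V1 Y1) t mX1n
  (fun w => stick_integral_truncate_nd V101 Y10 w) (@stick_integral_truncate_cvg _ _ _ V1 Y1 V101 Y10 Y1oo).
have c2 := @cvg_probability_gt _ _ _ Q (fun n => mix B (X0 n) (X1 n))
   (mix B (stick_integral V0 Y0) (stick_integral V1 Y1)) t (fun n => measurable_mix mB (mX0n n) (mX1n n)).
rewrite -(cvg_lim _ c1)// -(cvg_lim _ (c2 _ _))//.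
- congr (limn _); apply/funext => n.
  apply: (mix_fixed_point_bounded (M := n.+1%:R) al01 th0 mB B01 lB _
    (regular_sticks_truncate n r0) (regular_sticks_truncate n r1)) => //.
  + by move=> k w; exact: truncate_le_nat.
  + by move=> k w; exact: truncate_le_nat.
- move=> p m n mn; have /andP[/ltW b0 /ltW b1] := B01 p.1.
  rewrite /mix leeD// lee_wpmul2l ?lee_fin ?subr_ge0//.
    exact: stick_integral_truncate_nd.
  exact: stick_integral_truncate_nd.
- move=> p; have /andP[/ltW b0 /ltW b1] := B01 p.1.
  apply: cvgeD.
  + by rewrite ge0_adde_def// inE mule_ge0 ?lee_fin ?subr_ge0// stick_integral_ge0.
  + by apply: cvgeZl => //; exact: stick_integral_truncate_cvg.
  + by apply: cvgeZl => //; exact: stick_integral_truncate_cvg.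
Qed.

End fixed_point_law.

(** * Uniqueness for the distributional equation of a Dirichlet mean *)

Lemma stick_remainder_mean {d} {T : measurableType d} {R : realType} (P : probability T R)
    (al th : R) nu V Y n : 0 <= al < 1 -> 0 <= th -> 0 < th + al ->
  regular_sticks al th nu P V Y ->
  (\int[P]_w (\prod_(k < n) (1 - V k w))%:E =
   (\prod_(k < n) ((th + k.+1%:R * al) / (th + k%:R * al + 1)))%:E)%E.
Proof.
move=> /andP[al0 al1]; elim: n th V Y => [|n IH] th V Y th0 tha r.
  under eq_integral do rewrite big_ord0.
  by rewrite big_ord0 integral_cst//= probability_setT mule1.
have [[mV mY VY lV lY] V01 Y0] := r.
have r' := regular_sticks_shift r.
have [[mV' mY' VY' lV' lY'] V01' Y0'] := r'.
pose W w := \prod_(k < n) (1 - V k.+1 w).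
have W0 w : 0 <= W w.
  by apply: prodr_ge0 => k _; have /andP[_ /ltW] := V01 k.+1 w; rewrite subr_ge0.
have mW : measurable_fun setT W.
  by apply: measurable_prod => k _; exact: measurable_funB.
(* [indep_pair_integralM] wants functions nonnegative on their whole domain, hence the absolute
   values. *)
transitivity (\int[P]_w ((`|1 - V 0%N w|)%:E * (`|W w|)%:E))%E.
  apply: eq_integral => w _; rewrite big_ord_recl -EFinM (ger0_norm (W0 w)).
  by have /andP[_ v1] := V01 0%N w; rewrite gtr0_norm// subr_gt0.
rewrite (@indep_pair_integralM _ _ _ _ _ _ _ P (fun w => (V 0%N w, Y 0%N w)) W
  (fun p => (`|1 - p.1|)%:E) (fun x => (`|x|)%:E))//; last 4 first.
- exact: measurable_fun_pair.
- apply: indep_head_tail => //; apply: tail_measurable_fun.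
  apply: measurable_prod => k _; apply: measurable_funB => //; exact: tail_measurable_V.
- by apply/measurable_EFinP; apply: measurableT_comp => //; exact: measurable_funB.
- exact/measurable_EFinP.
have -> : (\int[P]_w (`|W w|)%:E = \int[P]_w (\prod_(k < n) (1 - shift V k w))%:E)%E.
  by apply: eq_integral => w _; rewrite ger0_norm.
rewrite (IH (th + al) (shift V) (shift Y))//; last 2 first.
- exact: addr_ge0.
- by rewrite ltr_pwDl.
have := beta_law_moments (mV 0%N) (lV 0%N) 0 1.
rewrite subr_gt0 mul1r => /(_ al1 tha).
under eq_integral do rewrite expr0 expr1 mul1r.
move=> ->; rewrite -EFinM; congr EFin.
rewrite big_ord_recl/= !risingS !rising0 !mul1r mul0r !addr0.
have -> : 1 - al + (th + al) = th + 1 by ring.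
congr (_ * _); apply: eq_bigr => k _; rewrite /bump/= add1n.
by rewrite -![_.+1%:R]natr1; congr (_ / _); ring.
Qed.

(** What n unrollings of the fixed-point equation produce: n sticks, with x standing for the mean of
    what remains. *)
Fixpoint stick_comb {T : Type} {R : realType} (n : nat) (V : nat -> T -> R)
    (Y : nat -> T -> \bar R) (w : T) (x : \bar R) : \bar R :=
  if n is m.+1 then
    ((V 0%N w)%:E * Y 0%N w + (1 - V 0%N w)%:E * stick_comb m (shift V) (shift Y) w x)%E
  else x.

Lemma measurable_stick_comb {d d'} {T : measurableType d} {T' : measurableType d'}
    {R : realType} n (V : nat -> T -> R) (Y : nat -> T -> \bar R) (h : T' -> T) (g : T' -> \bar R) :
  (forall k, measurable_fun setT (V k)) -> (forall k, measurable_fun setT (Y k)) ->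
  measurable_fun setT h -> measurable_fun setT g ->
  measurable_fun setT (fun p => stick_comb n V Y (h p) (g p)).
Proof.
move=> mV mY mh mg; elim: n V Y mV mY => [|n IH] V Y mV mY //=.
apply: emeasurable_funD; apply: emeasurable_funM.
- by apply/measurable_EFinP; exact: measurableT_comp.
- exact: measurableT_comp.
- by apply/measurable_EFinP; apply: measurable_funB => //; exact: measurableT_comp.
- by apply: IH => k; [exact: mV|exact: mY].
Qed.

Lemma stick_combE {d} {T : measurableType d} {R : realType} n (V : nat -> T -> R)
    (Y : nat -> T -> \bar R) w x : (forall k w, 0 < V k w < 1) ->
  (forall k w, 0 <= Y k w)%E -> (0 <= x)%E ->
  (stick_comb n V Y w x = \sum_(k < n) ((stick_weight V k w)%:E * Y k w) +
    (\prod_(k < n) (1 - V k w))%:E * x)%E.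
Proof.
move=> V01 Y0 x0; elim: n V Y V01 Y0 => [|n IH] V Y V01 Y0 /=.
  by rewrite !big_ord0 mul1e add0e.
have /andP[/ltW v0 /ltW v1] := V01 0%N w.
rewrite IH; [|by move=> k v; exact: V01|by move=> k v; exact: Y0].
have W0 k : 0 <= stick_weight (shift V) k w by apply: stick_weight_ge0 => j v; exact: V01.
have R0 : 0 <= \prod_(k < n) (1 - shift V k w).
  by apply: prodr_ge0 => k _; have /andP[_ /ltW] := V01 k.+1 w; rewrite subr_ge0.
rewrite ge0_muleDr; last 2 first.
- by apply: sume_ge0 => k _; rewrite mule_ge0 ?lee_fin//; exact: Y0.
- by rewrite mule_ge0// lee_fin.
rewrite addeA; congr (_ + _)%E; last by rewrite muleA -EFinM [in RHS]big_ord_recl.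
rewrite [in RHS]big_ord_recl stick_weight0; congr (_ + _)%E.
rewrite ge0_sume_distrr; last by move=> k _; rewrite mule_ge0 ?lee_fin//; exact: Y0.
by apply: eq_bigr => k _; rewrite stick_weightS EFinM muleA.
Qed.

Lemma probability_indic {d} {T : measurableType d} {R : realType} (P : probability T R)
    (A : set T) : measurable A -> P A = (\int[P]_w (\1_A w)%:E)%E.
Proof. by move=> mA; rewrite integral_indic// setIT. Qed.

Section dirichlet_fixed_point.
Context d1 d2 (T1 : measurableType d1) (T2 : measurableType d2) (R : realType).
Variables (P1 : probability T1 R) (P2 : probability T2 R) (th : R).
Variables (nu : set (\bar R) -> \bar R) (X1 : T1 -> \bar R).
Hypotheses (th0 : 0 < th) (mX1 : measurable_fun setT X1) (X10 : forall w, (0 <= X1 w)%E).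

(* X1 = V0 Y0 + (1 - V0) X1 in law, with X1 independent of (V0, Y0) on the right. *)
Hypothesis fixed : forall V Y, regular_sticks 0 th nu P2 V Y ->
  forall phi : \bar R -> \bar R, measurable_fun setT phi -> (forall x, 0 <= phi x)%E ->
  (\int[P1]_w1 phi (X1 w1) =
   \int[P2]_w \int[P1]_w1 phi ((V 0%N w)%:E * Y 0%N w + (1 - V 0%N w)%:E * X1 w1))%E.

Lemma stick_comb_fixed_point n V Y : regular_sticks 0 th nu P2 V Y ->
  forall phi : \bar R -> \bar R, measurable_fun setT phi -> (forall x, 0 <= phi x)%E ->
  (\int[P1]_w1 phi (X1 w1) = \int[P2]_w \int[P1]_w1 phi (stick_comb n V Y w (X1 w1)))%E.
Proof.
elim: n V Y => [|n IH] V Y r phi mphi phi0.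
  rewrite /= integral_cst//= probability_setT mule1//.
have [[mV mY VY lV lY] V01 Y0] := r.
have r' : regular_sticks 0 th nu P2 (shift V) (shift Y).
  by have := regular_sticks_shift r; rewrite addr0.
have [[mV' mY' _ _ _] V01' Y0'] := r'.
pose g (q : R * \bar R) (z : \bar R) : \bar R := (q.1%:E * q.2 + (1 - q.1)%:E * z)%E.
have mg d (T : measurableType d) (q : T -> R * \bar R) (z : T -> \bar R) :
  measurable_fun setT q -> measurable_fun setT z -> measurable_fun setT (fun x => phi (g (q x) (z x))).
  move=> mq mz; apply: measurableT_comp => //.
  apply: emeasurable_funD; apply: emeasurable_funM => //.
  - by apply/measurable_EFinP; exact: measurableT_comp.
  - exact: measurableT_comp.
  - by apply/measurable_EFinP; apply: measurable_funB => //; exact: measurableT_comp.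
have mC : measurable_fun setT (fun p : T2 * T1 => stick_comb n (shift V) (shift Y) p.1 (X1 p.2)).
  by apply: measurable_stick_comb => //; exact: measurableT_comp.
pose q w := (V 0%N w, Y 0%N w).
have mq : measurable_fun setT q by exact: measurable_fun_pair.
pose C w x := stick_comb n (shift V) (shift Y) w x.
rewrite (fixed r mphi phi0).
(* The induction hypothesis, applied to the shifted sequences, unrolls [X1] at an independent copy
   w' of the sample point. *)
transitivity (\int[P2]_w \int[P2]_w' \int[P1]_w1 phi (g (q w) (C w' (X1 w1))))%E.
  apply: eq_integral => w _.
  by rewrite (IH _ _ r' (fun z => phi (g (q w) z)))// ; apply: (mg _ _ (fun=> q w) id).
pose F3 (p : (T2 * T1) * T2) := phi (g (q p.1.1) (C p.2 (X1 p.1.2))).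
have mF3 : measurable_fun setT F3.
  apply: mg; first by apply: (measurableT_comp mq); exact: measurableT_comp.
  apply: measurable_stick_comb => //; apply: measurableT_comp => //; exact: measurableT_comp.
transitivity (\int[P2]_w \int[P1]_w1 \int[P2]_w' phi (g (q w) (C w' (X1 w1))))%E.
  apply: eq_integral => w _.
  apply: (@fubini_tonelli _ _ _ _ _ P2 P1 (fun p => phi (g (q w) (C p.1 (X1 p.2))))) => //.
  by apply: (mg _ _ (fun=> q w)).
rewrite (@fubini_tonelli _ _ _ _ _ P2 P1 (fun p => \int[P2]_w' F3 (p, w'))%E)/=; last 2 first.
- have F30 x : (0 <= F3 x)%E by exact: phi0.
  exact: (@measurable_fun_fubini_tonelli_F _ _ _ _ R P2 F3).
- by move=> p; apply: integral_ge0 => w _; exact: phi0.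
rewrite [RHS](@fubini_tonelli _ _ _ _ _ P2 P1 (fun p => phi (g (q p.1) (C p.1 (X1 p.2))))%E)/=; last 2 first.
- by apply: mg => //; exact: measurableT_comp.
- by [].
apply: eq_integral => w1 _.
have mCx : measurable_fun setT (fun w => C w (X1 w1)) by exact: measurable_stick_comb.
(* With w1 integrated last, independence of the first stick and value from the later ones merges w'
   with w. *)
rewrite (@indep_pair_integral _ _ _ _ _ _ _ P2 q (fun w => C w (X1 w1)) mq mCx
  (fun p => phi (g p.1 p.2)))//.
- apply: indep_head_tail => //; apply: tail_measurable_fun.
  apply: (@measurable_stick_comb _ _ (g_sigma_algebraType (tail_cylinders V Y))
    (g_sigma_algebraType (tail_cylinders V Y)) R n (shift V) (shift Y) id (fun=> X1 w1)) => //.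
  + exact: tail_measurable_V.
  + exact: tail_measurable_Y.
- exact: mg.
Qed.

Hypothesis X1fin : P1 [set w | X1 w = +oo%E] = 0%E.

Variables (V : nat -> T2 -> R) (Y : nat -> T2 -> \bar R).
Hypothesis r : regular_sticks 0 th nu P2 V Y.

Let mD : measurable_fun setT (stick_integral V Y).
Proof. by have [[mV mY _ _ _] _ _] := r; exact: measurable_stick_integral. Qed.

Let mgt d (T : measurableType d) (Z : T -> \bar R) (t : R) : measurable_fun setT Z ->
  measurable [set w | (t%:E < Z w)%E].
Proof.
by move=> mZ; rewrite -[X in measurable X]setTI; exact: emeasurable_fun_o_infty.
Qed.

Let prob_gt n (t : R) : P1 [set w | (t%:E < X1 w)%E] =
  (\int[P2]_w P1 [set w1 | (t%:E < stick_comb n V Y w (X1 w1))%E])%E.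
Proof.
have [[mV mY _ _ _] _ _] := r.
pose phi (x : \bar R) : \bar R := (\1_[set x | (t%:E < x)%E] x)%:E.
have mphi : measurable_fun setT phi.
  by apply/measurable_EFinP; apply: measurable_indic; exact: (mgt t (@measurable_id _ _ _)).
have phi0 x : (0 <= phi x)%E by rewrite lee_fin.
have E (Z : T1 -> \bar R) : measurable_fun setT Z ->
   (\int[P1]_w1 phi (Z w1) = P1 [set w1 | (t%:E < Z w1)%E])%E.
  by move=> mZ; rewrite (probability_indic P1 (mgt t mZ)).
rewrite -E// (stick_comb_fixed_point n r mphi phi0); apply: eq_integral => w _.
rewrite E//; exact: (measurable_stick_comb n mV mY (measurable_cst w)).
Qed.

Let partial_le n w x : (0 <= x)%E ->
  (\sum_(0 <= k < n) ((stick_weight V k w)%:E * Y k w) <= stick_comb n V Y w x)%E.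
Proof.
have [_ V01 Y0] := r; move=> x0; rewrite stick_combE// big_mkord leeDl// mule_ge0// lee_fin.
by apply: prodr_ge0 => k _; have /andP[_ /ltW] := V01 k w; rewrite subr_ge0.
Qed.

(** Dropping the nonnegative remainder from the unrolled equation leaves the partial sums of the
    Dirichlet mean, which increase to it. *)
Lemma dirichlet_le_fixed_point (t : R) :
  (P2 [set w | t%:E < stick_integral V Y w] <= P1 [set w | t%:E < X1 w])%E.
Proof.
have [[mV mY _ _ _] V01 Y0] := r.
pose S n w := (\sum_(0 <= k < n) ((stick_weight V k w)%:E * Y k w))%E.
have mS n : measurable_fun setT (S n).
  apply: emeasurable_sum => k; apply: emeasurable_funM => //.
  by apply/measurable_EFinP; exact: measurable_stick_weight.
have cS := @cvg_probability_gt _ _ _ P2 S (stick_integral V Y) t mS.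
rewrite -(cvg_lim _ (cS _ _))//; last 2 first.
- move=> w m n mn; apply: lee_sum_nneg_natr => // k _ _; exact: stick_term_ge0.
- by move=> w; apply: is_cvg_nneseries => k _ _; exact: stick_term_ge0.
apply: lime_le; first by apply/cvg_ex; eexists; apply: cS;
  [move=> w m n mn; apply: lee_sum_nneg_natr => // k _ _; exact: stick_term_ge0
  |move=> w; apply: is_cvg_nneseries => k _ _; exact: stick_term_ge0].
apply: nearW => n; rewrite (prob_gt n).
rewrite (probability_indic P2 (mgt t (mS n))).
apply: ge0_le_integral => //.
- by apply/measurable_EFinP; apply: measurable_indic; exact: mgt.
- have mc : measurable [set p : T2 * T1 | (t%:E < stick_comb n V Y p.1 (X1 p.2))%E].
    apply: mgt; apply: measurable_stick_comb => //; exact: measurableT_comp.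
  have := @measurable_fun_xsection _ _ _ _ _ P1 _ mc.
  apply: eq_measurable_fun => w _ /=; congr (P1 _); apply/seteqP; split => w1 /=;
    by rewrite /xsection/= inE.
- move=> w _; rewrite indicE; case: (boolP (w \in _)) => [|_] /=; last exact: measure_ge0.
  rewrite inE/= => tS; rewrite (_ : [set w1 | _] = setT) ?probability_setT//.
  apply/seteqP; split => // w1 _ /=; apply: (lt_le_trans tS); exact: partial_le.
Qed.

(** Outside two events of probability at most e / 2, a large [X1] and a large remaining mass, the
    remainder of the unrolled equation is at most t - s. *)
Lemma fixed_point_le_dirichlet (s t : R) : s < t ->
  (P1 [set w | t%:E < X1 w] <= P2 [set w | s%:E < stick_integral V Y w])%E.
Proof.
move=> st; have [[mV mY _ _ _] V01 Y0] := r.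
(* Finiteness enters here: the events {X1 > n + 1} decrease to the null event {X1 = +oo}. *)
have tail_small (e : R) : 0 < e -> exists2 M : R, 0 < M & (P1 [set w | M%:E < X1 w] <= e%:E)%E.
  move=> e0.
  pose F n := [set w | (n.+1%:R%:E < X1 w)%E].
  have mF n : measurable (F n) by exact: mgt.
  have FI : \bigcap_n F n = [set w | X1 w = +oo%E].
    apply/seteqP; split => w /= => [h|Xoo]; last by move=> n _; rewrite /F/= Xoo ltry.
    apply: contrapT => /eqP; rewrite -ltey => Xoo.
    have Xf : X1 w \is a fin_num by rewrite ge0_fin_numE.
    have [x xE] : exists x, X1 w = x%:E by exists (fine (X1 w)); rewrite fineK.
    have := h (Num.truncn x) I; rewrite /F/= xE lte_fin.
    by rewrite ltNge (ltW (truncnS_gt _)).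
  have : P1 \o F @ \oo --> P1 (\bigcap_n F n).
    apply: nonincreasing_cvg_mu => //.
    - by rewrite (le_lt_trans (probability_le1 _ _))// ltry.
    - exact: bigcapT_measurable.
    - move=> m n mn; apply/subsetPset => w; rewrite /F/=; apply: le_lt_trans.
      by rewrite lee_fin ler_nat.
  rewrite FI X1fin => /fine_cvgP[_ /cvgrPdist_le /(_ e e0) [n _ /(_ n (leqnn n))]] /=.
  rewrite sub0r normrN => h; exists n.+1%:R => //.
  rewrite -[leLHS]fineK; last by rewrite fin_num_measure//; exact: mF.
  by rewrite lee_fin (le_trans _ h)// ler_norm.
(* Markov's inequality: the mass left after n sticks has mean q^n with q = th / (th + 1). *)
have rem_small (c e : R) : 0 < c -> 0 < e -> exists n,
    (P2 [set w | c < \prod_(k < n) (1 - V k w)]%R <= e%:E)%E.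
  move=> c0 e0.
  pose q := th / (th + 1).
  have q01 : 0 <= q < 1.
    have th1 : 0 < th + 1 by rewrite addr_gt0.
    by rewrite /q divr_ge0 ?(ltW th0) ?(ltW th1)//= ltr_pdivrMr// mul1r ltrDl.
  have [n qn] : exists n, q ^+ n <= c * e.
    have /andP[q0 q1] := q01.
    have : q ^+ n @[n --> \oo] --> 0 by apply: cvg_expr; rewrite ger0_norm.
    move=> /cvgrPdist_le /(_ (c * e)) []; first exact: mulr_gt0.
    move=> n _ /(_ n (leqnn n)) /=; rewrite sub0r normrN => h; exists n.
    by rewrite (le_trans _ h)// ler_norm.
  exists n.
  have mR : measurable_fun setT (fun w => \prod_(k < n) (1 - V k w)).
    by apply: measurable_prod => k _; exact: measurable_funB.
  have R0 w : 0 <= \prod_(k < n) (1 - V k w).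
    by apply: prodr_ge0 => k _; have /andP[_ /ltW] := V01 k w; rewrite subr_ge0.
  have mA : measurable [set w | c < \prod_(k < n) (1 - V k w)].
    have mRE : measurable_fun setT (fun w => (\prod_(k < n) (1 - V k w))%:E) by exact/measurable_EFinP.
  have := mgt c mRE.
    by congr measurable; apply/seteqP; split => w /=; rewrite lte_fin.
  have tha : 0 < th + 0 by rewrite addr0.
  have := @stick_remainder_mean _ _ _ P2 0 th nu V Y n _ (ltW th0) tha r.
  rewrite lexx ltr01 => /(_ isT) h.
  rewrite -(@lee_pmul2l _ c%:E)//.
  apply: (@le_trans _ _ (\int[P2]_w (\prod_(k < n) (1 - V k w))%:E)%E).
    rewrite (probability_indic P2 mA) -ge0_integralZl_EFin//; last 2 first.
    - by apply/measurable_EFinP; exact: measurable_indic.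
    - exact: ltW.
    apply: ge0_le_integral => //.
    - by move=> w _; rewrite -EFinM lee_fin mulr_ge0// ltW.
    - by apply: emeasurable_funM => //; apply/measurable_EFinP; exact: measurable_indic.
    - exact/measurable_EFinP.
    - move=> w _; rewrite -EFinM lee_fin indicE; case: (boolP (w \in _)).
        by rewrite inE/= mulr1 => /ltW.
      by rewrite mulr0.
  rewrite h -EFinM lee_fin (le_trans _ qn)//.
  rewrite (eq_bigr (fun=> q)); last by move=> k _; rewrite !mulr0 !addr0.
  by rewrite prodr_const card_ord.
apply/lee_addgt0Pr => e e0.
have e20 : 0 < e / 2 by rewrite divr_gt0.
have [M M0 XM] := tail_small _ e20.
(* A remaining mass of at most (t - s) / M times a mean of at most M uses up exactly the gap between
   the two levels. *)
have c0 : 0 < (t - s) / M by rewrite divr_gt0// subr_gt0.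
have [n Rn] := rem_small _ _ c0 e20.
have mR : measurable_fun setT (fun w => \prod_(k < n) (1 - V k w)).
  by apply: measurable_prod => k _; exact: measurable_funB.
have mRs : measurable [set w | (t - s) / M < \prod_(k < n) (1 - V k w)].
  have mRE : measurable_fun setT (fun w => (\prod_(k < n) (1 - V k w))%:E) by exact/measurable_EFinP.
  have := mgt ((t - s) / M) mRE.
  by congr measurable; apply/seteqP; split => w /=; rewrite lte_fin.
have mXM : measurable [set w | (M%:E < X1 w)%E] by exact: mgt.
rewrite (prob_gt n).
pose ind w : \bar R := (\1_[set w | (s%:E < stick_integral V Y w)%E] w)%:E.
pose inR w : \bar R := (\1_[set w | (t - s) / M < \prod_(k < n) (1 - V k w)] w)%:E.
have mind : measurable_fun setT ind by apply/measurable_EFinP; apply: measurable_indic; exact: mgt.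
have minR : measurable_fun setT inR by apply/measurable_EFinP; exact: measurable_indic.
apply: (@le_trans _ _ (\int[P2]_w (ind w + (inR w + (e / 2)%:E)))%E).
  apply: ge0_le_integral => //.
  - have mc : measurable [set p : T2 * T1 | (t%:E < stick_comb n V Y p.1 (X1 p.2))%E].
      apply: mgt; apply: measurable_stick_comb => //; exact: measurableT_comp.
    have := @measurable_fun_xsection _ _ _ _ _ P1 _ mc.
    apply: eq_measurable_fun => w _ /=; congr (P1 _); apply/seteqP; split => w1 /=;
      by rewrite /xsection/= inE.
  - apply: emeasurable_funD => //; exact: emeasurable_funD.
  - move=> w _; rewrite /ind /inR !indicE.
    case: (boolP (w \in _)) => [_|].
      apply: (@le_trans _ _ 1%E).
        apply: probability_le1; apply: mgt; exact: (measurable_stick_comb n mV mY (measurable_cst w)).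
      by rewrite -!EFinD lee_fin lerDl addr_ge0// ltW.
    rewrite notin_setE/= => /negP; rewrite -leNgt => Ds.
    case: (boolP (w \in _)) => [_|].
      apply: (@le_trans _ _ 1%E).
        apply: probability_le1; apply: mgt; exact: (measurable_stick_comb n mV mY (measurable_cst w)).
      by rewrite -!EFinD lee_fin add0r lerDl ltW.
    rewrite notin_setE/= => /negP; rewrite -leNgt => Rs.
    rewrite !add0e; apply: le_trans XM; apply: le_measure; rewrite ?inE//.
      by apply: mgt; exact: (measurable_stick_comb n mV mY (measurable_cst w)).
    move=> w1 /=; rewrite ltNge => tC; rewrite ltNge; apply: contra tC => X1M.
    rewrite stick_combE//.
    have -> : t%:E = (s%:E + (t - s)%:E)%E by rewrite -EFinD; congr EFin; ring.
    apply: leeD.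
      apply: le_trans Ds; have := @nneseries_lim_ge R (fun k => (stick_weight V k w)%:E * Y k w)%E xpredT 0 n.
      by rewrite big_mkord; apply => k _ _; exact: stick_term_ge0.
    apply: (@le_trans _ _ (((t - s) / M)%:E * M%:E)%E); last by rewrite -EFinM divfK// gt_eqF.
    apply: lee_pmul => //; rewrite lee_fin//.
    by apply: prodr_ge0 => k _; have /andP[_ /ltW] := V01 k w; rewrite subr_ge0.
rewrite ge0_integralD//; last 3 first.
- by move=> w _; rewrite /ind lee_fin.
- by move=> w _; rewrite /inR -EFinD lee_fin addr_ge0// ltW.
- exact: emeasurable_funD.
rewrite /ind integral_indic//; last exact: mgt.
rewrite setIT leeD2l// ge0_integralD//; last 2 first.
- by move=> w _; rewrite /inR lee_fin.
- by move=> w _; rewrite lee_fin ltW.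
rewrite /inR integral_indic// setIT integral_cst//= probability_setT mule1.
have -> : e%:E = ((e / 2)%:E + (e / 2)%:E)%E by rewrite -EFinD; congr EFin; field.
exact: leeD2r.
Qed.

Theorem dirichlet_mean_unique A : measurable A ->
  P1 (X1 @^-1` A) = P2 (stick_integral V Y @^-1` A).
Proof.
apply: eq_law_rays => // t.
apply/eqP; rewrite eq_le dirichlet_le_fixed_point andbT.
(* The previous lemma loses a gap between the levels; it is applied to t + 1 / (n + 1) over t, and
   the gap closes in the limit. *)
have -> : [set w | (t%:E < X1 w)%E] = \bigcup_n [set w | ((t + n.+1%:R^-1)%:E < X1 w)%E].
  apply/seteqP; split => w /=.
    move=> tX; have [Xoo|Xoo] := eqVneq (X1 w) +oo%E.
      by exists 0%N => //=; rewrite Xoo ltry.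
    have Xf : X1 w \is a fin_num by rewrite ge0_fin_numE// ltey.
    have [x xE] : exists x, X1 w = x%:E by exists (fine (X1 w)); rewrite fineK.
    move: tX; rewrite xE lte_fin => tX.
    have d0 : 0 < x - t by rewrite subr_gt0.
    exists (Num.truncn (x - t)^-1) => //=.
    rewrite xE lte_fin -ltrBrDl -[ltRHS]invrK ltf_pV2 ?posrE ?invr_gt0//.
    exact: truncnS_gt.
  by move=> [n _ /=]; apply: le_lt_trans; rewrite lee_fin lerDl.
have c : P1 \o (fun n => [set w | ((t + n.+1%:R^-1)%:E < X1 w)%E]) @ \oo -->
    P1 (\bigcup_n [set w | ((t + n.+1%:R^-1)%:E < X1 w)%E]).
  apply: nondecreasing_cvg_mu => //.
  - by move=> n; exact: mgt.
  - by apply: bigcupT_measurable => n; exact: mgt.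
  - move=> m n mn; apply/subsetPset => w /=; apply: le_lt_trans.
    by rewrite lee_fin lerD2l lef_pV2 ?posrE// ler_nat.
rewrite -(cvg_lim _ c)//; apply: lime_le; first by apply/cvg_ex; eexists; exact: c.
by apply: nearW => n /=; apply: fixed_point_le_dirichlet; rewrite ltrDl.
Qed.

End dirichlet_fixed_point.

Lemma integral_prod {d0 d1} {T0 : measurableType d0} {T1 : measurableType d1} {R : realType}
    (P0 : probability T0 R) (P1 : probability T1 R) (f : T0 * T1 -> \bar R) :
  measurable_fun setT f -> (forall p, 0 <= f p)%E ->
  (\int[P0 \x P1]_p f p = \int[P0]_x \int[P1]_y f (x, y))%E.
Proof. by move=> mf f0; rewrite fubini_tonelli1. Qed.

Section dirichlet_step.
Context d0 d1 d2 (T0 : measurableType d0) (T1 : measurableType d1) (T2 : measurableType d2).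
Context (R : realType) (al th : R).
Variables (P0 : probability T0 R) (P1 : probability T1 R) (P2 : probability T2 R).

Lemma mix_integral (B : T2 -> R) (X0 : T0 -> \bar R) (X1 : T1 -> \bar R) (phi : \bar R -> \bar R) :
  measurable_fun setT B -> measurable_fun setT X0 -> measurable_fun setT X1 ->
  measurable_fun setT phi -> (forall x, 0 <= phi x)%E ->
  (\int[P2 \x (P0 \x P1)]_p phi (mix B X0 X1 p) =
   \int[P2]_w \int[P0]_w0 \int[P1]_w1
     phi ((B w)%:E * X0 w0 + (1 - B w)%:E * X1 w1))%E.
Proof.
move=> mB m0 m1 mphi phi0.
have mm := measurable_mix mB m0 m1.
have mF : measurable_fun setT (phi \o mix B X0 X1) by exact: measurableT_comp.
rewrite (@integral_prod _ _ _ _ _ P2 (P0 \x P1)%E (phi \o mix B X0 X1) mF); last by move=> p; exact: phi0.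
apply: eq_integral => w _.
rewrite (@integral_prod _ _ _ _ _ P0 P1 (fun q => phi (mix B X0 X1 (w, q))))//.
apply: measurableT_comp => //; apply: (@measurableT_comp _ _ _ _ _ _ (mix B X0 X1)) => //.
Qed.

Hypotheses (al01 : 0 < al < 1) (th0 : 0 < th).

(** The first stick of a Dirichlet process is Beta(1, th), and its first atom has the law of the
    PD(al, 0) mean and is independent of the stick; so this pair can play the roles of [B] and [X0]
    in [mix_fixed_point]. *)
Theorem dirichlet_step nu V0 Y0 V1 Y1 :
  regular_sticks al 0 nu P0 V0 Y0 -> regular_sticks al th nu P1 V1 Y1 ->
  (forall k w, Y0 k w < +oo)%E -> (forall k w, Y1 k w < +oo)%E ->
  forall V Y, regular_sticks 0 th (fun A => P0 (stick_integral V0 Y0 @^-1` A)) P2 V Y ->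
  forall phi : \bar R -> \bar R, measurable_fun setT phi -> (forall x, 0 <= phi x)%E ->
  (\int[P1]_w1 phi (stick_integral V1 Y1 w1) =
   \int[P2]_w \int[P1]_w1
     phi ((V 0%N w)%:E * Y 0%N w + (1 - V 0%N w)%:E * stick_integral V1 Y1 w1))%E.
Proof.
move=> r0 r1 Y0oo Y1oo V Y r phi mphi phi0.
have [[mV0 mY0 _ _ _] _ _] := r0; have [[mV1 mY1 _ _ _] _ _] := r1.
have [[mV mY VY lV lY] V01 _] := r.
have mX0 : measurable_fun setT (stick_integral V0 Y0) by exact: measurable_stick_integral.
have mX1 : measurable_fun setT (stick_integral V1 Y1) by exact: measurable_stick_integral.
have lB : has_law P2 (V 0%N) (beta_law 1 th).
  by have := lV 0%N; rewrite subr0 mulr0 addr0.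
have mm := measurable_mix (mV 0%N) mX0 mX1.
have h := mix_fixed_point al01 th0 (mV 0%N) (V01 0%N) lB r0 r1 Y0oo Y1oo.
rewrite (eq_law_integral mX1 mm h mphi phi0) mix_integral//.
(* With the integral over [P1] absorbed into [psi], only the law of the pair (stick, atom) has to be
   moved from [P2] and [P0] to [P2] alone. *)
pose psi (v : R) (y : \bar R) : \bar R :=
  (\int[P1]_w1 phi (v%:E * y + (1 - v)%:E * stick_integral V1 Y1 w1))%E.
have mpsi : measurable_fun setT (fun q : R * \bar R => psi q.1 q.2).
  pose F (p : (R * \bar R) * T1) : \bar R :=
    phi (p.1.1%:E * p.1.2 + (1 - p.1.1)%:E * stick_integral V1 Y1 p.2)%E.
  apply: (@measurable_fun_fubini_tonelli_F _ _ _ _ R P1 F); last by move=> p; exact: phi0.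
  have m1 : measurable_fun setT (fun p : (R * \bar R) * T1 => p.1.1) by exact: measurableT_comp.
  apply: measurableT_comp => //; apply: emeasurable_funD; apply: emeasurable_funM.
  - exact/measurable_EFinP.
  - exact: measurableT_comp.
  - by apply/measurable_EFinP; exact: measurable_funB.
  - exact: measurableT_comp.
have psi0 v y : (0 <= psi v y)%E by exact: integral_ge0.
transitivity (\int[P2]_w \int[P2]_w' psi (V 0%N w) (Y 0%N w'))%E.
  apply: eq_integral => w _.
  apply: (@eq_law_integral _ _ _ _ _ _ _ P0 P2 (stick_integral V0 Y0) (Y 0%N)
    (psi (V 0%N w))) => //.
  - by move=> a ma; rewrite (lY 0%N a ma).
  - have mp : measurable_fun setT (fun y : \bar R => (V 0%N w, y)) by exact: measurable_fun_pair.
    exact: (measurableT_comp mpsi mp).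
rewrite (@indep_pair_integral _ _ _ _ _ _ _ P2 (V 0%N) (Y 0%N) (mV 0%N) (mY 0%N)
  (fun p => psi p.1 p.2))//.
exact: indep_head.
Qed.

End dirichlet_step.

(** * Finiteness *)

Section finiteness.
Variable R : realType.
Implicit Types (al th : R) (k N : nat).

(** The mean in [stick_remainder_mean]; successive differences are the expected weights. *)
Definition stick_remainder al th N : R :=
  \prod_(k < N) ((th + k.+1%:R * al) / (th + k%:R * al + 1)).

Lemma stick_remainderSl al th N :
  stick_remainder al th N.+1 = (th + al) / (th + 1) * stick_remainder al (th + al) N.
Proof.
rewrite /stick_remainder big_ord_recl/= mul1r mul0r addr0; congr (_ * _).
apply: eq_bigr => k _; rewrite /bump/= add1n.
by rewrite -![_.+1%:R]natr1; congr (_ / _); ring.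
Qed.

Lemma stick_remainder_ge0 al th N : 0 <= al -> 0 <= th -> 0 <= stick_remainder al th N.
Proof.
by move=> al0 th0; apply: prodr_ge0 => k _; rewrite divr_ge0// ?addr_ge0// mulr_ge0.
Qed.

Lemma stick_remainder_nd al th N : 0 <= al < 1 -> 0 <= th ->
  stick_remainder al th N.+1 <= stick_remainder al th N.
Proof.
move=> /andP[al0 al1] th0; rewrite /stick_remainder big_ord_recr/=.
rewrite ler_piMr//; first exact: stick_remainder_ge0.
have h : 0 <= N%:R * al by rewrite mulr_ge0.
by rewrite ler_pdivrMr ?ltr_wpDl ?addr_ge0// mul1r -natr1 mulrDl mul1r addrA lerD2l ltW.
Qed.

(** A weight is independent of its atom. The induction removes the first stick, which raises th to
    th + al, so th is generalised. *)
Lemma expected_stick_weight {d} {T : measurableType d} (P : probability T R) al th nu V Y k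
    (phi : \bar R -> \bar R) : 0 < al < 1 -> 0 <= th ->
  regular_sticks al th nu P V Y ->
  measurable_fun setT phi -> (forall x, 0 <= phi x)%E ->
  (\int[P]_w ((stick_weight V k w)%:E * phi (Y k w)) =
   (stick_remainder al th k - stick_remainder al th k.+1)%:E * \int[P]_w phi (Y 0%N w))%E.
Proof.
move=> al01 th0 r mphi phi0; have /andP[al0 al1] := al01.
elim: k th V Y th0 r => [|k IH] th V Y th0 r.
  have [[mV mY VY lV lY] V01 Y0] := r.
  transitivity (\int[P]_w ((`|V 0%N w|)%:E * phi (Y 0%N w)))%E.
    apply: eq_integral => w _; rewrite stick_weight0 gtr0_norm//.
    by have /andP[] := V01 0%N w.
  rewrite (@indep_pair_integralM _ _ _ _ _ _ _ P (V 0%N) (Y 0%N) (fun x => (`|x|)%:E) phi)//;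
    last 2 first.
  - exact: indep_head.
  - exact/measurable_EFinP.
  congr (_ * _)%E.
  have := beta_law_moments (mV 0%N) (lV 0%N) 1 0.
  rewrite subr_gt0 mul1r => /(_ al1 (ltr_wpDl th0 al0)).
  under eq_integral do rewrite expr0 expr1 mulr1.
  move=> ->; congr EFin.
  rewrite stick_remainderSl /stick_remainder !big_ord0 !risingS !rising0 addr0 !mulr1.
  have t1 : th + 1 != 0 by rewrite gt_eqF// ltr_wpDl.
  have -> : 1 - al + (th + al) = th + 1 by ring.
  by rewrite !addr0 ?mul1r ?mulr1; field.
have [[mV mY VY lV lY] V01 Y0] := r.
have r' := regular_sticks_shift r.
have [[mV' mY' VY' lV' lY'] V01' Y0'] := r'.
have tha : 0 <= th + al by rewrite addr_ge0// ltW.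
pose W w : \bar R := ((stick_weight (shift V) k w)%:E * phi (shift Y k w))%E.
have mW0 d' (T' : measurableType d') (h : T' -> T) :
    (forall j, measurable_fun setT (shift V j \o h)) ->
    (forall j, measurable_fun setT (shift Y j \o h)) -> measurable_fun setT (W \o h).
  move=> mVh mYh; apply: emeasurable_funM; last exact: (measurableT_comp mphi (mYh k)).
  apply/measurable_EFinP.
  exact: (@measurable_stick_weight _ _ _ (fun j => shift V j \o h)).
have mW : measurable_fun setT W by exact: (mW0 _ _ id).
have W0 w : (0 <= W w)%E.
  by rewrite mule_ge0// lee_fin stick_weight_ge0// => j v; exact: V01.
transitivity (\int[P]_w ((`|1 - V 0%N w|)%:E * `|W w|))%E.
  apply: eq_integral => w _; rewrite stick_weightS EFinM -muleA (gee0_abs (W0 w)).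
  by have /andP[_ v1] := V01 0%N w; rewrite gtr0_norm// subr_gt0.
rewrite (@indep_pair_integralM _ _ _ _ _ _ _ P (fun w => (V 0%N w, Y 0%N w)) W
  (fun p => (`|1 - p.1|)%:E) (fun x => `|x|)%E)//; last 4 first.
- exact: measurable_fun_pair.
- apply: indep_head_tail => //; apply: tail_measurable_fun.
  apply: (mW0 _ (g_sigma_algebraType (tail_cylinders V Y)) id).
  + exact: tail_measurable_V.
  + exact: tail_measurable_Y.
- by apply/measurable_EFinP; apply: measurableT_comp => //; exact: measurable_funB.
- exact: measurableT_comp.
have -> : (\int[P]_w `|W w| = \int[P]_w W w)%E by apply: eq_integral => w _; rewrite gee0_abs.
rewrite /W (IH (th + al) (shift V) (shift Y))//.
have := beta_law_moments (mV 0%N) (lV 0%N) 0 1.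
rewrite subr_gt0 mul1r => /(_ al1 (ltr_wpDl th0 al0)).
under eq_integral do rewrite expr0 expr1 mul1r.
move=> ->; rewrite muleA -EFinM; congr (_%:E * _)%E; last first.
  apply: (@eq_law_integral _ _ _ _ _ _ _ P P (shift Y 0%N) (Y 0%N) phi) => //.
  by move=> a ma; rewrite lY'// lY.
rewrite !(stick_remainderSl al th) !risingS !rising0 !mul1r !addr0.
have -> : 1 - al + (th + al) = th + 1 by ring.
by rewrite mulrBr.
Qed.

Variables (al th : R).
Hypotheses (al01 : 0 < al < 1) (th0 : 0 <= th).

(** [c] and [be] come from [prod_stick_mean_le]: the expected mass after n sticks is at most (c / (n
    + c))^be. This is why the truncation level of the k-th stick is k + c. *)
Let c : R := (th + 1) / al.
Let be : R := (1 - al) / al.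

Let al0 : 0 < al. Proof. by have /andP[] := al01. Qed.
Let al1 : al < 1. Proof. by have /andP[] := al01. Qed.
Let be0 : 0 < be. Proof. by rewrite divr_gt0// subr_gt0. Qed.
Let c1 : 1 <= c.
Proof. by rewrite ler_pdivlMr// mul1r (le_trans (ltW al1))// lerDr. Qed.
Let c0 : 0 < c. Proof. exact: lt_le_trans c1. Qed.

(** Only the sticks with k + c >= z count; their expected weights telescope to at most the remainder
    at the first such k, which is at most (c / (k + c))^be. *)
Lemma sum_stick_remainder_indic_le (z : R) N : 0 < z ->
  \sum_(k < N) (stick_remainder al th k - stick_remainder al th k.+1) *
     (z <= k%:R + c)%R%:R <= (c / z) `^ be.
Proof.
move=> z0.
pose S n : R := \sum_(k < n) (stick_remainder al th k - stick_remainder al th k.+1) *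
  (z <= k%:R + c)%R%:R.
rewrite -/(S N).
have S0 n : n%:R + c < z -> S n.+1 = 0.
  move=> nz; apply: big1 => k _; rewrite leNgt (le_lt_trans _ nz) ?mulr0//.
  by rewrite lerD2r ler_nat -ltnS.
have S0' n : ~~ (z <= n%:R + c) -> S n = 0.
  rewrite -ltNge => nz; case: n nz => [|n] nz; first by rewrite /S big_ord0.
  by apply: S0; apply: le_lt_trans nz; rewrite lerD2r ler_nat.
have r_le n : z <= n%:R + c -> stick_remainder al th n <= (c / z) `^ be.
  move=> zn; apply: (le_trans (prod_stick_mean_le n al01 th0)); rewrite -/c -/be.
  have cn0 : 0 < c + n%:R by rewrite ltr_pwDl.
  apply: ge0_ler_powR.
  - exact: ltW be0.
  - by rewrite nnegrE; apply: divr_ge0; exact: ltW.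
  - by rewrite nnegrE; apply: divr_ge0; exact: ltW.
  - by apply: ler_wpM2l; [exact: ltW|rewrite lef_pV2 ?posrE// addrC].
have main n : z <= n%:R + c -> S n + stick_remainder al th n <= (c / z) `^ be.
  elim: n => [|n IH] zn; first by rewrite /S big_ord0 add0r r_le.
  have [zn'|zn'] := boolP (z <= n%:R + c).
    apply: le_trans (IH zn'); rewrite /S big_ord_recr/= zn' mulr1.
    by rewrite -addrA lerD2l subrK.
  by rewrite S0 ?add0r ?r_le// ltNge.
have [zN|zN] := boolP (z <= N%:R + c); last by rewrite S0'// powR_ge0.
apply: le_trans (main N zN); rewrite lerDl; apply: stick_remainder_ge0 => //; exact: ltW.
Qed.

(** The trivial bound N is carried through the induction: if the index N still counts, the sum is at
    most N + 1 <= N + c < z, where c >= 1 is used. *)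
Lemma sum_indic_gt_le (z : R) N : 0 <= z -> \sum_(k < N) (k%:R + c < z)%R%:R <= z.
Proof.
move=> z0; suff : \sum_(k < N) ((k%:R + c < z)%R%:R : R) <= z /\
    \sum_(k < N) ((k%:R + c < z)%R%:R : R) <= N%:R by case.
elim: N => [|N [IH1 IH2]]; first by rewrite big_ord0.
rewrite big_ord_recr/= -natr1; case: ltP => [Nz|_]; last first.
  by rewrite addr0; split=> //; rewrite (le_trans IH2)// lerDl.
split; last by rewrite lerD2r.
by rewrite (le_trans _ (ltW Nz))// lerD.
Qed.

Variables (d : measure_display) (T : measurableType d) (P : probability T R).
Variables (nu : set (\bar R) -> \bar R) (V : nat -> T -> R) (Y : nat -> T -> \bar R).
Hypothesis r : regular_sticks al th nu P V Y.
Hypothesis Yal : (\int[P]_w (`|fine (Y 0%N w)| `^ al)%:E < +oo)%E.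

Let z (y : \bar R) : R := `|fine y| `^ al.

Let mz : measurable_fun setT z.
Proof.
apply: (measurableT_comp (@measurable_powR R al)).
by apply: measurableT_comp => //; exact: measurable_fine.
Qed.

Let z0 y : 0 <= z y. Proof. exact: powR_ge0. Qed.

(** The linearly growing level is low enough for the weighted sum to be integrable and high enough
    for only finitely many values to be cut. *)
Let cut k (y : \bar R) : \bar R := (`|fine y| * (z y <= k%:R + c)%R%:R)%:E.

Let mcut k : measurable_fun setT (cut k).
Proof.
apply/measurable_EFinP; apply: measurable_funM.
  by apply: measurableT_comp => //; exact: measurable_fine.
have mA : measurable [set y | z y <= k%:R + c].
  rewrite (_ : [set y | _] = z @^-1` `]-oo, k%:R + c]).
    exact: (measurable_preimageT mz).
  by apply/seteqP; split => y /=; rewrite in_itv.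
rewrite (_ : (fun y => _) = \1_[set y | z y <= k%:R + c]); first exact: measurable_indic.
apply/funext => y; rewrite indicE; congr (_%:R)%R; congr nat_of_bool.
by apply/idP/idP; rewrite inE.
Qed.

Let cut0 k y : (0 <= cut k y)%E.
Proof. by rewrite lee_fin mulr_ge0. Qed.

(* Here y = f, z = f^al: the weights of the sticks with k + c >= z sum to at most
   (c / z)^((1 - al) / al), and f (f^-al)^((1 - al) / al) = f^al. *)
Let cut_sum_le y N :
  (\sum_(0 <= k < N) ((stick_remainder al th k - stick_remainder al th k.+1)%:E * cut k y) <=
   (c `^ be)%:E * (z y)%:E)%E.
Proof.
rewrite /cut; set x := `|fine y|.
have [x0|x0] := eqVneq x 0.
  rewrite big1 ?mule_ge0 ?lee_fin ?powR_ge0// => k _.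
  by rewrite x0 mul0r mule0.
have xp : 0 < x by rewrite lt_neqAle eq_sym x0 normr_ge0.
have zp : 0 < z y by rewrite powR_gt0.
under eq_bigr do rewrite -EFinM mulrCA.
rewrite sumEFin -mulr_sumr -EFinM lee_fin big_mkord.
apply: (@le_trans _ _ (x * (c / z y) `^ be)).
  by rewrite ler_wpM2l ?normr_ge0// sum_stick_remainder_indic_le.
rewrite powRM ?invr_ge0 ?(ltW c0) ?(ltW zp)// mulrCA.
rewrite ler_wpM2l ?powR_ge0// /z -/x -powRN -powRrM.
rewrite -[X in X * _](@powRr1 _ x) ?(ltW xp)// -powRD; last by rewrite x0 implybT.
by rewrite le_eqVlt; apply/orP; left; apply/eqP; congr (_ `^ _); rewrite /be; field; rewrite gt_eqF.
Qed.

Let G (w : T) : \bar R := (\sum_(0 <= k <oo) ((stick_weight V k w)%:E * cut k (Y k w)))%E.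

Let mterm k : measurable_fun setT (fun w => (stick_weight V k w)%:E * cut k (Y k w))%E.
Proof.
have [[mV mY _ _ _] _ _] := r.
apply: emeasurable_funM; first by apply/measurable_EFinP; exact: measurable_stick_weight.
exact: (measurableT_comp (mcut k)).
Qed.

Let term0 k w : (0 <= (stick_weight V k w)%:E * cut k (Y k w))%E.
Proof. by have [_ V01 _] := r; rewrite mule_ge0// lee_fin stick_weight_ge0. Qed.

(** Termwise integration replaces each weight by its mean and each value by [Y 0]; [cut_sum_le] then
    bounds the sum by a multiple of z(Y 0). *)
Let int_G : (\int[P]_w G w < +oo)%E.
Proof.
have [[mV mY _ _ _] V01 Y0] := r.
rewrite integral_nneseries//.
have rd k : 0 <= stick_remainder al th k - stick_remainder al th k.+1.
  by rewrite subr_ge0 stick_remainder_nd// (ltW al0).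
have mcutY k : measurable_fun setT (fun w => cut k (Y 0%N w)) by exact: (measurableT_comp (mcut k)).
have mzY : measurable_fun setT (fun w => (z (Y 0%N w))%:E).
  by apply/measurable_EFinP; exact: (measurableT_comp mz).
apply: (@le_lt_trans _ _ ((c `^ be)%:E * \int[P]_w (z (Y 0%N w))%:E)%E); last first.
  by rewrite lte_mul_pinfty// ?lee_fin ?powR_ge0.
apply: lime_le.
  by apply: is_cvg_nneseries => k _ _; exact: integral_ge0.
apply: nearW => N.
rewrite (eq_bigr (fun k => \int[P]_w ((stick_remainder al th k - stick_remainder al th k.+1)%:E *
    cut k (Y 0%N w)))%E); last first.
  move=> k _; rewrite (expected_stick_weight k al01 th0 r (mcut k) (cut0 k)).
  by rewrite ge0_integralZl_EFin.
rewrite -ge0_integral_sum//; last 2 first.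
- by move=> k; exact: emeasurable_funM.
- by move=> k w _; rewrite mule_ge0// lee_fin.
rewrite -ge0_integralZl_EFin ?powR_ge0//; last by move=> w _; rewrite lee_fin.
apply: ge0_le_integral => //.
- by move=> w _; apply: sume_ge0 => k _; rewrite mule_ge0// lee_fin.
- by apply: emeasurable_sum => k; exact: emeasurable_funM.
- exact: emeasurable_funM.
Qed.

Let G0 w : (0 <= G w)%E.
Proof. by apply: nneseries_ge0 => k _ _; exact: term0. Qed.

Let mG : measurable_fun setT G.
Proof. by apply: measurable_lim_ereal => n; exact: emeasurable_sum. Qed.

Let large k := [set w | (k%:R + c < z (Y k w))].

Let mlarge k : measurable (large k).
Proof.
have [[_ mY _ _ _] _ _] := r.
rewrite (_ : large k = (z \o Y k) @^-1` `]k%:R + c, +oo[).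
  exact: (measurable_preimageT (measurableT_comp mz (mY k))).
by apply/seteqP; split => w /=; rewrite in_itv/= andbT.
Qed.

(** All values share one law, so the partial sums are expected numbers of k with k + c < z(Y 0), at
    most the expectation of z(Y 0). *)
Let sum_large : (\sum_(0 <= k <oo) P (large k) < +oo)%E.
Proof.
have [[_ mY _ _ lY] _ _] := r.
apply: le_lt_trans Yal.
have mlarge0 k : measurable [set w | k%:R + c < z (Y 0%N w)].
  rewrite (_ : [set w | _] = (z \o Y 0%N) @^-1` `]k%:R + c, +oo[).
    exact: (measurable_preimageT (measurableT_comp mz (mY 0%N))).
  by apply/seteqP; split => w /=; rewrite in_itv/= andbT.
have mind k : measurable_fun setT (fun w => (\1_[set w | k%:R + c < z (Y 0%N w)] w : R)%:E).
  by apply/measurable_EFinP; exact: measurable_indic.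
apply: lime_le; first by apply: is_cvg_nneseries.
apply: nearW => N.
rewrite (eq_bigr (fun k => \int[P]_w (\1_[set w | k%:R + c < z (Y 0%N w)] w)%:E)%E); last first.
  move=> k _; rewrite integral_indic// setIT.
  have mS : measurable [set y | k%:R + c < z y].
    rewrite (_ : [set y | _] = z @^-1` `]k%:R + c, +oo[).
      exact: (measurable_preimageT mz).
    by apply/seteqP; split => y /=; rewrite in_itv/= andbT.
  transitivity (nu [set y | k%:R + c < z y]); first exact: lY.
  by rewrite -(lY 0%N _ mS).
rewrite -ge0_integral_sum//.
apply: ge0_le_integral => //.
- by move=> w _; apply: sume_ge0 => k _; rewrite lee_fin.
- exact: emeasurable_sum.
- by apply/measurable_EFinP; exact: (measurableT_comp mz).
move=> w _; rewrite sumEFin lee_fin big_mkord.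
rewrite (eq_bigr (fun k : 'I_N => (k%:R + c < z (Y 0%N w))%R%:R)); first exact: sum_indic_gt_le.
move=> k _; rewrite indicE; congr (_%:R)%R; congr nat_of_bool.
by apply/idP/idP; rewrite inE.
Qed.

(** Off a null set, by Borel-Cantelli, the series differs from the integrable [G] in finitely many
    finite terms only. *)
Theorem stick_integral_finite : (forall k w, Y k w < +oo)%E ->
  P [set w | stick_integral V Y w = +oo%E] = 0%E.
Proof.
move=> Yoo; have [[mV mY _ _ _] V01 Y0] := r.
have mGoo : measurable [set w | G w = +oo%E].
  exact: (measurable_preimageT mG (emeasurable_set1 _)).
have mXoo : measurable [set w | stick_integral V Y w = +oo%E].
  exact: (measurable_preimageT (measurable_stick_integral mV mY) (emeasurable_set1 _)).
have mls : measurable (lim_sup_set large).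
  apply: bigcapT_measurable => n; apply: bigcup_measurable => k _; exact: mlarge.
have Goo : P [set w | G w = +oo%E] = 0%E.
  have iG : P.-integrable setT G.
    apply/integrableP; split=> //.
    by rewrite (_ : (\int[P]_x `|G x| = \int[P]_x G x)%E)//; apply: eq_integral => w _; rewrite gee0_abs.
  have [N [mN N0 GN]] := integrable_ae measurableT iG.
  apply/eqP; rewrite eq_le measure_ge0 andbT -N0; apply: le_measure; rewrite ?inE//.
  by move=> w /= Gw; apply: GN => /= /(_ I); rewrite Gw.
apply/eqP; rewrite eq_le measure_ge0 andbT.
apply: (@le_trans _ _ (P (lim_sup_set large `|` [set w | G w = +oo%E]))).
  apply: le_measure; rewrite ?inE//; first exact: measurableU.
  move=> w /= Xoo; apply: contrapT => /not_orP[nL nG]; move: Xoo; apply/eqP.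
  rewrite -ltey.
  have [n nn] : exists n, forall k, (n <= k)%N -> z (Y k w) <= k%:R + c.
    apply: contrapT => h; apply: nL => n _.
    move: h => /forallNP/(_ n)/existsNP[k /not_implyP[nk /negP]].
    by rewrite -ltNge => kz; exists k.
  have X0 k : (0 <= (stick_weight V k w)%:E * Y k w)%E by exact: stick_term_ge0.
  rewrite /stick_integral (nneseries_split 0 n) ?add0n//.
  apply: lte_add_pinfty.
    apply: lte_sum_pinfty => k _; rewrite lte_mul_pinfty// ?lee_fin ?stick_weight_ge0//.
  apply: (@le_lt_trans _ _ (G w)); last by rewrite ltey; apply/eqP.
  rewrite /G (nneseries_split 0 n) ?add0n//.
  apply: (@le_trans _ _ (\sum_(n <= k <oo) ((stick_weight V k w)%:E * cut k (Y k w)))%E).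
    rewrite -(nneseries_addn n X0) -(nneseries_addn n (fun k => term0 k w)); apply: lee_nneseries => [k _ _|k _]; first exact: X0.
    have nk := leq_addl k n.
    rewrite /cut nn//= mulr1 ger0_norm ?fine_ge0//.
    by rewrite fineK// ge0_fin_numE// Yoo.
  by rewrite leeDr// sume_ge0.
have L0 : P (lim_sup_set large) = 0%E by exact: lim_sup_set_cvg0.
apply: (@le_trans _ _ (P (lim_sup_set large) + P [set w | G w = +oo%E])%E).
  exact: measureU2.
by rewrite L0 Goo adde0.
Qed.

End finiteness.

(** * Absolute continuity *)

(** |a| times the image of Lebesgue measure under the affine map agrees with Lebesgue measure on
    half-open intervals, hence everywhere. For a < 0 the preimage of an interval is closed at its
    other end, with the same length. *)
Lemma lebesgue_null_affine {R : realType} (A : set R) (a b : R) : a != 0 -> measurable A ->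
  lebesgue_measure A = 0%E -> lebesgue_measure [set v | A (a * v + b)] = 0%E.
Proof.
move=> a0 mA A0.
pose f (v : measurableTypeR R) : measurableTypeR R := a * v + b.
have mf : measurable_fun setT f.
  by apply: measurable_funD => //; exact: measurable_funM.
have h : lebesgue_measure A =
    mscale (NngNum (normr_ge0 a))
      (measure_function_pushforward__canonical__measure_function_Measure (@lebesgue_measure R) mf) A.
  apply: lebesgue_measure_unique => //= X.
  move=> [[u v] _ <-] /=; rewrite /mscale/= /pushforward.
  have [ap|an] := ltP 0 a.
    have -> : f @^-1` [set` `]u, v]] = [set` `](u - b) / a, (v - b) / a]].
      apply/seteqP; split => x /=; rewrite !in_itv/= ltr_pdivrMr// ler_pdivlMr//
        ltrBlDr lerBrDr [x * a]mulrC; by [].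
    rewrite !lebesgue_measure_itv/= !lte_fin ltr_pM2r ?invr_gt0// ltrD2r gtr0_norm//.
    case: ifP => _; last by rewrite mule0.
    by rewrite -!EFinD -EFinM; congr EFin; field.
  have {an} an : a < 0 by rewrite lt_neqAle a0.
  have -> : f @^-1` [set` `]u, v]] = [set` `[(v - b) / a, (u - b) / a[].
    apply/seteqP; split => x /=; rewrite !in_itv/= ler_ndivrMr// ltr_ndivlMr//
        ltrBlDr lerBrDr [x * a]mulrC andbC; by [].
  rewrite !lebesgue_measure_itv/= !lte_fin ltr_nM2r ?invr_lt0// ltrD2r ltr0_norm//.
  case: ifP => _; last by rewrite mule0.
  by rewrite -!EFinD -EFinM; congr EFin; field.
move: h; rewrite A0 /mscale/= /pushforward => /esym/eqP.
by rewrite mule_eq0 eqe normr_eq0 (negbTE a0) => /eqP.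
Qed.

Section absolute_continuity.
Context d (T : measurableType d) (R : realType) (P : probability T R).

Lemma convex_comb_null (V : T -> R) (B X : T -> \bar R) (a b : R) (A : set R) :
  measurable_fun setT V -> measurable_fun setT B -> measurable_fun setT X ->
  has_law P V (beta_law a b) -> indep_pair P V B -> indep_pair P (fun w => (V w, B w)) X ->
  measurable A -> lebesgue_measure A = 0%E ->
  P [set w | fine (B w) != fine (X w) /\ A (V w * fine (B w) + (1 - V w) * fine (X w))] = 0%E.
Proof.
move=> mV mB mX lV VB VBX mA A0.
pose S := [set p : (R * \bar R) * \bar R | fine p.1.2 != fine p.2 /\
   A (p.1.1 * fine p.1.2 + (1 - p.1.1) * fine p.2)].
have mf1 : measurable_fun setT (fun p : (R * \bar R) * \bar R => fine p.1.2).
  by apply: measurableT_comp; [exact: fine_measurable|exact: measurableT_comp].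
have mf2 : measurable_fun setT (fun p : (R * \bar R) * \bar R => fine p.2).
  by apply: measurableT_comp => //; exact: fine_measurable.
have mf0 : measurable_fun setT (fun p : (R * \bar R) * \bar R => p.1.1).
  exact: measurableT_comp.
have mS : measurable S.
  have -> : S = (fun p : (R * \bar R) * \bar R => fine p.1.2 - fine p.2) @^-1` (~` [set 0]) `&`
     (fun p => p.1.1 * fine p.1.2 + (1 - p.1.1) * fine p.2) @^-1` A.
    apply/seteqP; split => p /= [h1 h2]; split=> //.
      by apply/eqP; rewrite subr_eq0.
    by move/eqP : h1; rewrite subr_eq0.
  apply: measurableI.
    apply: (measurable_preimageT (measurable_funB mf1 mf2)).
    by apply: measurableC; exact: measurable_set1.
  apply: (measurable_preimageT _ mA); apply: measurable_funD; apply: measurable_funM => //.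
  exact: measurable_funB.
pose phi (p : (R * \bar R) * \bar R) : \bar R := (\1_S p)%:E.
have mphi : measurable_fun setT phi by apply/measurable_EFinP; exact: measurable_indic.
have phi0 p : (0 <= phi p)%E by rewrite lee_fin.
have mVB : measurable_fun setT (fun w => (V w, B w)) by exact: measurable_fun_pair.
have mVBX : measurable_fun setT (fun w => ((V w, B w), X w)) by exact: measurable_fun_pair.
transitivity (\int[P]_w phi ((V w, B w), X w))%E.
  rewrite -[LHS]/(P ((fun w => ((V w, B w), X w)) @^-1` S)) probability_indic//.
  exact: (measurable_preimageT mVBX).
rewrite (indep_pair_integral mVB mX VBX mphi phi0).
pose psi x (q : R * \bar R) := phi (q, x).
have mpsi x : measurable_fun setT (psi x).
  have mp : measurable_fun setT (fun q : R * \bar R => (q, x)) by exact: measurable_fun_pair.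
  exact: (measurableT_comp mphi mp).
have mF : measurable_fun setT (fun p : T * T => phi ((V p.1, B p.1), X p.2)).
  have mp : measurable_fun setT (fun p : T * T => ((V p.1, B p.1), X p.2)).
    apply: measurable_fun_pair; last exact: measurableT_comp.
    by apply: measurable_fun_pair; exact: measurableT_comp.
  exact: (measurableT_comp mphi mp).
rewrite (@fubini_tonelli _ _ _ _ _ P P (fun p => phi ((V p.1, B p.1), X p.2)))//.
apply: integral0_eq => w' _.
rewrite (@indep_pair_integral _ _ _ _ _ _ _ P V B mV mB (psi (X w')) VB)//; last first.
  by move=> q; exact: phi0.
have mF2 : measurable_fun setT (fun p : T * T => psi (X w') (V p.1, B p.2)).
  have mp : measurable_fun setT (fun p : T * T => (V p.1, B p.2)).
    by apply: measurable_fun_pair; exact: measurableT_comp.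
  exact: (measurableT_comp (mpsi _) mp).
rewrite (@fubini_tonelli _ _ _ _ _ P P (fun p => psi (X w') (V p.1, B p.2)))//; last first.
  by move=> q; exact: phi0.
apply: integral0_eq => w _ /=.
have [e|ne] := eqVneq (fine (B w)) (fine (X w')).
  apply: integral0_eq => x _; rewrite /psi /phi indicE (_ : _ \in S = false)//.
  by apply/negP; rewrite inE /S/= e eqxx => -[].
(* For fixed distinct values of B and X the combination is affine in v with nonzero slope, so the
   null set [A] pulls back to a null set of sticks. *)
pose N := [set v | A ((fine (B w) - fine (X w')) * v + fine (X w'))].
have mN : measurable N.
  apply: (@measurable_preimageT _ _ R R (fun v => (fine (B w) - fine (X w')) * v + fine (X w')) _ A mA).
  by apply: measurable_funD => //; exact: measurable_funM.
have N0 : lebesgue_measure N = 0%E by apply: lebesgue_null_affine => //; rewrite subr_eq0.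
rewrite -(beta_law_null lV mN N0) probability_indic; last exact: (measurable_preimageT mV).
apply: eq_integral => x _; rewrite /psi /phi !indicE; congr (_%:R%:E); congr nat_of_bool.
apply/idP/idP; rewrite !inE /S /N/=.
  by move=> [_]; congr A; ring.
by move=> h; split=> //; move: h; congr A; ring.
Qed.

Variables (al : R) (nu : set (\bar R) -> \bar R).

(** Since 1 - V 0 > 0, an infinite tail mean would make the whole mean infinite; so a finite mean
    splits within the reals. *)
Let finite_split (th : R) (V : nat -> T -> R) (Y : nat -> T -> \bar R) w (r : R) :
  regular_sticks al th nu P V Y -> (forall k w, Y k w < +oo)%E ->
  stick_integral V Y w = r%:E ->
  exists y x : R, [/\ Y 0%N w = y%:E, stick_integral (shift V) (shift Y) w = x%:E &
    r = V 0%N w * y + (1 - V 0%N w) * x].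
Proof.
move=> [_ V01 Y0] Yoo; rewrite stick_integral_rec//.
have [y yE] : exists y, Y 0%N w = y%:E.
  by exists (fine (Y 0%N w)); rewrite fineK// ge0_fin_numE.
have X0 : (0 <= stick_integral (shift V) (shift Y) w)%E.
  by apply: stick_integral_ge0 => k v; [exact: V01|exact: Y0].
have /andP[_ v1] := V01 0%N w.
rewrite yE -/(shift V) -/(shift Y).
have [->|Xoo] := eqVneq (stick_integral (shift V) (shift Y) w) +oo%E.
  by rewrite gt0_muley ?lte_fin ?subr_gt0.
have [x xE] : exists x, stick_integral (shift V) (shift Y) w = x%:E.
  exists (fine (stick_integral (shift V) (shift Y) w)).
  by rewrite fineK// ge0_fin_numE// ltey.
by rewrite xE -!EFinM -EFinD => -[rE]; exists y, x; split.
Qed.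

(** Despite the name, the event that the first value and the tail mean do not coincide while their
    combination falls in [A]. *)
Let collision (V : nat -> T -> R) (Y : nat -> T -> \bar R) (A : set R) :=
  [set w | fine (Y 0%N w) != fine (stick_integral (shift V) (shift Y) w) /\
     A (V 0%N w * fine (Y 0%N w) + (1 - V 0%N w) * fine (stick_integral (shift V) (shift Y) w))].

Let measurable_collision V Y A : (forall k, measurable_fun setT (V k)) ->
  (forall k, measurable_fun setT (Y k)) -> measurable A -> measurable (collision V Y A).
Proof.
move=> mV mY mA.
have mX : measurable_fun setT (stick_integral (shift V) (shift Y)).
  by apply: measurable_stick_integral => k; [exact: mV|exact: mY].
have mB : measurable_fun setT (fun w => fine (Y 0%N w)).
  by apply: (measurableT_comp (@fine_measurable R setT measurableT)).
have mC : measurable_fun setT (fun w => fine (stick_integral (shift V) (shift Y) w)).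
  by apply: (measurableT_comp (@fine_measurable R setT measurableT)).
have -> : collision V Y A =
    (fun w => fine (Y 0%N w) - fine (stick_integral (shift V) (shift Y) w)) @^-1` (~` [set 0]) `&`
    (fun w => V 0%N w * fine (Y 0%N w) +
       (1 - V 0%N w) * fine (stick_integral (shift V) (shift Y) w)) @^-1` A.
  apply/seteqP; split => w /= [h1 h2]; split=> //.
    by apply/eqP; rewrite subr_eq0.
  by move/eqP : h1; rewrite subr_eq0.
apply: measurableI.
  apply: (measurable_preimageT (measurable_funB mB mC)).
  by apply: measurableC; exact: measurable_set1.
apply: (measurable_preimageT _ mA); apply: measurable_funD; apply: measurable_funM => //.
exact: measurable_funB.
Qed.

Let collision_null (th : R) V Y A : regular_sticks al th nu P V Y -> measurable A ->
  lebesgue_measure A = 0%E -> P (collision V Y A) = 0%E.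
Proof.
move=> [[mV mY VY lV lY] V01 Y0] mA A0; apply: (convex_comb_null _ _ _ (lV 0%N)) => //.
- by apply: measurable_stick_integral => k; [exact: mV|exact: mY].
- exact: indep_head.
- exact: indep_head_stick_integral.
Qed.

(** Up to a null event, the mean equals c only if the first value and the tail mean both equal c.
    These are independent, so each stick contributes a factor q; for q < 1 this rules out the
    atom. *)
Lemma stick_integral_atom_le (c q : R) n (th : R) V Y : regular_sticks al th nu P V Y ->
  (forall k w, Y k w < +oo)%E -> 0 <= q -> (nu [set c%:E] <= q%:E)%E ->
  (P (stick_integral V Y @^-1` [set c%:E]) <= (q ^+ n)%:E)%E.
Proof.
elim: n th V Y => [|n IH] th V Y r Yoo q0 nuq.
  rewrite expr0; apply: probability_le1; have [[mV mY _ _ _] _ _] := r.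
  by apply: (measurable_preimageT (measurable_stick_integral mV mY)); exact: emeasurable_set1.
have r' := regular_sticks_shift r.
have [[mV mY VY lV lY] V01 Y0] := r; have [[mV' mY' _ _ _] _ _] := r'.
pose X' := stick_integral (shift V) (shift Y).
have mX' : measurable_fun setT X' by exact: measurable_stick_integral.
have mc : measurable [set c%:E : \bar R] by exact: emeasurable_set1.
have mX : measurable_fun setT (stick_integral V Y) by exact: measurable_stick_integral.
have mcol := measurable_collision mV mY (measurable_set1 c).
have mYX : measurable (Y 0%N @^-1` [set c%:E] `&` X' @^-1` [set c%:E]).
  by apply: measurableI; [exact: (measurable_preimageT (mY 0%N))|exact: (measurable_preimageT mX')].
apply: (@le_trans _ _ (P (collision V Y [set c] `|`
    (Y 0%N @^-1` [set c%:E] `&` X' @^-1` [set c%:E])))).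
  apply: le_measure; rewrite ?inE//.
  - exact: (measurable_preimageT mX).
  - exact: measurableU.
  move=> w /= Xc; have [y [x [yE xE cE]]] := finite_split r Yoo Xc.
  rewrite /collision/= /X' yE xE/=; have [yx|yx] := eqVneq y x; last by left.
  by right; rewrite cE yx; split; congr EFin; ring.
apply: (@le_trans _ _ (P (collision V Y [set c]) +
    P (Y 0%N @^-1` [set c%:E] `&` X' @^-1` [set c%:E]))%E).
  exact: measureU2.
rewrite (collision_null r)//; last by rewrite lebesgue_measure_set1.
have ind := indep_head_stick_integral mV mY VY.
have m2 : measurable [set p : R * \bar R | p.2 = c%:E].
  exact: (measurable_preimageT (measurable_snd : measurable_fun setT (@snd R (\bar R))) mc).
rewrite add0e (_ : P _ = P (Y 0%N @^-1` [set c%:E]) * P (X' @^-1` [set c%:E]))%E; last first.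
  exact: (ind [set p | p.2 = c%:E] [set c%:E] m2 mc).
rewrite exprS EFinM; apply: lee_pmul => //; first by rewrite (lY 0%N _ mc).
by apply: (IH (th + al)) => // k w; exact: Yoo.
Qed.

Lemma stick_integral_no_atom (c th : R) V Y : regular_sticks al th nu P V Y ->
  (forall k w, Y k w < +oo)%E -> (nu [set c%:E] < 1)%E ->
  P (stick_integral V Y @^-1` [set c%:E]) = 0%E.
Proof.
move=> r Yoo nuc; have [[mV mY _ _ lY] _ _] := r.
have nu0 : (0 <= nu [set c%:E])%E by rewrite -(lY 0%N _ (emeasurable_set1 _)) measure_ge0.
have nuf : nu [set c%:E] \is a fin_num by rewrite ge0_fin_numE// (lt_trans nuc)// ltry.
have [q qE] : exists q, nu [set c%:E] = q%:E by exists (fine (nu [set c%:E])); rewrite fineK.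
move: nu0 nuc; rewrite qE lee_fin lte_fin => q0 q1.
apply/eqP; rewrite eq_le measure_ge0 andbT; apply/lee_addgt0Pr => e e0; rewrite add0e.
have : q ^+ n @[n --> \oo] --> 0 by apply: cvg_expr; rewrite ger0_norm.
move=> /cvgrPdist_le /(_ e e0) [n _ /(_ n (leqnn n))] /=.
rewrite sub0r normrN ger0_norm ?exprn_ge0// => qn.
apply: (@le_trans _ _ (q ^+ n)%:E); last by rewrite lee_fin.
by apply: (stick_integral_atom_le _ r) => //; rewrite qE.
Qed.

Theorem stick_integral_abs_continuous (th : R) V Y A : regular_sticks al th nu P V Y ->
  (forall k w, Y k w < +oo)%E -> (forall c, nu [set c%:E] < 1)%E ->
  measurable A -> lebesgue_measure A = 0%E ->
  P [set w | exists2 x, A x & stick_integral V Y w = x%:E] = 0%E.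
Proof.
move=> r Yoo nuc mA A0.
have r' := regular_sticks_shift r.
have [[mV mY VY lV lY] V01 Y0] := r; have [[mV' mY' _ _ _] _ _] := r'.
pose X' := stick_integral (shift V) (shift Y).
have mX' : measurable_fun setT X' by exact: measurable_stick_integral.
have mX : measurable_fun setT (stick_integral V Y) by exact: measurable_stick_integral.
have mcol := measurable_collision mV mY mA.
have ind := indep_head_stick_integral mV mY VY.
pose S := [set p : (R * \bar R) * \bar R | p.1.2 = p.2].
have mS : measurable S.
  rewrite -[X in measurable X]setTI.
  apply: measurable_eqe => //; exact: measurableT_comp.
have mVY : measurable_fun setT (fun w => (V 0%N w, Y 0%N w)) by exact: measurable_fun_pair.
have mVYX : measurable_fun setT (fun w => ((V 0%N w, Y 0%N w), X' w)) by exact: measurable_fun_pair.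
have mYX : measurable [set w | Y 0%N w = X' w] by exact: (measurable_preimageT mVYX mS).
(* By independence the first value may be frozen at y, and the tail mean has no atom at y. *)
have YX0 : P [set w | Y 0%N w = X' w] = 0%E.
  rewrite probability_indic//.
  transitivity (\int[P]_w (\1_S ((V 0%N w, Y 0%N w), X' w))%:E)%E.
    by apply: eq_integral => w _; rewrite !indicE; congr (_%:R%:E); congr nat_of_bool;
      apply/idP/idP; rewrite !inE.
  rewrite (@indep_pair_integral _ _ _ _ _ _ _ P _ X' mVY mX' (fun p => (\1_S p)%:E) ind)//;
    last by apply/measurable_EFinP; exact: measurable_indic.
  apply: integral0_eq => w _ /=.
  have [y yE] : exists y, Y 0%N w = y%:E.
    by exists (fine (Y 0%N w)); rewrite fineK// ge0_fin_numE.
  have Yoo' k v : (shift Y k v < +oo)%E by exact: Yoo.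
  rewrite -(stick_integral_no_atom r' Yoo' (nuc y)) probability_indic; last first.
    by apply: (measurable_preimageT mX'); exact: emeasurable_set1.
  apply: eq_integral => v _; rewrite !indicE; congr (_%:R%:E); congr nat_of_bool.
  by apply/idP/idP; rewrite !inE /S/= yE => /esym.
have mXA : measurable [set w | exists2 x, A x & stick_integral V Y w = x%:E].
  rewrite (_ : [set w | _] = stick_integral V Y @^-1` (EFin @` A)).
    by apply: (measurable_preimageT mX); exact: measurable_image_EFin.
  by apply/seteqP; split => w [x Ax xE]; exists x.
apply/eqP; rewrite eq_le measure_ge0 andbT.
apply: (@le_trans _ _ (P (collision V Y A `|` [set w | Y 0%N w = X' w]))).
  apply: le_measure; rewrite ?inE//; first exact: measurableU.
  move=> w /= [c Ac Xc]; have [y [x [yE xE cE]]] := finite_split r Yoo Xc.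
  rewrite /collision/= /X' yE xE/=; have [->|yx] := eqVneq y x; first by right.
  by left; split=> //; rewrite -cE.
apply: (@le_trans _ _ (P (collision V Y A) + P [set w | Y 0%N w = X' w])%E).
  exact: measureU2.
by rewrite YX0 (collision_null r mA A0) adde0.
Qed.

End absolute_continuity.

(** * Almost sure modifications of sticks and values *)

Section regularization.
Context d (T : measurableType d) (R : realType) (P : probability T R).

Lemma eq_law_ae d' (T' : measurableType d') (X X' : T -> T') (N : set T) (A : set T') :
  measurable_fun setT X -> measurable_fun setT X' -> measurable N -> P N = 0%E ->
  (forall w, ~ N w -> X w = X' w) -> measurable A -> P (X @^-1` A) = P (X' @^-1` A).
Proof.
move=> mX mX' mN N0 XX' mA.
have half (U U' : T -> T') : measurable_fun setT U -> measurable_fun setT U' ->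
    (forall w, ~ N w -> U w = U' w) -> (P (U @^-1` A) <= P (U' @^-1` A))%E.
  move=> mU mU' UU'.
  have m := measurable_preimageT mU mA; have m' := measurable_preimageT mU' mA.
  apply: (@le_trans _ _ (P (U' @^-1` A `|` N))).
    apply: le_measure; rewrite ?inE//; first exact: measurableU.
    by move=> w /= Aw; have [Nw|Nw] := pselect (N w); [right|left; rewrite -UU'].
  apply: (@le_trans _ _ (P (U' @^-1` A) + P N)%E); first exact: measureU2.
  by rewrite N0 adde0.
by apply/eqP; rewrite eq_le !half// => w Nw; rewrite XX'.
Qed.

(** The default outside ]0, 1[ is the interior point 1/2; writing it with indicators leaves
    measurability to arithmetic. *)
Definition clip01 (v : R) : R := \1_(`]0, 1[%classic) v * v + (1 - \1_(`]0, 1[%classic) v) / 2.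

Lemma clip01_id v : 0 < v < 1 -> clip01 v = v.
Proof.
by move=> v01; rewrite /clip01 indicE mem_set /= ?in_itv//= mul1r subrr mul0r addr0.
Qed.

Lemma clip01_bounds v : 0 < clip01 v < 1.
Proof.
rewrite /clip01 indicE; case: (boolP (v \in _)) => [|_] /=.
  by rewrite inE/= in_itv/= mul1r subrr mul0r addr0.
by rewrite mul0r add0r subr0; apply/andP; split; lra.
Qed.

Lemma measurable_clip01 : measurable_fun setT clip01.
Proof.
have m1 : measurable_fun setT (\1_(`]0, 1[%classic : set R) : R -> R) by exact: measurable_indic.
apply: measurable_funD; first exact: measurable_funM.
by apply: measurable_funM => //; exact: measurable_funB.
Qed.

Definition clip0 (y : \bar R) : \bar R := maxe y 0%E.

Lemma measurable_clip0 : measurable_fun setT clip0.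
Proof. exact: measurable_maxe. Qed.

(** Each stick or value is changed on a null set only. The mean is unchanged off the countable union
    of these sets, so all laws survive. *)
Lemma regular_sticks_clip al th nu V Y : PD_stick al th nu P V Y ->
  (forall k, P (Y k @^-1` [set y | (0 <= y)%E]) = 1%E) ->
  regular_sticks al th nu P (fun k => clip01 \o V k) (fun k => clip0 \o Y k) /\
  (forall A, measurable A -> P (stick_integral V Y @^-1` A) =
     P (stick_integral (fun k => clip01 \o V k) (fun k => clip0 \o Y k) @^-1` A)).
Proof.
move=> [mV mY VY lV lY] Yge0.
have mV' k : measurable_fun setT (clip01 \o V k) by exact: (measurableT_comp measurable_clip01).
have mY' k : measurable_fun setT (clip0 \o Y k) by exact: (measurableT_comp measurable_clip0).
have mpos : measurable [set y : \bar R | (0 <= y)%E].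
  by rewrite -[X in measurable X]setTI; exact: emeasurable_fun_c_infty.
pose N1 k := ~` (V k @^-1` `]0, 1[%classic).
pose N2 k := ~` (Y k @^-1` [set y | (0 <= y)%E]).
have mN1 k : measurable (N1 k) by apply: measurableC; exact: (measurable_preimageT (mV k)).
have mN2 k : measurable (N2 k) by apply: measurableC; exact: (measurable_preimageT (mY k)).
have N10 k : P (N1 k) = 0%E.
  rewrite probability_setC ?(beta_law_01 (lV k)) ?subee//.
  exact: (measurable_preimageT (mV k)).
have N20 k : P (N2 k) = 0%E.
  by rewrite probability_setC ?Yge0 ?subee//; exact: (measurable_preimageT (mY k)).
have id1 k w : ~ N1 k w -> V k w = clip01 (V k w).
  by move=> /contrapT; rewrite /= in_itv/= => /clip01_id.
have id2 k w : ~ N2 k w -> Y k w = clip0 (Y k w).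
  by move=> /contrapT /= h; rewrite /clip0 max_l.
split.
  split; last 2 first.
  - by move=> k w; exact: clip01_bounds.
  - by move=> k w; rewrite /= /clip0 le_max lexx orbT.
  split=> //.
  - exact: (stick_indep_comp measurable_clip01 measurable_clip0 VY).
  - by move=> k B mB; rewrite -(lV k B mB); apply/esym/(@eq_law_ae _ _ _ _ (N1 k)) => // w; exact: id1.
  - by move=> k B mB; rewrite -(lY k B mB); apply/esym/(@eq_law_ae _ _ _ _ (N2 k)) => // w; exact: id2.
pose N := \bigcup_k (N1 k `|` N2 k).
have mN : measurable N by apply: bigcupT_measurable => k; exact: measurableU.
have N0 : P N = 0%E.
  apply: measure_negligible => //; apply: negligible_bigcup => k.
  by apply: negligibleU; [exists (N1 k); split=> //; exact: N10|exists (N2 k); split=> //; exact: N20].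
move=> A mA; apply: (eq_law_ae _ _ mN N0) => //; try exact: measurable_stick_integral.
move=> w nN; have nk k : ~ N1 k w /\ ~ N2 k w.
  by split=> h; apply: nN; exists k => //; [left|right].
apply: eq_eseriesr => k _; congr (_%:E * _)%E; last by have [_ /id2] := nk k.
rewrite /stick_weight; congr (_ * _); first by have [/id1] := nk k.
by apply: eq_bigr => j _; congr (1 - _); have [/id1] := nk j.
Qed.

End regularization.

Unset Implicit Arguments.

(** The means are series in the extended reals, so absolute continuity takes two clauses: no mass at
    the infinities, and none on Lebesgue-null sets of reals. Non-constancy of f is required because
    for f = c almost surely the mean is c, whose law is a point mass. *)
Theorem theorem2p1 (R : realType) (dX : measure_display) (X : measurableType dX)
  (H : probability X R) (f : X -> R) (alpha theta : R)
  (d0 d1 d2 : measure_display)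
  (O0 : measurableType d0) (O1 : measurableType d1) (O2 : measurableType d2)
  (P0 : probability O0 R) (P1 : probability O1 R) (P2 : probability O2 R)
  (V0 : nat -> O0 -> R) (Z0 : nat -> O0 -> X)
  (V1 : nat -> O1 -> R) (Z1 : nat -> O1 -> X)
  (V2 : nat -> O2 -> R) (Y2 : nat -> O2 -> \bar R) :
  0 < alpha < 1 -> 0 < theta ->
  nonatomic H ->
  measurable_fun setT f -> (forall x, 0 <= f x) ->
  (\int[H]_x (f x `^ alpha)%:E < +oo)%E ->
  (forall c : R, (0 < H [set x | f x != c])%E) ->
  (* P~_{alpha,0} with mean H *)
  PD_stick alpha 0 H P0 V0 Z0 ->
  (* P~_{alpha,theta} with mean H *)
  PD_stick alpha theta H P1 V1 Z1 ->
  (* P~_{0,theta}: Dirichlet process with mean Q_{alpha,0}, the law of P~_{alpha,0}(f) *)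
  PD_stick 0 theta
    (fun B : set (\bar R) => P0 (stick_integral V0 (fun k w => (f (Z0 k w))%:E) @^-1` B))
    P2 V2 Y2 ->
  let Xat := stick_integral V1 (fun k w => (f (Z1 k w))%:E) in
  let Xdp := stick_integral V2 Y2 in
  (forall B : set (\bar R), measurable B -> P1 (Xat @^-1` B) = P2 (Xdp @^-1` B))
  /\ (P1 [set w | ~ (Xat w \is a fin_num)] = 0%E
      /\ forall A : set R, measurable A -> lebesgue_measure A = 0%E ->
           P1 [set w | exists2 r, A r & Xat w = r%:E] = 0%E).
Proof.
move=> al01 th0 _ mf f0 fal fnc PD0 PD1 PD2.
set Xat := stick_integral V1 _; set Xdp := stick_integral V2 _; cbv zeta.
pose g x : \bar R := (f x)%:E.
have mg : measurable_fun setT g by exact/measurable_EFinP.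
(* The law of f(Z): atoms matter only through f, so values replace points from here on. *)
pose nu (A : set (\bar R)) := H (g @^-1` A).
have sticks d (T : measurableType d) (P : probability T R) t V Z :
    PD_stick alpha t H P V Z ->
    PD_stick alpha t nu P V (fun k => g \o Z k) /\
    forall k, P ((g \o Z k) @^-1` [set y | (0 <= y)%E]) = 1%E.
  move=> [mV mZ VZ lV lZ]; split.
    split=> //.
    - by move=> k; exact: measurableT_comp.
    - exact: (stick_indep_comp (@measurable_id _ R setT) mg VZ).
    - by move=> k B mB; rewrite comp_preimage lZ//; exact: (measurable_preimageT mg).
  move=> k; rewrite -(@probability_setT _ _ _ P); congr (P _).
  by apply/seteqP; split => w //= _; rewrite lee_fin.
have [PD0' pos0] := sticks _ _ _ _ _ _ PD0.
have [PD1' pos1] := sticks _ _ _ _ _ _ PD1.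
have [r0 e0] := regular_sticks_clip PD0' pos0.
have [r1 e1] := regular_sticks_clip PD1' pos1.
pose Y0' k := @clip0 R \o (g \o Z0 k); pose Y1' k := @clip0 R \o (g \o Z1 k).
pose X0' := stick_integral (fun k => @clip01 R \o V0 k) Y0'.
pose X1' := stick_integral (fun k => @clip01 R \o V1 k) Y1'.
have Y0oo k w : (Y0' k w < +oo)%E by rewrite /Y0' /= /clip0 gt_max !ltry.
have Y1oo k w : (Y1' k w < +oo)%E by rewrite /Y1' /= /clip0 gt_max !ltry.
have [[mV0 mY0 _ _ _] V001 Y00] := r0; have [[mV1 mY1 _ _ lY1] V101 Y10] := r1.
have X00 w : (0 <= X0' w)%E by exact: stick_integral_ge0.
have X10 w : (0 <= X1' w)%E by exact: stick_integral_ge0.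
have mX1 : measurable_fun setT X1' by exact: measurable_stick_integral.
have mpos : measurable [set y : \bar R | (0 <= y)%E].
  by rewrite -[X in measurable X]setTI; exact: emeasurable_fun_c_infty.
(* The base law of the Dirichlet process is that of the unmodified mean; [e0] identifies it with the
   law of the clipped one. *)
have PD2' : PD_stick 0 theta (fun B => P0 (X0' @^-1` B)) P2 V2 Y2.
  by have [mV mY VY lV lY] := PD2; split=> // k B mB; rewrite lY// e0.
have pos2 k : P2 (Y2 k @^-1` [set y | (0 <= y)%E]) = 1%E.
  have [_ _ _ _ lY] := PD2'; rewrite lY// -(@probability_setT _ _ _ P0); congr (P0 _).
  by apply/seteqP; split => w //= _; exact: X00.
have [r2 e2] := regular_sticks_clip PD2' pos2.
have f_int : (\int[P1]_w (`|fine (Y1' 0%N w)| `^ alpha)%:E < +oo)%E.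
  have [_ mZ _ _ lZ] := PD1.
  rewrite (_ : (\int[P1]_w _)%E = \int[H]_x (f x `^ alpha)%:E)%E//.
  transitivity (\int[P1]_w (f (Z1 0%N w) `^ alpha)%:E)%E.
    by apply: eq_integral => w _; rewrite /Y1' /= /clip0 max_l ?lee_fin//= ger0_norm.
  apply: (@eq_law_integral _ _ _ _ _ _ _ P1 H (Z1 0%N) id (fun x => (f x `^ alpha)%:E)) => //.
  - by move=> a ma; exact: lZ.
  - by apply/measurable_EFinP; exact: (measurableT_comp (@measurable_powR R alpha)).
  - by move=> x; rewrite lee_fin powR_ge0.
have X1fin : P1 [set w | X1' w = +oo%E] = 0%E.
  exact: (stick_integral_finite al01 (ltW th0) r1 f_int Y1oo).
split.
  move=> B mB; rewrite e1// e2//.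
  apply: (dirichlet_mean_unique th0 mX1 X10 _ X1fin r2 mB) => V Y r phi mphi phi0.
  exact: (dirichlet_step al01 th0 r0 r1 Y0oo Y1oo r mphi phi0).
split.
  have -> : [set w | ~ (Xat w \is a fin_num)] = Xat @^-1` [set +oo%E; -oo%E].
    apply/seteqP; split => w /=; first by case: (Xat w) => // _; [left|right].
    by case=> ->.
  have moo : measurable [set +oo%E; -oo%E : \bar R].
    by apply: measurableU; exact: emeasurable_set1.
  rewrite e1// -X1fin; congr (P1 _); apply/seteqP; split => w /=; last by left.
  by case=> // X1Noo; have := X10 w; rewrite /X1' X1Noo.
move=> A mA A0.
have -> : [set w | exists2 r, A r & Xat w = r%:E] = Xat @^-1` (EFin @` A).
  by apply/seteqP; split => w [x Ax xE]; exists x.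
rewrite e1; last exact: measurable_image_EFin.
rewrite -(stick_integral_abs_continuous r1 Y1oo _ mA A0).
  by congr (P1 _); apply/seteqP; split => w [x Ax xE]; exists x.
(* It remains to see that the law of f has no point of mass 1, which is non-constancy. *)
move=> c; rewrite /nu.
have -> : g @^-1` [set c%:E] = ~` [set x | f x != c].
  apply/seteqP; split => x /=; first by move=> [->]; rewrite eqxx.
  by move=> /negP/negPn/eqP fxc; rewrite /g fxc.
have mc : measurable [set x | f x != c].
  have -> : [set x | f x != c] = ~` (g @^-1` [set c%:E]).
    apply/seteqP; split => x /=; first by move=> /eqP h [].
    by move=> h; apply/eqP => fc; apply: h; rewrite /g fc.
  by apply: measurableC; apply: (measurable_preimageT mg); exact: emeasurable_set1.
rewrite probability_setC//.
have := fnc c.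
have /fineK <- : H [set x | f x != c] \is a fin_num by rewrite fin_num_measure.
by rewrite lte_fin -EFinB lte_fin => h; rewrite ltrBlDr ltrDl.
Qed.
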